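(* Consider the systems $$x_i'(t)=a_i(t,x_i(t))\Big[-b_i(t,x_i(t))+G_i\Big(\sum_{p=1}^{P}\sum_{j,l=1}^{n}c_{ijlp}(t)h_{ijlp}\big(x_j(t-\tau_{ijp}(t)),x_l(t-\tilde\tau_{ilp}(t))\big)\Big)+H_i\Big(\sum_{q=1}^{Q}\sum_{j,l=1}^{n}d_{ijlq}(t)f_{ijlq}\Big(\int_{-\infty}^0 g_{ijq}(x_j(t+s))\,d\eta_{ijq}(s),\int_{-\infty}^0\tilde g_{ilq}(x_l(t+s))\,d\tilde\eta_{ilq}(s)\Big)\Big)+I_i(t)\Big]\qquad (S)$$ and $$x_i'(t)=a_i(t,x_i(t))\Big[-\hat b_i(t,x_i(t))+G_i\Big(\sum_{p=1}^{P}\sum_{j,l=1}^{n}\hat c_{ijlp}(t)h_{ijlp}\big(x_j(t-\hat\tau_{ijp}(t)),x_l(t-\hat{\tilde\tau}_{ilp}(t))\big)\Big)+H_i\Big(\sum_{q=1}^{Q}\sum_{j,l=1}^{n}\hat d_{ijlq}(t)f_{ijlq}\Big(\int_{-\infty}^0 g_{ijq}(x_j(t+s))\,d\eta_{ijq}(s),\int_{-\infty}^0\tilde g_{ilq}(x_l(t+s))\,d\tilde\eta_{ilq}(s)\Big)\Big)+\hat I_i(t)\Big]\qquad (\hat S)$$ for $t\ge0$, $i=1,\dots,n$, with data as described in the context. Assume: (i) for each $i$ there is a continuous $\beta_i:[0,+\infty)\to[0,+\infty)$ such that $\frac{b_i(t,u)-b_i(t,v)}{u-v}\ge\beta_i(t)$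 for all $t\ge0$ and $u\ne v$ in $\mathbb{R}$; (ii) for each $i$, the partial derivative $\partial a_i/\partial t$ exists and there are $\underline a_i,\overline a_i>0$ and $A_i:[0,+\infty)\to\mathbb{R}$ such that $\underline a_i\le a_i(t,v)\le\overline a_i$ and $A_i(t)a_i^2(t,v)\le\frac{\partial}{\partial t}a_i(t,v)$ for all $t\ge0$, $v\in\mathbb{R}$; (iii) for each $i,j,l,p,q$ there are $\gamma^{(1)}_{ijlp},\gamma^{(2)}_{ijlp},\mu^{(1)}_{ijlq},\mu^{(2)}_{ijlq},\xi_{ijq},\tilde\xi_{ilq},\zeta_i,\varsigma_i>0$ such that, for all $u_1,u_2,v_1,v_2,u,v\in\mathbb{R}$, $|h_{ijlp}(u_1,u_2)-h_{ijlp}(v_1,v_2)|\le\gamma^{(1)}_{ijlp}|u_1-v_1|+\gamma^{(2)}_{ijlp}|u_2-v_2|$, $|f_{ijlq}(u_1,u_2)-f_{ijlq}(v_1,v_2)|\le\mu^{(1)}_{ijlq}|u_1-v_1|+\mu^{(2)}_{ijlq}|u_2-v_2|$, $|g_{ijq}(u)-g_{ijq}(v)|\le\xi_{ijq}|u-v|$, $|\tilde g_{ilq}(u)-\tilde g_{ilq}(v)|\le\tilde\xi_{ilq}|u-v|$, $|G_i(u)-G_i(v)|\le\zeta_i|u-v|$, $|H_i(u)-H_i(v)|\le\varsigma_i|u-v|$; (iv) there is $\omega>0$ such that, for all $i,j,l,p,q$ and $u\in\mathbb{R}$, the functions $a_i(\cdot,u)$, $\hat b_i(\cdot,u)$, $\hat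 c_{ijlp}$, $\hat d_{ijlq}$, $\hat\tau_{ijp}$, $\hat{\tilde\tau}_{ilp}$, $\hat I_i$ are $\omega$-periodic on $[0,+\infty)$; (v) for each $i$ there are $\omega$-periodic continuous functions $\hat\beta_i,\hat\beta_i^*:[0,+\infty)\to(0,+\infty)$ such that $\hat\beta_i(t)\le\frac{\hat b_i(t,u)-\hat b_i(t,v)}{u-v}\le\hat\beta_i^*(t)$ for all $t\in[0,\omega]$ and $u\ne v$ in $\mathbb{R}$; (vi) there is $d=(d_1,\dots,d_n)$ with all $d_i>0$ such that, for all $t\in[0,\omega]$ and $i=1,\dots,n$, $$\hat\beta_i(t)>\sum_{j,l=1}^{n}\Big[\sum_{p=1}^{P}\zeta_i|\hat c_{ijlp}(t)|\Big(\tfrac{d_j}{d_i}\gamma^{(1)}_{ijlp}+\tfrac{d_l}{d_i}\gamma^{(2)}_{ijlp}\Big)+\sum_{q=1}^{Q}\varsigma_i|\hat d_{ijlq}(t)|\Big(\tfrac{d_j}{d_i}\mu^{(1)}_{ijlq}\xi_{ijq}+\tfrac{d_l}{d_i}\mu^{(2)}_{ijlq}\tilde\xi_{ilq}\Big)\Big];$$ (vii) for all $i,j,l,p,q$ and every bounded continuous $w:\mathbb{R}\to\mathbb{R}$, each of $\beta_i(t)-\hat\beta_i(t)$, $b_i(t,w(t))-\hat b_i(t,w(t))$, $c_{ijlp}(t)-\hat c_{ijlp}(t)$, $d_{ijlq}(t)-\hat d_{ijlq}(t)$, $\tau_{ijp}(t)-\hat\tau_{ijp}(t)$, $\tilde\tau_{ilp}(t)-\hat{\tilde\tau}_{ilp}(t)$,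 $I_i(t)-\hat I_i(t)$ tends to $0$ as $t\to+\infty$; (viii) there is $d=(d_1,\dots,d_n)$ with all $d_i>0$ (not necessarily the one in (vi)) such that, for all $t\in[0,\omega]$ and $i=1,\dots,n$, $$-(\hat\beta_i(t)+A_i(t))\underline a_i+\sum_{j,l=1}^{n}\Big(\sum_{p=1}^{P}\zeta_i|\hat c_{ijlp}(t)|\Big(\gamma^{(1)}_{ijlp}\overline a_j\tfrac{d_j}{d_i}+\gamma^{(2)}_{ijlp}\overline a_l\tfrac{d_l}{d_i}\Big)+\sum_{q=1}^{Q}\varsigma_i|\hat d_{ijlq}(t)|\Big(\mu^{(1)}_{ijlq}\xi_{ijq}\overline a_j\tfrac{d_j}{d_i}+\mu^{(2)}_{ijlq}\tilde\xi_{ilq}\overline a_l\tfrac{d_l}{d_i}\Big)\Big)<0.$$ Then $(\hat S)$ has an $\omega$-periodic solution $\hat x(t)$, and every solution $x(t)$ of (S) with bounded initial condition satisfies $\lim_{t\to+\infty}|x(t)-\hat x(t)|=0$.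
   Context: $n,P,Q\in\mathbb{N}$; indices $i,j,l$ range over $\{1,\dots,n\}$, $p$ over $\{1,\dots,P\}$, $q$ over $\{1,\dots,Q\}$. The functions $a_i:[0,+\infty)\times\mathbb{R}\to(0,+\infty)$, $b_i,\hat b_i:[0,+\infty)\times\mathbb{R}\to\mathbb{R}$, $c_{ijlp},\hat c_{ijlp},d_{ijlq},\hat d_{ijlq},I_i,\hat I_i:[0,+\infty)\to\mathbb{R}$, $\tau_{ijp},\tilde\tau_{ilp},\hat\tau_{ijp},\hat{\tilde\tau}_{ilp}:[0,+\infty)\to[0,+\infty)$, $G_i,H_i:\mathbb{R}\to\mathbb{R}$, $h_{ijlp},f_{ijlq}:\mathbb{R}^2\to\mathbb{R}$, $g_{ijq},\tilde g_{ilq}:\mathbb{R}\to\mathbb{R}$ are continuous, and $\eta_{ijq},\tilde\eta_{ilq}:(-\infty,0]\to\mathbb{R}$ are non-decreasing bounded functions with $\eta_{ijq}(0)-\eta_{ijq}(-\infty)=\tilde\eta_{ilq}(0)-\tilde\eta_{ilq}(-\infty)=1$, where $\eta(-\infty)=\lim_{s\to-\infty}\eta(s)$; integrals against them are Stieltjes integrals. $|\cdot|$ is the maximum norm on $\mathbb{R}^n$. $BC$ is the space of bounded continuous functions $\phi:(-\infty,0]\to\mathbb{R}^n$; $x_t(s)=x(t+s)$ for $s\le0$. A solution with bounded initial condition is a continuous function $x$ on an interval $(-\infty,t^* )$ such that, for some $t_0\ge0$ and $\phi\in BC$, $t_0<t^*\le+\infty$, $x_{t_0}=\phi$, and $x$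 is continuously differentiable and satisfies the system on $[t_0,t^* )$ (one-sided derivative at $t_0$). Solutions are understood to be noncontinuable (maximal); under the hypotheses they are defined on $\mathbb{R}$. An $\omega$-periodic solution is a function $\hat x:\mathbb{R}\to\mathbb{R}^n$ with $\hat x(t+\omega)=\hat x(t)$ for all $t$ that satisfies the system for $t\ge0$. *)

(* Defs.v *)
From mathcomp Require Import all_boot all_order all_algebra.
From mathcomp Require Import all_classical all_reals all_analysis.

Set Implicit Arguments.
Unset Strict Implicit.
Unset Printing Implicit Defensive.

Import Order.TTheory GRing.Theory Num.Theory.
Import numFieldNormedType.Exports.

Local Open Scope classical_set_scope.
Local Open Scope ring_scope.

(* Functions on [0, +oo) or (-oo, 0] are total functions on R of which only
   the values on that half-line are constrained. *)

Definition continuous_nonneg (R : realType) (f : R -> R) : Prop :=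
  {within `[0, +oo[, continuous f}.

Definition continuous_nonneg2 (R : realType) (f : R -> R -> R) : Prop :=
  {within `[0, +oo[ `*` setT, continuous (fun z : R * R => f z.1 z.2)}.

Definition periodic_nonneg (R : realType) (omega : R) (f : R -> R) : Prop :=
  forall t, 0 <= t -> f (t + omega) = f t.

Definition vanishes_at_infty (R : realType) (f : R -> R) : Prop :=
  f t @[t --> +oo] --> (0 : R).

(* The derivative of f at t relative to D: one-sided at an endpoint of an
   interval D, two-sided at its interior points. *)
Definition has_deriv_within (R : realType) (D : set R) (f : R -> R) (t l : R)
  : Prop :=
  (fun s => (f s - f t) / (s - t)) @ within D t^' --> l.

(* I is the Riemann-Stieltjes integral of f against eta over [a, b], as the
   limit of the sums over tagged partitions when the mesh tends to 0; the
   partition points are s 0 <= ... <= s N and the tags xi 0, ..., xi N.-1. *)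
Definition is_RSint (R : realType) (f eta : R -> R) (a b I : R) : Prop :=
  forall eps : R, 0 < eps -> exists2 delta : R, 0 < delta &
    forall (N : nat) (s xi : nat -> R),
      s 0%N = a -> s N = b ->
      (forall k, (k < N)%N ->
         [/\ s k <= xi k, xi k <= s k.+1 & s k.+1 - s k < delta]) ->
      `| \sum_(k < N) f (xi k) * (eta (s k.+1) - eta (s k)) - I | < eps.

(* The improper integral over (-oo, 0], as the limit of the integrals over
   [a, 0] when a tends to -oo. *)
Definition is_RSint_neg (R : realType) (f eta : R -> R) (I : R) : Prop :=
  exists2 J : R -> R, (forall a, a <= 0 -> is_RSint f eta a 0 (J a)) &
    J a @[a --> -oo] --> I.

(* Equal to 0 when the integral does not exist, which does not happen when f
   is continuous and bounded and eta is monotone and bounded. *)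
Definition RSint_neg (R : realType) (f eta : R -> R) : R :=
  xget 0 [set I | is_RSint_neg f eta I].

Definition stieltjes_weight (R : realType) (eta : R -> R) : Prop :=
  [/\ forall s t, s <= t -> t <= 0 -> eta s <= eta t,
      exists M, forall s, s <= 0 -> `|eta s| <= M &
      exists2 l, eta s @[s --> -oo] --> l & eta 0 - l = 1].

Section System.
Variables (R : realType) (n P Q : nat).

(* The i-th component, at time t, of the right-hand side of the system. *)
Definition network_rhs
    (a b : 'I_n -> R -> R -> R)
    (c : 'I_n -> 'I_n -> 'I_n -> 'I_P -> R -> R)
    (d : 'I_n -> 'I_n -> 'I_n -> 'I_Q -> R -> R)
    (tau ttau : 'I_n -> 'I_n -> 'I_P -> R -> R)
    (I : 'I_n -> R -> R)
    (G H : 'I_n -> R -> R)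
    (h : 'I_n -> 'I_n -> 'I_n -> 'I_P -> R -> R -> R)
    (f : 'I_n -> 'I_n -> 'I_n -> 'I_Q -> R -> R -> R)
    (g tg eta teta : 'I_n -> 'I_n -> 'I_Q -> R -> R)
    (x : R -> 'rV[R]_n) (t : R) (i : 'I_n) : R :=
  a i t (x t 0 i) *
  (- b i t (x t 0 i)
   + G i (\sum_(p < P) \sum_(j < n) \sum_(l < n)
            c i j l p t *
            h i j l p (x (t - tau i j p t) 0 j) (x (t - ttau i l p t) 0 l))
   + H i (\sum_(q < Q) \sum_(j < n) \sum_(l < n)
            d i j l q t *
            f i j l q
              (RSint_neg (fun s => g i j q (x (t + s) 0 j)) (eta i j q))
              (RSint_neg (fun s => tg i l q (x (t + s) 0 l)) (teta i l q)))
   + I i t).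

Implicit Types (F : (R -> 'rV[R]_n) -> R -> 'I_n -> R) (x : R -> 'rV[R]_n).

(* x is a solution of x' = F x on [t0, tstar) with bounded continuous initial
   condition at t0; only the values of x on (-oo, tstar) matter. *)
Definition is_solution F (t0 : R) (tstar : \bar R) x : Prop :=
  [/\ 0 <= t0, (t0%:E < tstar)%E,
      {within [set t : R | (t%:E < tstar)%E], continuous x},
      exists M, forall t, t <= t0 -> `|x t| <= M &
      let D := [set t : R | t0 <= t /\ (t%:E < tstar)%E] in
      exists2 dx : R -> 'rV[R]_n, {within D, continuous dx} &
        forall t, D t -> forall i,
          has_deriv_within D (fun s => x s 0 i) t (dx t 0 i) /\
          dx t 0 i = F x t i].

Definition noncontinuable_solution F (t0 : R) (tstar : \bar R) x : Prop :=
  is_solution F t0 tstar x /\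
  ~ (exists tstar' y, [/\ (tstar < tstar')%E, is_solution F t0 tstar' y &
       forall t : R, (t%:E < tstar)%E -> y t = x t]).

Definition periodic_solution F (omega : R) x : Prop :=
  (forall t, x (t + omega) = x t) /\ is_solution F 0 +oo%E x.

End System.

(* Main.v *)
(* Under (vi) the weighted sup norm gives an invariant box for the periodic
   system, and a bounded envelope for the perturbed one, so solutions are global
   and bounded. For two bounded solutions x and y of asymptotically periodic
   perturbations of the periodic system, put
   V_i(t) = |int_{y_i(t)}^{x_i(t)} du / a_i(t, u)|. If v = limsup max_i V_i / w_i
   were positive, a limit of translates along times realizing v would give two
   exact solutions for which V_i / w_i <= v throughout the past with equality at
   one time; (ii) and (viii) make the left derivative of V_i negative there, a
   contradiction. Hence x - y --> 0. Applied to a bounded solution z of the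
   periodic system and its translate by omega, this makes every limit of the
   translates z(. + k omega) a periodic solution; applied to that solution and a
   solution of (S), it gives the convergence. *)

Require Import Defs.
From mathcomp Require Import all_boot all_order all_algebra.
From mathcomp Require Import all_classical all_reals all_analysis.
From mathcomp Require Import ring lra zify.

Import Order.TTheory GRing.Theory Num.Theory.
Import numFieldNormedType.Exports.

Local Open Scope classical_set_scope.
Local Open Scope ring_scope.
Set Implicit Arguments.
Unset Strict Implicit.
Unset Printing Implicit Defensive.


(** The integral V_i is chosen because differentiating it along solutions cancels the factor a_i.
    What is left is the difference of the two brackets plus the integral of the time derivative of 1
    / a_i, which (ii) bounds above by - A_i (x_i - y_i) when x_i >= y_i. The obstacle is that A_i is
    an arbitrary function, not assumed bounded or measurable. So V_i is never differentiated: at the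
    maximal time only its left difference quotients are estimated from above. The one bound this
    needs comes from (viii) itself, which forces - A_i < hat beta_i. Since the delays reach back to
    - oo, a comparison at a finite time still involves the initial histories, where V_i is not
    controlled by v; they disappear only in the limit of translates. Limits are taken along a free
    ultrafilter: bounded functions then converge at all times at once, and eventual Lipschitz bounds
    make the convergence locally uniform. The right-hand side is continuous for this convergence on
    bounded histories because a Stieltjes weight has small mass far in the past. *)

Section UniformContinuity.
Context {R : realType}.

Lemma unif_continuous_itv (g : R -> R) a b e : continuous g -> 0 < e ->
  exists2 d, 0 < d & forall x y, a <= x <= b -> `|x - y| < d ->
    `|g x - g y| <= e.
Proof.
move=> cg e0.
have /compact_near_coveringP/(_ R 0^'+ (fun d x => forall y, `|x - y| < d ->
  `|g x - g y| <= e)) : compact `[a, b] by exact: segment_compact.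
case.
  move=> x _; have e20 : 0 < e / 2 by rewrite divr_gt0.
  have /cvgrPdist_le/(_ _ e20)/nbhs_ballP[r /= r0 hr] := cg x.
  have r20 : 0 < r / 2 by rewrite divr_gt0.
  exists (ball x (r / 2), [set d | d <= r / 2]) => /=.
    split; first exact: nbhsx_ballx.
    by near=> d; near: d; exact: nbhs_right_le.
  move=> [x' d] /= [bx' dr] y xy.
  have h1 : `|g x - g x'| <= e / 2.
    by apply: hr; apply: le_ball bx'; lra.
  have h2 : `|g x - g y| <= e / 2.
    apply: hr; rewrite /ball/=; apply: le_lt_trans (ler_distD x' _ _) _.
    by move: bx'; rewrite /ball/=; lra.
  rewrite (le_trans (ler_distD (g x) _ _))// (distrC (g x')).
  by rewrite (le_trans (lerD h1 h2))// -splitr.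
move=> r /= r0 hr; exists (r / 2); first by rewrite divr_gt0.
move=> x y xab xy; apply: (hr (r / 2)) => //=; rewrite ?in_itv//= ?divr_gt0//.
by rewrite sub0r normrN gtr0_norm ?divr_gt0// ltr_pdivrMr// ltr_pMr// ltr1n.
Unshelve. all: by end_near. Qed.

End UniformContinuity.

(** * Riemann-Stieltjes integrals over compact intervals *)

Section RiemannStieltjes.
Context {R : realType}.
Implicit Types (f eta : R -> R) (a b : R) (s xi : nat -> R).

Definition tagged_partition a b (delta : R) (N : nat) s xi :=
  [/\ s 0%N = a, s N = b &
     forall k, (k < N)%N ->
       [/\ s k <= xi k, xi k <= s k.+1 & s k.+1 - s k < delta]].

Definition RS_sum f eta (N : nat) s xi : R :=
  \sum_(k < N) f (xi k) * (eta (s k.+1) - eta (s k)).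

Lemma partition_bounds a b delta N s xi : tagged_partition a b delta N s xi ->
  forall k, (k <= N)%N -> a <= s k <= b.
Proof.
move=> [s0 sN sP].
have step k : (k < N)%N -> s k <= s k.+1.
  by move=> /sP[h1 h2 _]; exact: le_trans h1 h2.
have up k : (k <= N)%N -> a <= s k.
  elim: k => [_|k IH kN]; first by rewrite s0.
  by rewrite (le_trans (IH (ltnW kN)))// step.
have down k : (k <= N)%N -> s (N - k)%N <= b.
  elim: k => [_|k IH kN]; first by rewrite subn0 sN.
  apply: le_trans (IH (ltnW kN)).
  by rewrite -(subnSK kN); apply: step; rewrite ltn_subrL; lia.
move=> k kN; rewrite up//=.
by have := down (N - k)%N (leq_subr _ _); rewrite subKn.
Qed.

Lemma partition_mono a b delta N s xi k : tagged_partition a b delta N s xi ->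
  (k < N)%N -> s k <= s k.+1.
Proof. by move=> [_ _ sP] /sP[h1 h2 _]; exact: le_trans h1 h2. Qed.

Lemma partition_tag a b delta N s xi k : tagged_partition a b delta N s xi ->
  (k < N)%N -> a <= xi k <= b.
Proof.
move=> sP kN; have [_ _ /(_ _ kN)[h1 h2 _]] := sP.
have /andP[h3 _] := partition_bounds sP (ltnW kN).
have /andP[_ h4] := partition_bounds sP kN.
by rewrite (le_trans h3 h1) (le_trans h2 h4).
Qed.

Lemma uniform_partition a b delta : a <= b -> 0 < delta ->
  exists N s xi, tagged_partition a b delta N s xi.
Proof.
move=> ab d0.
pose N := (Num.bound ((b - a) / delta)).+1.
have N0 : (N%:R : R) != 0 by rewrite pnatr_eq0.
have hstep k : (k.+1%:R : R) = k%:R + 1 by rewrite -natr1.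
have hk k : a + k.+1%:R * ((b - a) / N%:R) - (a + k%:R * ((b - a) / N%:R)) =
   (b - a) / N%:R by rewrite hstep; ring.
pose s k := a + k%:R * ((b - a) / N%:R).
have sS k : s k <= s k.+1.
  by rewrite -subr_ge0 hk divr_ge0// subr_ge0.
exists N, s, s; split => [||k kN].
- by rewrite /s mul0r addr0.
- by rewrite /s; field.
split => //; rewrite hk ltr_pdivrMr ?ltr0n// mulrC -ltr_pdivrMr//.
apply: lt_le_trans (archi_boundP _) _; first by rewrite divr_ge0 ?subr_ge0 ?(ltW d0).
by rewrite ler_nat.
Qed.

(** Used twice: to intersect the cells of two partitions, and later to truncate histories to a
    box. *)
Definition clamp (l u x : R) := Num.max l (Num.min x u).

(** The m-th term is the increment of [eta] over the part of the m-th cell that lies left of [x], so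
    the partial sums telescope. *)
Lemma sum_clamp_partition eta a b delta M r ze x : a <= b ->
  tagged_partition a b delta M r ze -> a <= x <= b ->
  \sum_(m < M) (eta (clamp (r m) (r m.+1) x) - eta (r m)) = eta x - eta a.
Proof.
move=> ab rP /andP[ax xb].
have H K : (K <= M)%N ->
  \sum_(m < K) (eta (clamp (r m) (r m.+1) x) - eta (r m)) =
  eta (Num.min x (r K)) - eta a.
  elim: K => [_|K IH KM].
    by rewrite big_ord0; have [-> _ _] := rP; rewrite min_r// subrr.
  rewrite big_ord_recr/= IH 1?ltnW//.
  have rK := partition_mono rP KM.
  rewrite /clamp; have [xr|rx] := leP x (r K).
    have -> : Num.min x (r K.+1) = x by apply/min_l/(le_trans xr).
    by rewrite max_l//; ring.
  rewrite max_r; first by ring.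
  by rewrite le_min rK (ltW rx).
by rewrite H//; have [_ -> _] := rP; rewrite min_l.
Qed.

Section Cauchy.
Variables (f eta : R -> R) (a b : R).
Hypothesis ab : a <= b.
Hypothesis eta_mono : forall x y, a <= x -> x <= y -> y <= b -> eta x <= eta y.

(** No common refinement is sorted out: [D k m] is the increment of [eta] over the intersection of
    the k-th cell of one partition with the m-th cell of the other. It vanishes when the two cells
    do not overlap; when they do, their tags are less than [2 * delta] apart. *)
Lemma RS_sum_dist delta e N s xi M r ze :
  (forall x y, a <= x <= b -> a <= y <= b -> `|x - y| < 2 * delta ->
     `|f x - f y| <= e) ->
  tagged_partition a b delta N s xi -> tagged_partition a b delta M r ze ->
  `|RS_sum f eta N s xi - RS_sum f eta M r ze| <= e * (eta b - eta a).
Proof.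
move=> osc sP rP.
have sb k := @partition_bounds _ _ _ _ _ _ sP k.
have rb k := @partition_bounds _ _ _ _ _ _ rP k.
pose D k m := eta (clamp (r m) (r m.+1) (s k.+1)) -
              eta (clamp (r m) (r m.+1) (s k)).
have clb (m : 'I_M) x : a <= x <= b ->
    r m <= clamp (r m) (r m.+1) x <= r m.+1.
  move=> /andP[ax xb]; rewrite /clamp le_max lexx/= ge_max ge_min lexx orbT.
  by rewrite andbT; exact: partition_mono rP (ltn_ord m).
have D0 (k : 'I_N) (m : 'I_M) : 0 <= D k m.
  have /andP[h1 h2] := clb m _ (sb _ (ltnW (ltn_ord k))).
  have /andP[h3 h4] := clb m _ (sb _ (ltn_ord k)).
  have /andP[h5 _] := rb _ (ltnW (ltn_ord m)).
  have /andP[_ h6] := rb _ (ltn_ord m).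
  rewrite subr_ge0; apply: eta_mono.
  - exact: le_trans h5 h1.
  - rewrite /clamp ge_max le_max lexx/= le_max; apply/orP; right.
    rewrite le_min !ge_min lexx (partition_mono sP (ltn_ord k)).
    by rewrite orbT.
  - exact: le_trans h4 h6.
have Sk (k : 'I_N) : \sum_(m < M) D k m = eta (s k.+1) - eta (s k).
  have h1 := sum_clamp_partition eta ab rP (sb _ (ltnW (ltn_ord k))).
  have h2 := sum_clamp_partition eta ab rP (sb _ (ltn_ord k)).
  transitivity (eta (s k.+1) - eta a - (eta (s k) - eta a)); last by ring.
  by rewrite -h1 -h2 -sumrB; apply: eq_bigr => m _; rewrite /D; ring.
have Sm (m : 'I_M) : \sum_(k < N) D k m = eta (r m.+1) - eta (r m).
  have -> : \sum_(k < N) D k m = \sum_(0 <= k < N)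
      (eta (clamp (r m) (r m.+1) (s k.+1)) - eta (clamp (r m) (r m.+1) (s k))).
    by rewrite big_mkord.
  rewrite telescope_sumr//.
  have [-> -> _] := sP.
  have /andP[h5 _] := rb _ (ltnW (ltn_ord m)).
  have /andP[_ h6] := rb _ (ltn_ord m).
  have h7 := partition_mono rP (ltn_ord m).
  rewrite /clamp (min_r h6) (max_r h7).
  by rewrite (min_l (le_trans h5 h7)) (max_l h5).
have -> : RS_sum f eta N s xi - RS_sum f eta M r ze =
    \sum_(k < N) \sum_(m < M) (f (xi k) - f (ze m)) * D k m.
  rewrite /RS_sum.
  under [X in X - _]eq_bigr => k _ do rewrite -Sk mulr_sumr.
  under [X in _ - X]eq_bigr => m _ do rewrite -Sm mulr_sumr.
  rewrite [X in _ - X]exchange_big/= -sumrB; apply: eq_bigr => k _.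
  by rewrite -sumrB; apply: eq_bigr => m _; rewrite mulrBl.
have -> : e * (eta b - eta a) = \sum_(k < N) \sum_(m < M) e * D k m.
  under eq_bigr => k _ do rewrite -mulr_sumr Sk.
  rewrite -mulr_sumr; congr (_ * _).
  rewrite -(big_mkord xpredT (fun k => eta (s k.+1) - eta (s k))).
  rewrite telescope_sumr//.
  by have [-> -> _] := sP.
apply: le_trans (ler_norm_sum _ _ _) _; apply: ler_sum => k _.
apply: le_trans (ler_norm_sum _ _ _) _; apply: ler_sum => m _.
rewrite normrM (ger0_norm (D0 k m)).
have [h1 h2 h3] : [/\ s k <= xi k, xi k <= s k.+1 & s k.+1 - s k < delta].
  by have [_ _ /(_ k (ltn_ord k))] := sP.
have [h4 h5 h6] : [/\ r m <= ze m, ze m <= r m.+1 & r m.+1 - r m < delta].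
  by have [_ _ /(_ m (ltn_ord m))] := rP.
have [sr|rs] := leP (s k.+1) (r m).
  suff -> : D k m = 0 by rewrite !mulr0.
  have e1 x : x <= r m -> clamp (r m) (r m.+1) x = r m.
    by move=> xr; rewrite /clamp max_l// ge_min xr.
  by rewrite /D !e1 ?subrr//; lra.
have [rs'|sr'] := leP (r m.+1) (s k).
  suff -> : D k m = 0 by rewrite !mulr0.
  have e1 x : r m.+1 <= x -> clamp (r m) (r m.+1) x = r m.+1.
    by move=> xr; rewrite /clamp (min_r xr) max_r//; lra.
  by rewrite /D !e1 ?subrr//; lra.
apply: ler_wpM2r => //; apply: osc.
- exact: partition_tag sP (ltn_ord k).
- exact: partition_tag rP (ltn_ord m).
- by rewrite ltr_norml; apply/andP; split; lra.
Qed.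

End Cauchy.

Let minr_lel (x y : R) : Num.min x y <= x. Proof. by rewrite ge_min lexx. Qed.
Let minr_ler (x y : R) : Num.min x y <= y. Proof. by rewrite ge_min lexx orbT. Qed.

(** The standard choice of tolerance below: to absorb a factor [X] that may be zero, the budget [u]
    is divided by [X + 1]. *)
Lemma frac_le (u X : R) : 0 <= u -> 0 <= X -> u / (X + 1) * X <= u.
Proof.
move=> u0 X0; rewrite mulrAC ler_pdivrMr ?ltr_wpDl// ler_wpM2l// lerDl.
exact: ler01.
Qed.

Lemma tagged_partition_le a b d d' N s xi : d <= d' ->
  tagged_partition a b d N s xi -> tagged_partition a b d' N s xi.
Proof.
move=> dd [s0 sN sP]; split=> // k /sP[h1 h2 h3]; split=> //.
exact: lt_le_trans dd.
Qed.

Lemma is_RSintP f eta a b I : is_RSint f eta a b I <->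
  forall e, 0 < e -> exists2 d, 0 < d & forall N s xi,
    tagged_partition a b d N s xi -> `|RS_sum f eta N s xi - I| < e.
Proof.
split=> H e /H[d d0 h]; exists d => // N s xi; first by case; exact: h.
by move=> s0 sN sP; apply: h; split.
Qed.

Lemma RSint_exists f eta a b : a <= b ->
  (forall x y, a <= x -> x <= y -> y <= b -> eta x <= eta y) ->
  (forall e, 0 < e -> exists2 d, 0 < d & forall x y, a <= x <= b ->
     a <= y <= b -> `|x - y| < d -> `|f x - f y| <= e) ->
  exists I, is_RSint f eta a b I.
Proof.
move=> ab mono unif.
have eta0 : 0 <= eta b - eta a by rewrite subr_ge0 mono.
have close e : 0 < e -> exists2 d, 0 < d & forall N s xi M r ze,
    tagged_partition a b d N s xi -> tagged_partition a b d M r ze ->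
    `|RS_sum f eta N s xi - RS_sum f eta M r ze| <= e.
  move=> e0; pose e' := e / (eta b - eta a + 1).
  have e'0 : 0 < e' by rewrite divr_gt0// ltr_wpDl.
  have [d d0 hd] := unif _ e'0.
  (* Halved because [RS_sum_dist] compares tags up to twice the mesh apart. *)
  exists (d / 2); first by rewrite divr_gt0.
  move=> N s xi M r ze P1 P2.
  apply: le_trans (RS_sum_dist (delta := d / 2) (e := e') ab mono _ P1 P2) _.
    by move=> x y ? ? xy; apply: hd => //; move: xy; rewrite mulrCA divff// mulr1.
  by rewrite /e' frac_le// ltW.
(* The supremum of the lower bounds valid for all sufficiently fine partitions is the lower limit of
   the sums; by [close] it is their limit. *)
pose L := [set x | exists2 d, 0 < d & forall N s xi,
  tagged_partition a b d N s xi -> x <= RS_sum f eta N s xi].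
have Lin e d N s xi : (forall M r ze, tagged_partition a b d M r ze ->
    `|RS_sum f eta N s xi - RS_sum f eta M r ze| <= e) -> 0 < d ->
    L (RS_sum f eta N s xi - e).
  move=> h d0; exists d => // M r ze /h; rewrite ler_norml => /andP[_]; lra.
have Lub e d N s xi x : (forall M r ze, tagged_partition a b d M r ze ->
    `|RS_sum f eta N s xi - RS_sum f eta M r ze| <= e) -> 0 < d ->
    L x -> x <= RS_sum f eta N s xi + e.
  move=> h d0 [d' d'0 h'].
  have [M [r [ze P]]] : exists M r ze, tagged_partition a b (Num.min d d') M r ze.
    by apply: uniform_partition => //; rewrite lt_min d0.
  have := h _ _ _ (tagged_partition_le (minr_lel _ _) P).
  have := h' _ _ _ (tagged_partition_le (minr_ler _ _) P).
  by move=> h1; rewrite ler_norml => /andP[h2 _]; lra.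
have [d1 d10 hd1] := close 1 ltr01.
have [N1 [s1 [xi1 P1]]] := uniform_partition ab d10.
have supL : has_sup L.
  split; first by exists (RS_sum f eta N1 s1 xi1 - 1); apply: Lin d10 => *; exact: hd1.
  exists (RS_sum f eta N1 s1 xi1 + 1) => x; apply: Lub d10 => *; exact: hd1.
exists (sup L); apply/is_RSintP => e e0.
have e20 : 0 < e / 2 by rewrite divr_gt0.
have [d d0 hd] := close _ e20; exists d => // N s xi P.
apply: (@le_lt_trans _ _ (e / 2)); last by rewrite ltr_pdivrMr// ltr_pMr// ltr1n.
rewrite ler_norml; apply/andP; split.
  suff : sup L <= RS_sum f eta N s xi + e / 2 by lra.
  apply: ge_sup; first by case: supL.
  by move=> x; apply: Lub d0 => *; exact: hd.
suff : RS_sum f eta N s xi - e / 2 <= sup L by lra.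
apply: ub_le_sup; first by case: supL.
by apply: Lin d0 => *; exact: hd.
Qed.

Lemma RSint_unique f eta a b I J : a <= b -> is_RSint f eta a b I ->
  is_RSint f eta a b J -> I = J.
Proof.
move=> ab /is_RSintP hI /is_RSintP hJ; apply/eqP; rewrite -subr_eq0 -normr_le0.
apply/ler_addgt0Pl => e e0; rewrite addr0.
have e20 : 0 < e / 2 by rewrite divr_gt0.
have [d d0 hd] := hI _ e20; have [d' d'0 hd'] := hJ _ e20.
have [M [r [ze P]]] : exists M r ze, tagged_partition a b (Num.min d d') M r ze.
  by apply: uniform_partition => //; rewrite lt_min d0.
have := hd _ _ _ (tagged_partition_le (minr_lel _ _) P).
have := hd' _ _ _ (tagged_partition_le (minr_ler _ _) P).
rewrite !ltr_norml => /andP[? ?] /andP[? ?].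
by rewrite ler_norml; apply/andP; split; lra.
Qed.

Lemma RSintB f f' eta a b I J : is_RSint f eta a b I ->
  is_RSint f' eta a b J -> is_RSint (fun x => f x - f' x) eta a b (I - J).
Proof.
move=> /is_RSintP hI /is_RSintP hJ; apply/is_RSintP => e e0.
have e20 : 0 < e / 2 by rewrite divr_gt0.
have [d d0 hd] := hI _ e20; have [d' d'0 hd'] := hJ _ e20.
exists (Num.min d d') => [|N s xi P]; first by rewrite lt_min d0.
have := hd _ _ _ (tagged_partition_le (minr_lel _ _) P).
have := hd' _ _ _ (tagged_partition_le (minr_ler _ _) P).
have -> : RS_sum (fun x => f x - f' x) eta N s xi =
    RS_sum f eta N s xi - RS_sum f' eta N s xi.
  by rewrite -sumrB; apply: eq_bigr => k _; rewrite mulrBl.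
rewrite !ltr_norml => /andP[? ?] /andP[? ?]; apply/andP; split; lra.
Qed.

Lemma RS_sum_le f eta a b d N s xi C : a <= b ->
  (forall x y, a <= x -> x <= y -> y <= b -> eta x <= eta y) ->
  (forall x, a <= x <= b -> `|f x| <= C) ->
  tagged_partition a b d N s xi ->
  `|RS_sum f eta N s xi| <= C * (eta b - eta a).
Proof.
move=> ab mono fC P.
have -> : C * (eta b - eta a) = \sum_(k < N) C * (eta (s k.+1) - eta (s k)).
  rewrite -mulr_sumr -(big_mkord xpredT (fun k => eta (s k.+1) - eta (s k))).
  by rewrite telescope_sumr//; case: P => -> ->.
apply: le_trans (ler_norm_sum _ _ _) _; apply: ler_sum => k _.
have /andP[h1 _] := partition_bounds P (ltnW (ltn_ord k)).
have /andP[_ h2] := partition_bounds P (ltn_ord k).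
have h3 := partition_mono P (ltn_ord k).
have e0 : 0 <= eta (s k.+1) - eta (s k) by rewrite subr_ge0 mono.
rewrite normrM (ger0_norm e0) ler_wpM2r//.
exact/fC/(partition_tag P).
Qed.

Lemma RSint_le f eta a b I C : a <= b ->
  (forall x y, a <= x -> x <= y -> y <= b -> eta x <= eta y) ->
  (forall x, a <= x <= b -> `|f x| <= C) -> is_RSint f eta a b I ->
  `|I| <= C * (eta b - eta a).
Proof.
move=> ab mono fC /is_RSintP hI.
apply/ler_addgt0Pl => e e0; have [d d0 hd] := hI _ e0.
have [M [r [ze P]]] := uniform_partition ab d0.
have := hd _ _ _ P; have := RS_sum_le ab mono fC P.
have := ler_distD (RS_sum f eta M r ze) I 0.
by rewrite !subr0 (distrC I); lra.
Qed.

(** Pushing the points of a partition of [a, b] up to at least [a'] gives a partition of [a', b],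
    and [etaE] splits each increment of [eta] at [a']. The upper parts differ only by the displaced
    tag of a cell straddling [a']; the lower parts have total mass [eta a' - eta a]. *)
Lemma RSint_tail f eta a a' b I I' C : a <= a' -> a' <= b ->
  (forall x y, a <= x -> x <= y -> y <= b -> eta x <= eta y) ->
  (forall e, 0 < e -> exists2 d, 0 < d & forall x y, a <= x <= b ->
     a <= y <= b -> `|x - y| < d -> `|f x - f y| <= e) ->
  (forall x, a <= x <= b -> `|f x| <= C) ->
  is_RSint f eta a b I -> is_RSint f eta a' b I' ->
  `|I - I'| <= C * (eta a' - eta a).
Proof.
move=> aa' a'b mono unif fC /is_RSintP hI /is_RSintP hI'.
have ab := le_trans aa' a'b.
have eta0 : 0 <= eta b - eta a' by rewrite subr_ge0 mono.
apply/ler_addgt0Pl => e e0.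
have e30 : 0 < e / 3 by rewrite divr_gt0.
have e40 : 0 < e / 3 / (eta b - eta a' + 1) by rewrite divr_gt0// ltr_wpDl.
have [d d0 hd] := hI _ e30; have [d' d'0 hd'] := hI' _ e30.
have [d2 d20 hd2] := unif _ e40.
have [N [s [xi P]]] : exists N s xi,
    tagged_partition a b (Num.min (Num.min d d') d2) N s xi.
  by apply: uniform_partition => //; rewrite !lt_min d0 d'0.
have Pd : tagged_partition a b d N s xi.
  by apply: tagged_partition_le P; rewrite !ge_min lexx.
pose s' k := Num.max a' (s k); pose xi' k := Num.max a' (xi k).
have P' dd : tagged_partition a b dd N s xi -> tagged_partition a' b dd N s' xi'.
  case=> s0 sN sP; split=> [||k kN]; rewrite /s' /xi'.
  - by rewrite s0 max_l.
  - by rewrite sN max_r.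
  have [h1 h2 h3] := sP _ kN; split; rewrite ?ge_max ?le_max ?lexx ?h1 ?h2 ?orbT//.
  by apply: le_lt_trans h3; have := le_trans h1 h2; clear; rewrite /Num.max; do 2 case: ifPn; lra.
have P'd : tagged_partition a' b d' N s' xi'.
  by apply/P'/tagged_partition_le/P; rewrite !ge_min lexx orbT.
pose s2 k := Num.min a' (s k).
have etaE x : eta x = eta (Num.max a' x) + eta (Num.min a' x) - eta a'.
  by rewrite /Num.max /Num.min; case: ifPn => _; ring.
have sumE : RS_sum f eta N s xi - RS_sum f eta N s' xi' =
   \sum_(k < N) ((f (xi k) - f (xi' k)) * (eta (s' k.+1) - eta (s' k))
   + f (xi k) * (eta (s2 k.+1) - eta (s2 k))).
  rewrite -sumrB; apply: eq_bigr => k _.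
  by rewrite (etaE (s k)) (etaE (s k.+1)) /s' /s2; ring.
have tele (t : nat -> R) : \sum_(k < N) (eta (t k.+1) - eta (t k)) =
    eta (t N) - eta (t 0%N).
  by rewrite -(big_mkord xpredT (fun k => eta (t k.+1) - eta (t k))) telescope_sumr.
have mono2 k : (k < N)%N -> [/\ 0 <= eta (s' k.+1) - eta (s' k) &
     0 <= eta (s2 k.+1) - eta (s2 k)].
  move=> kN; have h1 := partition_mono P kN.
  have /andP[h2 h3] := partition_bounds P kN.
  have /andP[h4 h5] := partition_bounds P (ltnW kN).
  rewrite /s' /s2 !subr_ge0; split; apply: mono.
  - by rewrite le_max aa'.
  - by rewrite ge_max !le_max lexx h1 orbT.
  - by rewrite ge_max a'b.
  - by rewrite le_min aa'.
  - by rewrite le_min !ge_min lexx h1 orbT.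
  - by rewrite ge_min a'b.
have : `|RS_sum f eta N s xi - RS_sum f eta N s' xi'| <=
    e / 3 + C * (eta a' - eta a).
  rewrite sumE.
  apply: (@le_trans _ _ (\sum_(k < N)
    (e / 3 / (eta b - eta a' + 1) * (eta (s' k.+1) - eta (s' k))
    + C * (eta (s2 k.+1) - eta (s2 k))))).
    apply: le_trans (ler_norm_sum _ _ _) _; apply: ler_sum => k _.
    have [h1 h2] := mono2 _ (ltn_ord k).
    apply: le_trans (ler_normD _ _) _; rewrite !normrM (ger0_norm h1) (ger0_norm h2).
    have xib := partition_tag P (ltn_ord k).
    apply: lerD; last by rewrite ler_wpM2r// fC.
    have [_ _ /(_ _ (ltn_ord k))[h3 h4]] := P; rewrite !lt_min -andbA => /and3P[_ _ h5].
    have [sa|sa] := leP (s k.+1) a'.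
      suff -> : eta (s' k.+1) - eta (s' k) = 0 by rewrite !mulr0.
      by rewrite /s' !max_l ?subrr//; lra.
    apply: ler_wpM2r => //; apply: hd2 => //.
      rewrite /xi' le_max ge_max a'b; case/andP: xib => -> ->; rewrite orbT//.
    have d20' : 0 < d2 by [].
    rewrite /xi'; have [h6|h6] := leP a' (xi k); first by rewrite subrr normr0.
    by rewrite ltr_norml; move: h3 h4 h5 h6 sa d20'; clear; move=> *; apply/andP; split; lra.
  rewrite big_split/= -!mulr_sumr !tele; have [s0 sN _] := P.
  rewrite /s' /s2 s0 sN (max_r a'b) (max_l aa') (min_l a'b) (min_r aa').
  by rewrite lerD2r frac_le// ltW.
have := hd _ _ _ Pd; have := hd' _ _ _ P'd.
rewrite !ltr_norml !ler_norml => /andP[? ?] /andP[? ?] /andP[? ?].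
apply/andP; split; lra.
Qed.

End RiemannStieltjes.

(** * Improper integrals against a weight on the negative half-line *)

Section ImproperRiemannStieltjes.
Context {R : realType}.
Implicit Types (f eta : R -> R).

(** Continuity on (-oo, 0], stated as plain continuity of the extension by the constant [f 0]. *)
Definition cont_neg f := continuous (fun u : R => f (Num.min u 0)).

Lemma cont_neg_unif f a e : cont_neg f -> 0 < e -> exists2 d, 0 < d &
  forall x y, a <= x <= 0 -> a <= y <= 0 -> `|x - y| < d -> `|f x - f y| <= e.
Proof.
move=> cf e0; have [d d0 hd] := unif_continuous_itv a 0 cf e0.
exists d => // x y /[dup] xa /andP[_ x0] /andP[_ y0] /(hd _ _ xa).
by rewrite !min_l.
Qed.

Section Weight.
Variables (eta : R -> R) (l : R).
Hypothesis eta_mono : forall s t, s <= t -> t <= 0 -> eta s <= eta t.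
Hypothesis eta_lim : eta s @[s --> -oo] --> l.

Lemma weight_lim_le a : a <= 0 -> l <= eta a.
Proof.
move=> a0; apply/ler_addgt0Pr => e e0.
have /cvgrPdist_lt/(_ _ e0)[M [_ hM]] := eta_lim.
have /hM : Num.min M a - 1 < M by rewrite ltrBlDr ltr_pwDr// ge_min lexx.
have : eta (Num.min M a - 1) <= eta a.
  by apply: eta_mono => //; rewrite lerBlDr ler_wpDr// ge_min lexx orbT.
by rewrite ltr_norml => ? /andP[? ?]; lra.
Qed.

Lemma is_RSint_neg_unique f : cont_neg f -> is_subset1 [set I | is_RSint_neg f eta I].
Proof.
move=> cf I I' [J hJ JI] [J' hJ' JI'].
apply: cvg_unique JI _; first exact: norm_hausdorff.
apply: cvg_trans JI'; apply: near_eq_cvg; exists 0; split => //= a a0.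
by apply: (RSint_unique (ltW a0)); [exact/hJ'/ltW|exact/hJ/ltW].
Qed.

(** By [RSint_tail] the truncated integrals are Cauchy as the lower end tends to -oo. The explicit
    rate, the mass left of the truncation point, does not depend on [f] beyond its bound; it is what
    makes the integral continuous for locally uniform convergence. *)
Lemma RSint_negP f C : cont_neg f -> (forall u, u <= 0 -> `|f u| <= C) ->
  is_RSint_neg f eta (RSint_neg f eta) /\
  forall a I, a <= 0 -> is_RSint f eta a 0 I ->
    `|I - RSint_neg f eta| <= C * (eta a - l).
Proof.
move=> cf fC.
have mono a x y : a <= x -> x <= y -> y <= 0 -> eta x <= eta y.
  by move=> _; exact: eta_mono.
have C0 : 0 <= C by apply: le_trans (fC 0 _).
pose J a := xget 0 [set I | is_RSint f eta a 0 I].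
have JP a : a <= 0 -> is_RSint f eta a 0 (J a).
  move=> a0; apply: (@xgetPex _ 0 [set I | is_RSint f eta a 0 I]).
  apply: RSint_exists => // [|e e0]; first exact: mono.
  exact: cont_neg_unif.
have tail a a' : a <= a' -> a' <= 0 -> `|J a - J a'| <= C * (eta a' - eta a).
  move=> aa' a'0; apply: (RSint_tail aa' a'0 (mono _)); last 2 first.
  - exact/JP/(le_trans aa').
  - exact: JP.
  - by move=> e e0; exact: cont_neg_unif.
  - by move=> x /andP[_]; exact: fC.
have : cvg (J a @[a --> -oo]).
  apply/cauchy_cvgP/cauchy_exP => e e0.
  have e1 : 0 < e / (C + 1) by rewrite divr_gt0// ltr_wpDl.
  have /cvgrPdist_lt/(_ _ e1)[M [_ hM]] := eta_lim.
  pose a0 := Num.min M 0 - 1.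
  have a00 : a0 <= 0 by rewrite /a0 lerBlDr ler_wpDr// ge_min lexx orbT.
  have a0M : a0 < M by rewrite ltrBlDr ltr_pwDr// ge_min lexx.
  exists (J a0), a0; split=> //= a aa0; rewrite /ball/= distrC.
  apply: le_lt_trans (tail _ _ (ltW aa0) a00) _.
  have := hM _ a0M; have := weight_lim_le (le_trans (ltW aa0) a00).
  rewrite ltr_norml => h1 /andP[h2 _].
  apply: (@le_lt_trans _ _ ((C + 1) * (eta a0 - l))).
    have h3 := eta_mono (ltW aa0) a00.
    by apply: ler_pM => //; lra.
  have : (- (e / (C + 1))) < l - eta a0 by [].
  by rewrite ltrNl opprB ltr_pdivlMr ?ltr_wpDl// mulrC.
move=> /cvg_ex[I JI].
have -> : RSint_neg f eta = I.
  by apply: xget_unique => [|I' hI']; [exists J|apply: is_RSint_neg_unique hI' _ => //; exists J].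
split; first by exists J.
move=> a I' a0 hI'; have -> : I' = J a by apply: RSint_unique hI' (JP _ a0).
apply/ler_addgt0Pr => e e0.
have /cvgrPdist_lt/(_ _ e0)[M [_ hM]] : J b @[b --> -oo] --> I by [].
pose b := Num.min M a - 1.
have ba : b <= a by rewrite /b lerBlDr ler_wpDr// ge_min lexx orbT.
have bM : b < M by rewrite ltrBlDr ltr_pwDr// ge_min lexx.
have := tail _ _ ba a0; have := hM _ bM; have := weight_lim_le (le_trans ba a0).
move=> h1 h2 h3.
have : C * (eta a - eta b) <= C * (eta a - l) by rewrite ler_wpM2l// lerB.
have := ler_distD (J b) (J a) I; rewrite (distrC (J a) (J b)) (distrC (J b) I).
lra.
Qed.

(** The integral is cut at [T]: the mass of [T, 0] is at most the total mass 1, and the remaining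
    mass [eta T - l] is small when [T] is far left. *)
Lemma RSint_neg_dist f f' C C' e T : eta 0 - l = 1 -> cont_neg f -> cont_neg f' ->
  (forall u, u <= 0 -> `|f u| <= C') -> (forall u, u <= 0 -> `|f' u| <= C') ->
  T <= 0 ->
  (forall u, T <= u -> u <= 0 -> `|f u - f' u| <= e) ->
  (forall u, u <= 0 -> `|f u - f' u| <= C) ->
  `|RSint_neg f eta - RSint_neg f' eta| <= e + C * (eta T - l).
Proof.
move=> w1 cf cf' fC f'C T0 he hC.
have cB : cont_neg (fun x => f x - f' x) by move=> x; apply: cvgB; [exact: cf|exact: cf'].
have e0 : 0 <= e by apply: le_trans (he 0 _ _).
have mono a x y : a <= x -> x <= y -> y <= 0 -> eta x <= eta y.
  by move=> _; exact: eta_mono.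
have [[J hJ JI] _] := RSint_negP cf fC; have [[J' hJ' JI'] _] := RSint_negP cf' f'C.
have [PB tB] := RSint_negP cB hC.
have -> : RSint_neg f eta - RSint_neg f' eta = RSint_neg (fun x => f x - f' x) eta.
  apply: (is_RSint_neg_unique cB) PB; exists (fun a => J a - J' a).
    by move=> a a0; apply: RSintB; [exact: hJ|exact: hJ'].
  exact: cvgB.
have hT := RSintB (hJ _ T0) (hJ' _ T0).
have h1 := tB _ _ T0 hT.
have : `|J T - J' T| <= e * (eta 0 - eta T).
  by apply: (RSint_le T0 (mono _) _ hT) => x /andP[]; exact: he.
have : e * (eta 0 - eta T) <= e.
  by rewrite ler_piMr//; have := weight_lim_le T0; lra.
have := ler_normB (J T - J' T) (J T - J' T - RSint_neg (fun x => f x - f' x) eta).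
by rewrite subKr; lra.
Qed.

End Weight.

(** Obtained by using the same bound on both sides of [T] and letting [T] tend to -oo; no constant
    is lost because the total mass is 1. *)
Lemma RSint_neg_le eta f f' C C' : stieltjes_weight eta ->
  cont_neg f -> cont_neg f' ->
  (forall u, u <= 0 -> `|f u| <= C') -> (forall u, u <= 0 -> `|f' u| <= C') ->
  (forall u, u <= 0 -> `|f u - f' u| <= C) ->
  `|RSint_neg f eta - RSint_neg f' eta| <= C.
Proof.
move=> [mono _ [l lim w1]] cf cf' fC f'C hC.
have C0 : 0 <= C by apply: le_trans (hC 0 _).
apply/ler_addgt0Pr => e e0.
have e1 : 0 < e / (C + 1) by rewrite divr_gt0// ltr_wpDl.
have /cvgrPdist_lt/(_ _ e1)[M [_ hM]] := lim.
pose T := Num.min M 0 - 1.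
have T0 : T <= 0 by rewrite /T lerBlDr ler_wpDr// ge_min lexx orbT.
have /hM TM : T < M by rewrite ltrBlDr ltr_pwDr// ge_min lexx.
apply: le_trans (RSint_neg_dist mono lim w1 cf cf' fC f'C T0 _ hC) _.
  by move=> u _; exact: hC.
rewrite lerD2l (@le_trans _ _ (C * (e / (C + 1))))//.
  by rewrite ler_wpM2l//; move: TM; rewrite ltr_norml; lra.
by rewrite mulrC frac_le// ltW.
Qed.

Lemma RSint_neg_cvg (S : Type) (FS : set_system S) (f : S -> R -> R) f0 eta C :
  Filter FS -> stieltjes_weight eta ->
  (\forall k \near FS, cont_neg (f k)) -> cont_neg f0 ->
  (\forall k \near FS, forall u, u <= 0 -> `|f k u| <= C) ->
  (forall u, u <= 0 -> `|f0 u| <= C) ->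
  (forall T e, 0 < e ->
     \forall k \near FS, forall u, - T <= u -> u <= 0 -> `|f k u - f0 u| <= e) ->
  RSint_neg (f k) eta @[k --> FS] --> RSint_neg f0 eta.
Proof.
move=> FF [mono _ [l lim w1]] cf cf0 fC f0C cvgf.
have C0 : 0 <= C by apply: le_trans (f0C 0 _).
apply/cvgrPdist_le => e e0.
have e1 : 0 < e / 2 / (2 * C + 1) by rewrite !divr_gt0// ltr_wpDl// mulr_ge0.
have /cvgrPdist_lt/(_ _ e1)[M [_ hM]] := lim.
pose T := Num.min M 0 - 1.
have T0 : T <= 0 by rewrite /T lerBlDr ler_wpDr// ge_min lexx orbT.
have /hM TM : T < M by rewrite ltrBlDr ltr_pwDr// ge_min lexx.
have e20 : 0 < e / 2 by rewrite divr_gt0.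
have := cvgf (- T) _ e20; move: cf fC; apply: filter_app3; apply: nearW.
move=> k cfk fkC hk; rewrite distrC.
apply: (le_trans (RSint_neg_dist (C := 2 * C) (e := e / 2) mono lim w1 cfk cf0 fkC f0C T0 _ _)).
- by move=> u; rewrite -{1}(opprK T); exact: hk.
- move=> u u0; rewrite (le_trans (ler_normB _ _))// mulr2n mulrDl mul1r.
  by rewrite lerD ?fkC ?f0C.
rewrite [leRHS]splitr lerD2l (@le_trans _ _ (2 * C * (e / 2 / (2 * C + 1))))//.
  by rewrite ler_wpM2l ?mulr_ge0//; move: TM; rewrite ltr_norml; lra.
by rewrite mulrC frac_le ?mulr_ge0// ltW.
Qed.

End ImproperRiemannStieltjes.

(** * Relative derivatives, mean value inequalities and a barrier principle *)

Section Derivatives.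
Context {R : realType}.
Implicit Types (f g : R -> R) (D : set R) (t l a b e : R).

(** The first-order expansion avoids division and includes [s = t], so changes of domain, sums and
    limits reduce to manipulations of one inequality. *)
Lemma has_deriv_withinP D f t l : has_deriv_within D f t l <->
  forall e, 0 < e -> \forall s \near t, D s ->
    `|f s - f t - l * (s - t)| <= e * `|s - t|.
Proof.
split=> [H e e0|H].
- have : \forall s \near within D t^', `|l - (f s - f t) / (s - t)| <= e.
    by move/cvgrPdist_le : H; exact.
  rewrite near_withinE => /=; rewrite /dnbhs near_withinE.
  apply: filterS => s H1 Ds; have [->|st] := eqVneq s t.
    by rewrite !subrr mulr0 subrr normr0 mulr0.
  have st0 : s - t != 0 by rewrite subr_eq0.
  have {H1} := H1 st Ds.
  rewrite -(ler_pM2r (_ : 0 < `|s - t|)) ?normr_gt0// -normrM mulrBl divfK//.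
  by rewrite distrC.
- apply/cvgrPdist_le => e e0.
  rewrite near_withinE /dnbhs near_withinE /=.
  have := H e e0; apply: filterS => s Hs st Ds.
  have st0 : s - t != 0 by rewrite subr_eq0.
  rewrite -(ler_pM2r (_ : 0 < `|s - t|)) ?normr_gt0// -normrM mulrBl divfK//.
  by rewrite distrC; exact: Hs.
Qed.

Lemma has_deriv_within_sub D D' f t l : (\forall s \near t, D' s -> D s) ->
  has_deriv_within D f t l -> has_deriv_within D' f t l.
Proof.
move=> DD /has_deriv_withinP H; apply/has_deriv_withinP => e /H.
by apply: filter_app; apply: filterS DD => s DD' h /DD'.
Qed.

Lemma has_deriv_within_derive D f t l : (\forall s \near t, D s) ->
  has_deriv_within D f t l <-> is_derive t 1 f l.
Proof.
move=> Dt; transitivity (h^-1 *: (f (h + t) - f t) @[h --> 0^'] --> l).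
  split=> [/has_deriv_withinP H|H].
    apply/cvgrPdist_le => e e0; rewrite /dnbhs near_withinE.
    have := H e e0; move: Dt; rewrite !(near_shift 0 t).
    apply: filterS2 => h /= + + h0.
    rewrite subr0 => Dh /(_ Dh); rewrite addrK => Hh.
    rewrite -(ler_pM2r (_ : 0 < `|h|)) ?normr_gt0// -normrM mulrBl.
    by rewrite [h^-1 *: _]mulrC divfK// distrC.
  apply/has_deriv_withinP => e e0.
  move/cvgrPdist_le/(_ e e0) : H; rewrite /dnbhs near_withinE => H.
  rewrite (near_shift 0 t); move: H; apply: filterS => h /= H _.
  rewrite subr0 addrK; have [->|h0] := eqVneq h 0.
    by rewrite add0r subrr mulr0 subrr normr0 mulr0.
  have := H h0; rewrite -(ler_pM2r (_ : 0 < `|h|)) ?normr_gt0// -normrM mulrBl.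
  by rewrite [h^-1 *: _]mulrC divfK// distrC.
have eqf : (fun h => h^-1 *: (f (h + t) - f t)) =
           (fun h => h^-1 *: ((f \o shift t) (h *: 1) - f t)).
  by apply/funext => h /=; rewrite [h%:A]mulr1.
rewrite eqf; split=> H.
  split; first by apply/cvg_ex; exists l.
  by apply/cvg_lim.
case: H => H <-; exact: H.
Qed.

Lemma has_deriv_within_continuous f t l D : (\forall s \near t, D s) ->
  has_deriv_within D f t l -> {for t, continuous f}.
Proof.
move=> /has_deriv_within_derive h/h[df _].
by apply/differentiable_continuous/derivable1_diffP.
Qed.

(** The derivative is asked for only inside the interval, so that [a] may be an initial time, where
    it is one-sided. *)
Lemma has_deriv_within_mvt D f g a b : a < b ->
  (forall t, a < t < b -> D t) ->
  {for a, continuous f} -> {for b, continuous f} ->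
  (forall t, a < t < b -> has_deriv_within D f t (g t)) ->
  exists2 c, a < c < b & f b - f a = g c * (b - a).
Proof.
move=> ab DP fa fb Hg.
have near_ab t : a < t < b -> \forall s \near t, D s.
  move=> /andP[at_ tb]; near=> s; apply: DP; apply/andP; split; near: s.
    exact: lt_nbhsr.
  exact: lt_nbhsl.
have der x : x \in `]a, b[%R -> is_derive x 1 f (g x).
  rewrite in_itv/= => xab; apply/has_deriv_within_derive; last exact: Hg.
  exact: near_ab.
have [|c] := MVT ab der.
  apply: continuous_in_subspaceT => x /set_mem/=; rewrite in_itv/= => /andP[].
  rewrite le_eqVlt => /predU1P[<- _ //|ax]; rewrite le_eqVlt => /predU1P[->//|xb].
  have xab : a < x < b by rewrite ax.
  exact: has_deriv_within_continuous (near_ab _ xab) (Hg _ xab).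
by rewrite in_itv/=; exists c.
Unshelve. all: by end_near. Qed.

Lemma mean_value_le D f g a b (C : R) : a <= b ->
  (forall t, a < t < b -> D t) ->
  {for a, continuous f} -> {for b, continuous f} ->
  (forall t, a < t < b -> has_deriv_within D f t (g t)) ->
  (forall t, a < t < b -> g t <= C) ->
  f b - f a <= C * (b - a).
Proof.
rewrite le_eqVlt => /predU1P[-> *|ab DP fa fb Hg gC].
  by rewrite !subrr mulr0.
have [c cab ->] := has_deriv_within_mvt ab DP fa fb Hg.
by rewrite ler_wpM2r ?gC// subr_ge0 ltW.
Qed.

Lemma mean_value_dist D f g a b l e : a <= b ->
  (forall t, a < t < b -> D t) ->
  {for a, continuous f} -> {for b, continuous f} ->
  (forall t, a < t < b -> has_deriv_within D f t (g t)) ->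
  (forall t, a < t < b -> `|g t - l| <= e) ->
  `|f b - f a - l * (b - a)| <= e * (b - a).
Proof.
rewrite le_eqVlt => /predU1P[-> *|ab DP fa fb Hg gC].
  by rewrite !subrr !mulr0 subrr normr0.
have [c cab ->] := has_deriv_within_mvt ab DP fa fb Hg.
have ba0 : 0 <= b - a by rewrite subr_ge0 ltW.
by rewrite -mulrBl normrM (ger0_norm ba0) ler_wpM2r// gC.
Qed.

(** As [a < t] strictly, the primitive has a two-sided derivative at [t], hence one relative to
    every [D]. *)
Lemma has_deriv_within_integral (f : R -> R) a t D : continuous f -> a < t ->
  has_deriv_within D (fun x => \int[lebesgue_measure]_(t in `[a, x]) f t) t (f t).
Proof.
move=> cf ta.
have tT (E : set R) : \forall s \near t, E s -> [set: R] s by apply: (@filterE _ (nbhs t)).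
apply: (has_deriv_within_sub (tT D)).
apply/has_deriv_within_derive; first by apply: (@filterE _ (nbhs t)).
have [||||dF F'] := @continuous_FTC1_closed R f a t (t + 1).
- by rewrite ltrDl.
- apply: continuous_compact_integrable; first exact: segment_compact.
  exact: continuous_subspaceT.
- by [].
- exact: cf.
- split; first exact: dF.
  by rewrite -[LHS]derive1E; exact: F'.
Qed.

(** Continuous induction on the supremum of the times up to which all components are nonpositive. At
    that time a negative component stays negative by continuity and a vanishing one is handled by
    the hypothesis; finiteness of [J] gives a common interval to the right. *)
Lemma barrier (J : finType) (u : J -> R -> R) t0 t1 :
  (forall j t, t0 <= t <= t1 -> {for t, continuous (u j)}) ->
  (forall j, u j t0 <= 0) ->
  (forall j t, t0 <= t < t1 -> (forall i s, t0 <= s <= t -> u i s <= 0) ->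
     u j t = 0 -> \forall s \near t, t < s -> u j s <= 0) ->
  forall j t, t0 <= t <= t1 -> u j t <= 0.
Proof.
move=> cu u0 step j t /andP[t0t tt1].
pose E := [set s | t0 <= s <= t1 /\ forall i r, t0 <= r <= s -> u i r <= 0].
have Et0 : E t0.
  split; first by rewrite lexx (le_trans t0t).
  by move=> i r; rewrite -eq_le => /eqP <-.
have supE : has_sup E by split; [exists t0|exists t1 => s [/andP[]]].
set m := sup E.
have t0m : t0 <= m by apply: ub_le_sup => //; case: supE.
have mt1 : m <= t1 by apply: ge_sup => //; [case: supE|move=> s [/andP[]]].
have below i r : t0 <= r -> r < m -> u i r <= 0.
  move=> t0r rm; have mr : 0 < m - r by rewrite subr_gt0.
  have [s [Es1 Es2]] := sup_adherent mr supE; rewrite subKr => rs.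
  by apply: Es2; rewrite t0r ltW.
have Em i r : t0 <= r <= m -> u i r <= 0.
  move=> /andP[t0r]; rewrite le_eqVlt => /predU1P[->|]; last exact: below.
  rewrite leNgt; apply/negP => um.
  have m0 : t0 < m.
    by rewrite lt_neqAle t0m andbT; apply: contraL um => /eqP <-; rewrite -leNgt.
  have cm : {for m, continuous (u i)} by apply: cu; rewrite t0m.
  have /nbhs_ballP[d /= d0 hd] : \forall s \near m, 0 < u i s.
    exact: (cvgr_gt _ cm).
  pose s := Num.max t0 (m - d / 2).
  have sm : s < m by rewrite gt_max m0/= ltrBlDr ltrDl divr_gt0.
  have : 0 < u i s.
    apply: hd; rewrite /ball/= gtr0_norm ?subr_gt0//.
    rewrite ltrBlDr -ltrBlDl lt_max; apply/orP; right.
    by rewrite ltrD2l ltrN2 ltr_pdivrMr// ltr_pMr// ltr1n.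
  by apply/negP; rewrite -leNgt below// le_max lexx.
have [tm|mt] := leP t m; first by apply: Em; rewrite t0t.
exfalso.
have mt1' : m < t1 by apply: lt_le_trans mt tt1.
have H i : \forall s \near m, m < s -> u i s <= 0.
  have [um|um] := eqVneq (u i m) 0.
    by apply: step => //; rewrite t0m.
  have um0 : u i m < 0 by rewrite lt_neqAle um Em// t0m lexx.
  have cm : {for m, continuous (u i)} by apply: cu; rewrite t0m.
  near=> s; move=> _; apply/ltW; near: s.
  exact: cvgr_lt cm _ um0.
have /nbhs_ballP[d /= d0 hd] : \forall s \near m, forall i, m < s -> u i s <= 0.
  by apply: (@filter_forall _ _ _ (nbhs m)).
pose s := Num.min t1 (m + d / 2).
have ms : m < s by rewrite lt_min mt1' ltrDl divr_gt0.
have : s <= m.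
  apply: ub_le_sup; first by case: supE.
  split; first by rewrite (le_trans t0m (ltW ms))/= ge_min lexx.
  move=> i r /andP[t0r rs]; have [rm|mr] := leP r m; first by apply: Em; rewrite t0r.
  apply: hd => //; rewrite /ball/= ltr0_norm ?subr_lt0// opprB ltrBlDl.
  apply: le_lt_trans rs _; rewrite gt_min; apply/orP; right.
  by rewrite ltrD2l ltr_pdivrMr// ltr_pMr// ltr1n.
by rewrite leNgt ms.
Unshelve. all: by end_near. Qed.

End Derivatives.

(** * Limits along ultrafilters and continuous convergence *)

Section Limits.
Context {R : realType}.

(** One ultrafilter replaces every extraction of subsequences: along it all bounded sequences
    converge, so a limit can be taken at every time simultaneously. *)
Lemma free_ultrafilter : exists2 U : set_system nat, UltraFilter U & \oo `<=` U.
Proof. by have [U [UU h]] := ultraFilterLemma eventually_filter; exists U. Qed.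

Lemma ultra_lim (T : Type) (U : set_system T) (u : T -> R) (C : R) : UltraFilter U ->
  (\forall k \near U, `|u k| <= C) ->
  exists2 l, u k @[k --> U] --> l & `|l| <= C.
Proof.
move=> UU uC.
have := @segment_compact R (- C) C; rewrite compact_ultra.
have UuU : UltraFilter (u k @[k --> U]).
  split; first exact: fmap_proper_filter.
  move=> G PG sG; apply/funext => A; apply/propext; split=> [GA|]; last exact: sG.
  have [//|UnA] := in_ultra_setVsetC (u @^-1` A) UU.
  have /filter_ex[x [Ax nAx]] : G (A `&` ~` A) by apply: filterI => //; exact: sG.
  by [].
move=> /(_ _ UuU)[|l [/= lC ul]].
  rewrite /= nbhs_simpl; move: uC; apply: filterS => k /=.
  by rewrite in_itv/= ler_norml.
by exists l => //; move: lC; rewrite in_itv/= ler_norml.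
Qed.

Lemma cvg_dist_le (T : Type) (F : set_system T) (u : T -> R) (l c e : R) :
  ProperFilter F -> u @ F --> l -> (\forall k \near F, `|u k - c| <= e) ->
  `|l - c| <= e.
Proof.
move=> PF ul uc; apply/ler_addgt0Pr => d d0.
have [k [h1 h2]] : exists k, `|u k - c| <= e /\ `|l - u k| <= d.
  apply: (@filter_ex _ F); near=> k; split; near: k => //.
  by move/cvgrPdist_le : ul; exact.
by rewrite (le_trans (ler_distD (u k) _ _))// [leRHS]addrC lerD.
Unshelve. all: by end_near. Qed.

Section ContinuousConvergence.
Variables (T : Type) (U : set_system T).
Hypothesis PU : ProperFilter U.
Implicit Types (z : T -> R -> R) (y : R -> R) (t : R).

(** Continuous convergence, jointly in the index and the time. It is local in [t] and allows
    evaluation at moving times, and near compact sets it yields uniform convergence. *)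
Definition cvg_cont z y t := z p.1 p.2 @[p --> (U, nbhs t)] --> y t.

Lemma cvg_cont_pointwise z y t : cvg_cont z y t -> z k t @[k --> U] --> y t.
Proof.
move=> zy; apply/cvgrPdist_le => e e0.
have /cvgrPdist_le/(_ _ e0)[[A B] /= [UA Bt] H] := zy.
by apply: filterS UA => k Ak; apply: (H (k, t)); split => //=; exact: nbhs_singleton Bt.
Qed.

Lemma cvg_cont_equicontinuous z y t : z k t @[k --> U] --> y t ->
  (forall e, 0 < e -> \forall p \near (U, nbhs t), `|z p.1 p.2 - z p.1 t| <= e) ->
  cvg_cont z y t.
Proof.
move=> zt H; apply/cvgrPdist_le => e e0.
have e20 : 0 < e / 2 by rewrite divr_gt0.
have zt' : z p.1 t @[p --> (U, nbhs t)] --> y t.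
  exact: (cvg_comp (@fst T R) (z ^~ t) cvg_fst zt).
move/cvgrPdist_le/(_ _ e20) : zt'; have := H _ e20.
apply: filterS2 => p h1 h2.
rewrite (le_trans (ler_distD (z p.1 t) _ _))// [leRHS]splitr lerD// distrC//.
Qed.

Lemma cvg_cont_continuous z y : (forall t, cvg_cont z y t) -> continuous y.
Proof.
move=> zy t; apply/cvgrPdist_le => e e0.
have /cvgrPdist_le/(_ _ e0)[[A B] /= [UA Bt] H] := zy t.
apply: filterS Bt => s Bs; rewrite distrC.
apply: cvg_dist_le (cvg_cont_pointwise (zy s)) _.
by apply: filterS UA => k Ak; rewrite distrC; apply: (H (k, s)).
Qed.

Lemma near_prod_within (D : set R) (t : R) (P : T * R -> Prop) :
  (\forall p \near (U, within D (nbhs t)), P p) ->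
  \forall p \near (U, nbhs t), D p.2 -> P p.
Proof.
move=> [[A B] /= [UA Bt] H]; exists (A, [set s | D s -> B s]) => //= p [h1 h2] Dp.
by apply: H; split => //=; exact: h2.
Qed.

(* The derivatives need only converge away from [t], so this also computes a
   derivative at a point where [z k] is only known to be continuous. *)
Lemma cvg_cont_deriv z (g : T -> R -> R) y (lo t L : R) : lo <= t ->
  (\forall p \near (U, nbhs t), {for p.2, continuous (z p.1)} /\
     (lo < p.2 -> p.2 != t -> has_deriv_within `[lo, +oo[ (z p.1) p.2 (g p.1 p.2))) ->
  (forall e, 0 < e -> \forall p \near (U, nbhs t),
     lo < p.2 -> p.2 != t -> `|g p.1 p.2 - L| <= e) ->
  (\forall s \near t, lo <= s -> z k s @[k --> U] --> y s) ->
  has_deriv_within `[lo, +oo[ y t L.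
Proof.
move=> lot Hd Hg Hz; apply/has_deriv_withinP => e e0.
have [[A B] /= [UA Bt] H] : \forall p \near (U, nbhs t),
    {for p.2, continuous (z p.1)} /\ (lo < p.2 -> p.2 != t ->
      has_deriv_within `[lo, +oo[ (z p.1) p.2 (g p.1 p.2) /\
      `|g p.1 p.2 - L| <= e).
  move: Hd (Hg _ e0); apply: filterS2 => p [h1 h2] h3; split => // lop pt.
  by split; [exact: h2|exact: h3].
have /nbhs_ballP[d /= d0 hd] := Bt.
have bt r s : `|s - t| < d -> Num.min s t <= r <= Num.max s t -> B r.
  move=> st /andP[r1 r2]; apply: hd; rewrite /ball/= distrC.
  apply: le_lt_trans st; move: r1 r2; clear; have [st|ts] := leP s t => r1 r2.
    by rewrite (ler0_norm (_ : s - t <= 0)) ?subr_le0// ler_norml; apply/andP; split; lra.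
  by rewrite (gtr0_norm (_ : 0 < s - t)) ?subr_gt0// ler_norml; apply/andP; split; lra.
near=> s; rewrite /= in_itv/= andbT => los.
have zs : z k s @[k --> U] --> y s.
  by move: los; near: s.
have zt : z k t @[k --> U] --> y t.
  by have := nbhs_singleton Hz; apply.
have std : `|s - t| < d.
  by near: s; apply/nbhs_ballP; exists d => //= s; rewrite /ball/= distrC.
(* The mean value inequality between [s] and [t] holds for each [z k] with the same [e], and passes
   to the limit in [k]. *)
apply: (@cvg_dist_le _ U (fun k => z k s - z k t) _ (L * (s - t))).
  exact: cvgB.
apply: filterS UA => k Ak.
have cz r : Num.min s t <= r <= Num.max s t -> {for r, continuous (z k)}.
  by move=> rst; have [] := H (k, r); first by split => //=; exact: bt rst.
have dz r : Num.min s t < r < Num.max s t ->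
    has_deriv_within `[lo, +oo[ (z k) r (g k r) /\ `|g k r - L| <= e.
  move=> /andP[r1 r2]; have [] := H (k, r).
    by split => //=; apply: bt std _; rewrite !ltW.
  move=> _; apply => /=; first by apply: le_lt_trans r1; rewrite le_min los.
  apply/eqP => rt; move: r1 r2; rewrite rt gt_min lt_max !ltxx !orbF.
  by move=> /lt_trans h /h; rewrite ltxx.
have [st|ts] := leP s t.
  move: cz dz; rewrite min_l// max_r// => cz dz.
  rewrite (ler0_norm (_ : s - t <= 0)) ?subr_le0// opprB -normrN.
  rewrite (_ : - (z k s - z k t - L * (s - t)) = z k t - z k s - L * (t - s)); last by ring.
  apply: (@mean_value_dist R `[lo, +oo[ (z k) (g k) s t L e st).
  - by move=> r /andP[sr _] /=; rewrite in_itv/= andbT (le_trans los (ltW sr)).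
  - by apply: cz; rewrite lexx.
  - by apply: cz; rewrite lexx andbT.
  - by move=> r /dz[].
  - by move=> r /dz[].
rewrite (gtr0_norm (_ : 0 < s - t)) ?subr_gt0//.
move: cz dz; rewrite min_r ?max_l ?(ltW ts)// => cz dz.
apply: (@mean_value_dist R `[lo, +oo[ (z k) (g k) t s L e (ltW ts)).
- by move=> r /andP[sr _] /=; rewrite in_itv/= andbT (le_trans lot (ltW sr)).
- by apply: cz; rewrite lexx ltW.
- by apply: cz; rewrite lexx andbT ltW.
- by move=> r /dz[].
- by move=> r /dz[].
Unshelve. all: by end_near. Qed.

End ContinuousConvergence.
End Limits.

(** * Histories and functionals continuous on them *)

Section Histories.
Context {R : realType} {J : finType}.

(* A history is a function of [u <= 0]; its values at [u > 0] are junk. *)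
Definition hist := J -> R -> R.

Definition hist_cont (phi : hist) := forall j, cont_neg (phi j).

Definition hist_bounded (M : R) (phi : hist) :=
  forall j u, u <= 0 -> `|phi j u| <= M.

Definition hist_cvg (S : Type) (FS : set_system S) (phi : S -> hist) (phi0 : hist) :=
  forall T e, 0 < e -> \forall k \near FS, forall j u, - T <= u -> u <= 0 ->
    `|phi k j u - phi0 j u| <= e.

(* Continuity for the locally uniform convergence of equibounded histories. The
   filter is arbitrary so that it covers both limits in time and limits of
   translates along an ultrafilter. *)
Definition hist_continuous (F : R -> hist -> R) :=
  forall (S : Type) (FS : set_system S) (t : S -> R) (phi : S -> hist)
    (t0 : R) (phi0 : hist) (M : R),
    Filter FS -> 0 <= t0 ->
    (\forall k \near FS, [/\ 0 <= t k, hist_cont (phi k) & hist_bounded M (phi k)]) ->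
    hist_cont phi0 -> hist_bounded M phi0 ->
    t @ FS --> t0 -> hist_cvg FS phi phi0 ->
    F (t k) (phi k) @[k --> FS] --> F t0 phi0.

(** The segment x_t of the equation. *)
Definition past (x : J -> R -> R) (t : R) : hist := fun j u => x j (t + u).

Implicit Types (x y : J -> R -> R) (phi psi : hist).

Lemma cont_min0 (u : R) : {for u, continuous (fun v : R => Num.min v 0)}.
Proof.
have := @continuous_min R R id (cst 0) u (@cvg_id _ _) (@cvg_cst _ _ _ _ _).
exact.
Qed.

Lemma hist_cont_past x t : (forall j s, s <= t -> {for s, continuous (x j)}) ->
  hist_cont (past x t).
Proof.
move=> cx j u; rewrite /past.
apply: (@continuous_comp _ _ _ (fun u : R => t + Num.min u 0) (x j)); last first.
  by apply: cx; rewrite gerDl ge_min lexx orbT.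
by apply: cvgD; [exact: cvg_cst|exact: cont_min0].
Qed.

(** Continuity applied to a constant family over a one-point filter: [phi] converges to [psi] as a
    history, so [F] cannot see the junk values at positive arguments. *)
Lemma hist_continuous_ext F t phi psi M : hist_continuous F -> 0 <= t ->
  hist_cont phi -> hist_bounded M phi -> (forall j u, u <= 0 -> phi j u = psi j u) ->
  F t phi = F t psi.
Proof.
move=> FC t0 cphi bphi e; have PF := principal_filter_proper tt.
have cpsi : hist_cont psi.
  move=> j u; have -> : (fun u => psi j (Num.min u 0)) = fun u => phi j (Num.min u 0).
    by apply/funext => v; rewrite e// ge_min lexx orbT.
  exact: cphi.
have bpsi : hist_bounded M psi by move=> j u u0; rewrite -e// bphi.
have H1 : F t phi @[_ --> principal_filter tt] --> F t psi.
  apply: (FC unit (principal_filter tt) (fun _ => t) (fun _ => phi) t psi M) => //.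
  - exact: cvg_cst.
  - by move=> T e' e0; apply: filterE => _ j u _ u0; rewrite e// subrr normr0 ltW.
have H2 : F t phi @[_ --> principal_filter tt] --> F t phi by exact: cvg_cst.
by apply: cvg_unique H2 H1; exact: norm_hausdorff.
Qed.

(** The index [k] and the time [s] vary together along an arbitrary filter. Compactness of
    [- T0, 0], in near-covering form, turns convergence near each point into uniform convergence on
    the window. *)
Lemma hist_cvg_past (T : Type) (U : set_system T) (z : T -> J -> R -> R) y
    (S : Type) (FS : set_system S) (k : S -> T) (s : S -> R) t :
  ProperFilter U -> Filter FS ->
  (forall j r, r <= t -> cvg_cont U (fun i => z i j) (y j) r) ->
  k @ FS --> U -> s @ FS --> t ->
  hist_cvg FS (fun i => past (z (k i)) (s i)) (past y t).
Proof.
move=> PU FF zy kU st T0 e e0.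
have e20 : 0 < e / 2 by rewrite divr_gt0.
have KT : compact `[- T0, 0] by exact: segment_compact.
have NC := (near_covering_withinP _).2 ((compact_near_coveringP _).1 KT) S FS
  (fun i u => forall j, `|past (z (k i)) (s i) j u - past y t j u| <= e) FF.
apply: filterS (NC _) => [i h j u Tu u0|].
  by apply: h; rewrite /= in_itv/= Tu.
move=> u; rewrite /= in_itv/= => /andP[_ u0].
  have tu : t + u <= t by rewrite gerDl.
  suff H j : filter_prod (nbhs u) FS (fun p => - T0 <= p.1 <= 0 ->
      `|past (z (k p.2)) (s p.2) j p.1 - past y t j p.1| <= e).
    have [[A B] AB h] := @filter_forall _ _ _ (filter_prod (nbhs u) FS) _ H.
    exists (A, B) => // -[u' i] /h hj /=; rewrite in_itv/= => u'K j; exact: hj.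
  have /cvgrPdist_le/(_ _ e20)[[A B] /= [UA Bt] H] := zy j _ tu.
  have /nbhs_ballP[r /= r0 hr] := Bt.
  have r20 : 0 < r / 2 by rewrite divr_gt0.
  have sr : \forall i \near FS, `|t - s i| < r / 2 by move/cvgrPdist_lt : st; exact.
  have kA : \forall i \near FS, A (k i) by exact: kU.
  exists (ball u (r / 2), [set i | `|t - s i| < r / 2 /\ A (k i)]) => /=.
    by split; [exact: nbhsx_ballx|exact: filterI].
  move=> [u' i] /= [bu [si Ai]] /andP[_ u'0].
  rewrite /past.
  have Bu' : B (t + u').
    apply: hr; apply: le_ball (_ : ball (t + u) (r / 2) _); first by lra.
    by rewrite /ball/=; move: bu; rewrite /ball/= opprD addrACA subrr add0r.
  have h1 : `|y j (t + u) - y j (t + u')| <= e / 2.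
    rewrite distrC; apply: (@cvg_dist_le R T U (fun i => z i j (t + u')) _ (y j (t + u)) _ PU (cvg_cont_pointwise PU (zy j (t + u') _))).
      by rewrite gerDl.
    by apply: filterS UA => i' Ai'; rewrite distrC; exact: (H (i', t + u')).
  have h2 : `|y j (t + u) - z (k i) j (s i + u')| <= e / 2.
    apply: (H (k i, s i + u')); split => //=.
    apply: hr; rewrite /ball/= (_ : _ - _ = (t - s i) + (u - u')); last by ring.
    rewrite (splitr r); apply: le_lt_trans (ler_normD _ _) _.
    by apply: ltrD => //; move: bu; rewrite /ball/=.
  rewrite (le_trans (ler_distD (y j (t + u)) _ _))// [leRHS]splitr lerD//.
  by rewrite distrC.
Qed.

Lemma cvg_cont_cst (f : R -> R) t : {for t, continuous f} ->
  cvg_cont (principal_filter tt) (fun=> f) f t.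
Proof. by move=> cf; apply: (cvg_comp (@snd unit R) f cvg_snd cf). Qed.

(** A single function is viewed as a constant family over the one-point filter; this gives the
    continuity of t -> x_t. *)
Lemma hist_cvg_past_cst x (S : Type) (FS : set_system S) (s : S -> R) t :
  Filter FS -> (forall j r, r <= t -> {for r, continuous (x j)}) ->
  s @ FS --> t -> hist_cvg FS (fun i => past x (s i)) (past x t).
Proof.
move=> FF cx st; have PF := principal_filter_proper tt.
apply: (@hist_cvg_past unit (principal_filter tt) (fun _ => x) x S FS (fun=> tt)) => //.
  by move=> j r rt; apply: cvg_cont_cst; exact: cx.
by move=> A At; apply: filterE; case; exact: (At tt erefl).
Qed.

End Histories.

(** * Peano's theorem for equations with infinite delay and bounded right-hand side *)

Section Peano.
Context {R : realType} {J : finType}.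
Local Notation hist := (@hist R J).

Lemma has_deriv_withinB (D : set R) (f g : R -> R) t (l m : R) :
  has_deriv_within D f t l -> has_deriv_within D g t m ->
  has_deriv_within D (fun s => f s - g s) t (l - m).
Proof.
move=> /has_deriv_withinP hf /has_deriv_withinP hg; apply/has_deriv_withinP => e e0.
have e20 : 0 < e / 2 by rewrite divr_gt0.
move: (hf _ e20) (hg _ e20); apply: filterS2 => s hs gs Ds.
rewrite (_ : _ - _ - _ - _ = (f s - f t - l * (s - t)) - (g s - g t - m * (s - t))); last by ring.
rewrite (le_trans (ler_normB _ _))// (splitr e) mulrDl.
by rewrite lerD ?hs ?gs.
Qed.

Lemma has_deriv_withinDl (D : set R) (f : R -> R) (c : R) t (l : R) :
  has_deriv_within D f t l -> has_deriv_within D (fun s => c + f s) t l.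
Proof.
move=> /has_deriv_withinP hf; apply/has_deriv_withinP => e e0.
by apply: filterS (hf _ e0) => s; rewrite opprD addrACA subrr add0r.
Qed.

Lemma has_deriv_within_near (D : set R) (f g : R -> R) t (l : R) :
  (\forall s \near t, f s = g s) ->
  has_deriv_within D f t l -> has_deriv_within D g t l.
Proof.
move=> fg /has_deriv_withinP hf; apply/has_deriv_withinP => e e0.
have <- := nbhs_singleton fg.
by move: fg (hf _ e0); apply: filterS2 => s <-.
Qed.

Variables (F : J -> R -> hist -> R) (B t0 : R) (phi0 : hist) (M0 : R).
Hypothesis t0_ge0 : 0 <= t0.
Hypothesis F_cont : forall j, hist_continuous (F j).
Hypothesis F_bound : forall j t (phi : hist) (M : R), 0 <= t -> hist_cont phi ->
  hist_bounded M phi -> `|F j t phi| <= B.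
Hypothesis phi0_cont : hist_cont phi0.
Hypothesis phi0_bound : hist_bounded M0 phi0.

Let B_ge0 (j : J) : 0 <= B.
Proof. exact: le_trans (normr_ge0 _) (F_bound j t0_ge0 phi0_cont phi0_bound). Qed.

(** The invariants of Tonelli's scheme. The constant [B] is independent of the delay, which provides
    equicontinuity when the delay tends to 0. *)
Let nice (x : J -> R -> R) := [/\ forall j, continuous (x j),
  forall j t, t <= t0 -> x j t = phi0 j (t - t0) &
  forall j s t, t0 <= s -> s <= t -> `|x j t - x j s| <= B * (t - s)].

Let nice_bound x t : nice x -> hist_bounded (M0 + B * Num.max 0 (t - t0)) (past x t).
Proof.
move=> [_ x0 xB] j u u0; rewrite /past.
have B0 := B_ge0 j.
have [tu|tu] := leP (t + u) t0.
  rewrite x0// (le_trans (phi0_bound _ _))// ?subr_le0//.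
  by rewrite lerDl mulr_ge0// le_max lexx.
have := xB j _ _ (lexx t0) (ltW tu); rewrite (x0 j t0)// subrr => h.
rewrite -[x j _](subrK (phi0 j 0)) (le_trans (ler_normD _ _))// addrC lerD//.
  exact: phi0_bound.
rewrite (le_trans h)// ler_wpM2l// le_max; apply/orP; right; lra.
Qed.

Let nice_cont x t : nice x -> hist_cont (past x t).
Proof. by move=> [cx _ _]; apply: hist_cont_past => j s _; exact: cx. Qed.

(* Tonelli's scheme: delaying the state by [eps] makes the equation explicit on
   successive intervals of length [eps]. *)
Let rhs (eps : R) (x : J -> R -> R) j s :=
  F j (Num.max s t0) (past x (Num.max s t0 - eps)).

Let max_cont (s : R) : {for s, continuous (fun r : R => Num.max r t0)}.
Proof.
have := @continuous_max R R id (cst t0) s (@cvg_id _ _) (@cvg_cst _ _ _ _ _).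
exact.
Qed.

Let rhs_cont eps x j : nice x -> continuous (rhs eps x j).
Proof.
move=> nx s.
pose M := M0 + B * Num.max 0 (Num.max s t0 - eps + 1 - t0).
have ms : 0 <= Num.max s t0 by rewrite le_max t0_ge0 orbT.
have near1 : \forall r \near s, Num.max r t0 - eps <= Num.max s t0 - eps + 1.
  have /cvgrPdist_le/(_ 1 ltr01) := @max_cont s; apply: filterS => r.
  by rewrite ler_norml => /andP[? _]; lra.
apply: (F_cont (M := M)) => //.
- apply: filterS near1 => r hr; split.
  + by rewrite le_max t0_ge0 orbT.
  + exact: nice_cont.
  + move=> i u u0; apply: le_trans (nice_bound (Num.max r t0 - eps) nx i u0) _.
    rewrite lerD2l ler_wpM2l ?(B_ge0 j)// ge_max le_max lexx/= le_max.
    by apply/orP; right; lra.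
- exact: nice_cont.
- move=> i u u0; apply: le_trans (nice_bound (Num.max s t0 - eps) nx i u0) _.
  rewrite lerD2l ler_wpM2l ?(B_ge0 j)// ge_max le_max lexx/= le_max.
  by apply/orP; right; lra.
- exact: max_cont.
- apply: hist_cvg_past_cst; first by case: nx => cx _ _ i r _; exact: cx.
  by apply: cvgB; [exact: max_cont|exact: cvg_cst].
Qed.

(** Starting the integral at [t0 - 1] makes [t0] an interior point, where the primitive is
    continuous and differentiable. *)
Let prim (f : R -> R) x := \int[lebesgue_measure]_(t in `[t0 - 1, x]) f t.

Let primP f : continuous f ->
  forall t D, t0 - 1 < t -> has_deriv_within D (prim f) t (f t).
Proof. by move=> cf t D; exact: has_deriv_within_integral. Qed.

Let prim_cont f t : continuous f -> t0 <= t -> {for t, continuous (prim f)}.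
Proof.
move=> cf tt0; apply: (@has_deriv_within_continuous _ _ _ (f t) setT).
  by apply: (@filterE _ (nbhs t)).
by apply: primP => //; lra.
Qed.

(** The integral equation; the minimum and the maximum glue the initial history to the integral in
    one formula, continuous on the whole line. *)
Let step (eps : R) (x : J -> R -> R) : J -> R -> R := fun j t =>
  phi0 j (Num.min (t - t0) 0) +
  (prim (rhs eps x j) (Num.max t t0) - prim (rhs eps x j) t0).

Let step_deriv eps x j t : nice x -> t0 < t ->
  has_deriv_within `[t0, +oo[ (step eps x j) t (rhs eps x j t).
Proof.
move=> nx tt0.
have h : has_deriv_within `[t0, +oo[ (fun s => phi0 j 0 - prim (rhs eps x j) t0 +
    prim (rhs eps x j) s) t (rhs eps x j t).
  apply: has_deriv_withinDl; apply: primP; last by lra.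
  exact: rhs_cont.
apply: has_deriv_within_near h; near=> s; rewrite /step.
have st : t0 <= s by apply/ltW; near: s; exact: lt_nbhsr.
by rewrite max_l// min_r ?subr_ge0//; ring.
Unshelve. all: by end_near. Qed.

Let step_nice eps x : nice x -> nice (step eps x).
Proof.
move=> nx.
have cs j : continuous (step eps x j).
  move=> t; apply: cvgD; last apply: cvgB; last exact: cvg_cst.
    apply: (@continuous_comp _ _ _ (fun t => t - t0) (fun u => phi0 j (Num.min u 0))).
      by apply: cvgB; [exact: cvg_id|exact: cvg_cst].
    exact: phi0_cont.
  apply: (@continuous_comp _ _ _ (fun t => Num.max t t0) (prim (rhs eps x j))).
    exact: max_cont.
  by apply: prim_cont; [exact: rhs_cont|rewrite le_max lexx orbT].
split => [//|j t tt0|j s t st0 st].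
  by rewrite /step min_l ?subr_le0// max_r// subrr addr0.
have B0 := B_ge0 j.
have := @mean_value_dist R `[t0, +oo[ (step eps x j) (rhs eps x j) s t 0 B st.
rewrite mul0r subr0; apply.
- by move=> r /andP[sr _]; rewrite /= in_itv/= andbT (le_trans st0 (ltW sr)).
- exact: cs.
- exact: cs.
- by move=> r /andP[sr _]; apply: step_deriv => //; exact: le_lt_trans sr.
- move=> r _; rewrite subr0 /rhs.
  have m0 : 0 <= Num.max r t0 by rewrite le_max t0_ge0 orbT.
  exact: (F_bound j m0 (nice_cont nx) (nice_bound (Num.max r t0 - eps) nx)).
Qed.

Let rhs_agree eps x y j t s : 0 < eps -> nice x -> nice y ->
  (forall i r, r <= t - eps -> x i r = y i r) -> s <= t -> t0 <= s ->
  rhs eps x j s = rhs eps y j s.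
Proof.
move=> e0 nx ny xy st t0s; rewrite /rhs max_l//.
apply: (hist_continuous_ext (@F_cont j) _ (nice_cont nx) (nice_bound _ nx)).
  exact: le_trans t0s.
by move=> i u u0; apply: xy; lra.
Qed.

Let step_agree eps x y j t : 0 < eps -> nice x -> nice y ->
  (forall i r, r <= t - eps -> x i r = y i r) -> step eps x j t = step eps y j t.
Proof.
move=> e0 nx ny xy; rewrite /step; congr (_ + _).
have [tt0|/ltW tt0] := leP t t0; first by rewrite !subrr.
have := @mean_value_dist R setT (fun s => prim (rhs eps x j) s - prim (rhs eps y j) s)
  (fun s => rhs eps x j s - rhs eps y j s) t0 t 0 0 tt0.
rewrite !mul0r subr0 => H.
suff : `|prim (rhs eps x j) t - prim (rhs eps y j) t -
   (prim (rhs eps x j) t0 - prim (rhs eps y j) t0)| <= 0.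
  by rewrite normr_le0 => /eqP; lra.
apply: H => //.
- by apply: cvgB; apply: prim_cont => //; exact: rhs_cont.
- by apply: cvgB; apply: prim_cont => //; exact: rhs_cont.
- move=> r /andP[r1 r2]; apply: has_deriv_withinB; (apply: primP; last by lra);
  exact: rhs_cont.
- move=> r /andP[r1 r2]; rewrite subr0 normr_le0 subr_eq0; apply/eqP.
  exact: (@rhs_agree eps x y j t r e0 nx ny xy (ltW r2) (ltW r1)).
Qed.

(** Since a step reads the state with delay [eps], each iteration stabilizes the iterates on one
    more interval of length [eps]. After finitely many, an iterate solves the delayed equation up to
    [t0 + K]. *)
Lemma tonelli_approx eps K : 0 < eps -> exists2 x, nice x &
  forall j t, t0 < t -> t < t0 + K ->
    has_deriv_within `[t0, +oo[ (x j) t (F j t (past x (t - eps))).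
Proof.
move=> e0; pose x0 : J -> R -> R := fun j t => phi0 j (Num.min (t - t0) 0).
have nx0 : nice x0.
  split=> [j t|j t tt0|j s t st0 st].
  - apply: (@continuous_comp _ _ _ (fun t => t - t0) (fun u => phi0 j (Num.min u 0))).
      by apply: cvgB; [exact: cvg_id|exact: cvg_cst].
    exact: phi0_cont.
  - by rewrite /x0 min_l// subr_le0.
  - have tt0 := le_trans st0 st.
    rewrite /x0 !min_r ?subr_ge0// subrr normr0 mulr_ge0 ?(B_ge0 j)//.
    by rewrite subr_ge0.
pose X m := iter m (step eps) x0.
have nX m : nice (X m) by elim: m => //= m IH; exact: step_nice.
have agree m j t : t <= t0 + m%:R * eps -> X m.+1 j t = X m j t.
  elim: m j t => [|m IH] j t.
    rewrite mul0r addr0 => tt0.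
    by have [_ -> //] := nX 1%N; have [_ -> //] := nX 0%N.
  move=> ht; apply: (@step_agree eps _ _ j t e0 (nX m.+1) (nX m)) => i r hr; apply: IH.
  by move: ht; rewrite -natr1 mulrDl mul1r; lra.
pose m := Num.bound (K / eps).
have Km : K <= m%:R * eps.
  rewrite -ler_pdivrMr//; have [K0|K0] := leP 0 (K / eps).
    exact/ltW/archi_boundP.
  by rewrite (le_trans (ltW K0)).
exists (X m.+1) => // j t tt0 tK.
have := @step_deriv eps (X m) j t (nX m) tt0.
have -> : rhs eps (X m) j t = F j t (past (X m.+1) (t - eps)) => //.
rewrite /rhs max_l ?(ltW tt0)//.
apply: (hist_continuous_ext (@F_cont j) _ (nice_cont (nX m)) (nice_bound _ (nX m))).
  exact/(le_trans t0_ge0)/ltW.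
move=> i u u0; rewrite /past -agree//; lra.
Qed.

(** The approximation of index [k] has delay 1 / (k + 1) and solves its equation up to [t0 + k], so
    the limit along the ultrafilter is a solution for all times. *)
Theorem peano : exists x : J -> R -> R, [/\ forall j, continuous (x j),
  forall j u, u <= 0 -> x j (t0 + u) = phi0 j u &
  forall j t, t0 <= t -> has_deriv_within `[t0, +oo[ (x j) t (F j t (past x t))].
Proof.
have [U UU Uoo] := free_ultrafilter.
have PU : ProperFilter U by exact: ultra_proper.
have [z zP] : exists z : nat -> J -> R -> R, forall k, nice (z k) /\
    forall j t, t0 < t -> t < t0 + k%:R ->
    has_deriv_within `[t0, +oo[ (z k j) t (F j t (past (z k) (t - k.+1%:R^-1))).
  suff [z zP] : {z : nat -> J -> R -> R & forall k, nice (z k) /\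
    forall j t, t0 < t -> t < t0 + k%:R ->
    has_deriv_within `[t0, +oo[ (z k j) t (F j t (past (z k) (t - k.+1%:R^-1)))}.
    by exists z.
  apply: (@choice nat (J -> R -> R) (fun k x => nice x /\
    forall j t, t0 < t -> t < t0 + k%:R ->
    has_deriv_within `[t0, +oo[ (x j) t (F j t (past x (t - k.+1%:R^-1))))) => k.
  have k0 : 0 < (k.+1%:R : R)^-1 by rewrite invr_gt0 ltr0n.
  by have [x nx dx] := tonelli_approx k%:R k0; exists x.
have zM t k j : `|z k j t| <= M0 + B * Num.max 0 (t - t0).
  have [nz _] := zP k.
  by have := nice_bound t nz j (lexx 0); rewrite /past addr0.
have zl j t : exists l : R, z k j t @[k --> U] --> l.
  have [|l hl _] := @ultra_lim R nat U (fun k => z k j t) (M0 + B * Num.max 0 (t - t0)) UU.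
    by apply: filterE => k; exact: zM.
  by exists l.
have [y yP] : exists y : J -> R -> R, forall j t, z k j t @[k --> U] --> y j t.
  have [y hy] := @choice (J * R) R (fun p (l : R) => z k p.1 p.2 @[k --> U] --> l) (fun p => zl p.1 p.2).
  by exists (fun j t => y (j, t)) => j t; exact: (hy (j, t)).
have cc j t : cvg_cont U (fun k => z k j) (y j) t.
  apply: cvg_cont_equicontinuous => // e e0.
  have e20 : 0 < e / 2 by rewrite divr_gt0.
  have e3 : 0 < e / 2 / (B + 1) by rewrite divr_gt0// ltr_wpDl// (B_ge0 j).
  (* Before [t0] the approximations have no Lipschitz bound, but they all coincide with this one
     continuous function; after [t0] it is constant and the bound [B] takes over. *)
  pose base s := phi0 j (Num.min (s - t0) 0).
  have cb : {for t, continuous base}.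
    apply: (@continuous_comp _ _ _ (fun t => t - t0) (fun u => phi0 j (Num.min u 0))).
      by apply: cvgB; [exact: cvg_id|exact: cvg_cst].
    exact: phi0_cont.
  have zb k r s : r <= s -> `|z k j s - z k j r| <= `|base s - base r| + B * (s - r).
    move=> rs; have [[_ z0 zB] _] := zP k; have B0 := B_ge0 j.
    have brs : 0 <= B * (s - r) by rewrite mulr_ge0// subr_ge0.
    have [st0|/ltW t0s] := leP s t0.
      rewrite !z0//; last exact: le_trans st0.
      by rewrite /base !min_l ?subr_le0 ?(le_trans rs st0)// lerDl.
    have [rt0|/ltW t0r] := leP r t0; last by rewrite (le_trans (zB _ _ _ t0r rs))// lerDr.
    rewrite (le_trans (ler_distD (z k j t0) _ _))// addrC lerD//.
      by rewrite !z0// /base min_r ?subr_ge0// min_l ?subr_le0// subrr.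
    by rewrite (le_trans (zB _ _ _ _ t0s))// ler_wpM2l// lerD2l lerN2.
  have h : \forall s \near t, `|base s - base t| <= e / 2 /\ B * `|s - t| <= e / 2.
    near=> s; split.
      by rewrite distrC; near: s; move/cvgrPdist_le : cb; exact.
    have : `|s - t| <= e / 2 / (B + 1).
      rewrite distrC; near: s.
      by have /cvgrPdist_le := @cvg_id R (nbhs t); apply.
    move=> /(ler_wpM2l (B_ge0 j))/le_trans; apply.
    by rewrite mulrC frac_le ?(B_ge0 j)// ltW.
  exists (setT, [set s | `|base s - base t| <= e / 2 /\ B * `|s - t| <= e / 2]) => /=.
    by split => //; exact: filterT.
  move=> [k s] /= [_ [h1 h2]]; rewrite [leRHS]splitr.
  have [st|/ltW ts] := leP s t.
    rewrite distrC (le_trans (zb k _ _ st))// lerD//; first by rewrite distrC.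
    by move: h2; rewrite ler0_norm ?subr_le0// opprB.
  by rewrite (le_trans (zb k _ _ ts))// lerD//; move: h2; rewrite ger0_norm ?subr_ge0.
have cy j : continuous (y j) by exact: cvg_cont_continuous (cc j).
exists y; split => // [j u u0|j t t0t].
  have zy := yP j (t0 + u).
  apply: cvg_unique zy _; first exact: norm_hausdorff.
  have -> : (fun k => z k j (t0 + u)) = fun=> phi0 j u.
    by apply/funext => k; have [[_ h _] _] := zP k; rewrite h ?gerDl// addrAC subrr add0r.
  exact: cvg_cst.
have epsU : (k.+1%:R : R)^-1 @[k --> U] --> (0 : R).
  by apply: cvg_trans (@cvg_harmonic R); exact: cvg_fmap2 Uoo.
pose G k s := F j s (past (z k) (s - k.+1%:R^-1)).
apply: (@cvg_cont_deriv R nat U PU (fun k => z k j) G) => //.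
- have kt : \forall k \near U, t - t0 + 1 < k%:R.
    apply: Uoo; near=> k; near: k; exact: nbhs_infty_gtr.
  exists ([set k | t - t0 + 1 < k%:R], [set s | s < t + 1]) => /=.
    by split=> //; apply: lt_nbhsl; lra.
  move=> [k s] /= [h1 h2]; have [[cz _ _] dz] := zP k; split; first exact: cz.
  by move=> h3 _; apply: dz => //; lra.
- move=> e e0.
  have : \forall p \near (U, within `[t0, +oo[ (nbhs t)), `|F j t (past y t) - G p.1 p.2| <= e.
    have : G p.1 p.2 @[p --> (U, within `[t0, +oo[ (nbhs t))] --> F j t (past y t).
      apply: (F_cont (M := M0 + B * Num.max 0 (t + 1 - t0))).
      + exact: le_trans t0t.
      + exists (setT, [set s | t0 <= s <= t + 1]) => /=.
          split; first exact: filterT.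
          rewrite /within/=; have := @lt_nbhsl R t (t + 1) ltac:(lra).
          by apply: filterS => s st; rewrite in_itv/= andbT => ->; exact: ltW.
        move=> [k s] /= [_ /andP[h1 h2]]; have [nz _] := zP k; split.
        * exact: le_trans h1.
        * exact: nice_cont.
        * move=> i u u0; apply: le_trans (nice_bound _ nz i u0) _.
          have k0 : 0 <= (k.+1%:R : R)^-1 by rewrite invr_ge0.
          rewrite lerD2l ler_wpM2l ?(B_ge0 j)// ge_max le_max lexx/= le_max.
          by apply/orP; right; move: (k.+1%:R^-1) k0 h2 => *; lra.
      + by apply: hist_cont_past => i s _; exact: cy.
      + move=> i u u0; rewrite /past.
        have [|l hl lM] := @ultra_lim R nat U (fun k => z k i (t + u))
          (M0 + B * Num.max 0 (t + 1 - t0)) UU.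
          apply: filterE => k; apply: le_trans (zM _ _ _) _.
          rewrite lerD2l ler_wpM2l ?(B_ge0 j)// ge_max le_max lexx/= le_max.
          by apply/orP; right; lra.
        have -> : y i (t + u) = l => //.
        by apply: cvg_unique (yP _ _) hl; exact: norm_hausdorff.
      + exact: cvg_trans (cvg_snd) (cvg_within _).
      + apply: (hist_cvg_past (U := U)) => //.
          by apply: (@cvg_fst nat R U (within `[t0, +oo[ (nbhs t))).
        rewrite -[X in _ --> X]subr0; apply: cvgB.
          exact: cvg_trans (cvg_snd) (cvg_within _).
        exact: (cvg_comp (@fst nat R) _ (@cvg_fst nat R U (within `[t0, +oo[ (nbhs t)) _) epsU).
    by move/cvgrPdist_le; exact.
  move=> /near_prod_within; apply: filterS => p h h1 _; rewrite distrC; apply: h.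
  by rewrite /= in_itv/= andbT ltW.
- by apply: filterE => s _; exact: yP.
Unshelve. all: by end_near. Qed.

End Peano.

(** * Invariant boxes and continuation of solutions *)

Section Systems.
Context {R : realType} {J : finType}.
Local Notation hist := (@hist R J).
Implicit Types (F : J -> R -> hist -> R) (x y : J -> R -> R) (phi : hist).

(** Truncation makes the right-hand side globally bounded, as Peano's theorem requires, and leaves
    it unchanged on histories inside the box. *)
Definition clamp_hist (M : J -> R) (phi : hist) : hist :=
  fun j u => clamp (- M j) (M j) (phi j u).

Lemma clamp_dist (l m u v : R) : `|clamp l m u - clamp l m v| <= `|u - v|.
Proof.
wlog uv : u v / u <= v.
  move=> H; have [/H//|/ltW/H] := leP u v; by rewrite distrC (distrC v).
have e1 : clamp l m u <= clamp l m v.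
  rewrite /clamp ge_max !le_max lexx/=; apply/orP; right.
  by rewrite le_min !ge_min lexx uv/= orbT.
rewrite distrC ger0_norm ?subr_ge0// distrC ger0_norm ?subr_ge0//.
rewrite /clamp; have := uv; clear; move=> uv.
have [h1|h1] := leP m u; have [h2|h2] := leP m v; rewrite /Num.max;
  do 2 case: ltP => ?; lra.
Qed.

Lemma clamp_bound (m u : R) : 0 <= m -> `|clamp (- m) m u| <= m.
Proof.
move=> m0; rewrite ler_norml /clamp le_max lexx/= ge_max ge_min lexx.
by apply/andP; split => //; lra.
Qed.

Lemma clamp_id (m u : R) : `|u| <= m -> clamp (- m) m u = u.
Proof. by rewrite ler_norml /clamp => /andP[h1 h2]; rewrite min_l// max_r//. Qed.

Lemma lip_continuous (f : R -> R) : (forall u v, `|f u - f v| <= `|u - v|) ->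
  continuous f.
Proof.
move=> fL u; apply/cvgrPdist_le => e e0.
have /cvgrPdist_le/(_ _ e0) := @cvg_id R (nbhs u).
by apply: filterS => v; apply: le_trans.
Qed.

Lemma hist_cont_clamp M phi : hist_cont phi -> hist_cont (clamp_hist M phi).
Proof.
move=> cphi j u; rewrite /clamp_hist.
apply: (@continuous_comp R R R (fun u : R => phi j (Num.min u 0)) (clamp (- M j) (M j)) u).
  exact: cphi.
by apply: lip_continuous => v w; exact: clamp_dist.
Qed.

Lemma hist_continuous_clamp (M : J -> R) (F : R -> hist -> R) : (forall j, 0 <= M j) ->
  hist_continuous F -> hist_continuous (fun t phi => F t (clamp_hist M phi)).
Proof.
move=> M0 FC S FS t phi t0 phi0 N FF t00 H cphi0 bphi0 tt0 hc.
pose N' := \sum_j M j.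
have MN j : M j <= N' by rewrite /N' (bigD1 j)//= lerDl sumr_ge0.
have bc psi : hist_bounded N' (clamp_hist M psi).
  by move=> j u _; apply: le_trans (MN j); exact: clamp_bound.
apply: (FC S FS t _ t0 _ N') => //.
- by apply: filterS H => k [h1 h2 h3]; split => //; exact: hist_cont_clamp.
- exact: hist_cont_clamp.
- move=> T e e0; apply: filterS (hc T e e0) => k h j u Tu u0.
  exact: le_trans (clamp_dist _ _ _ _) (h j u Tu u0).
Qed.

Lemma hist_continuous_time (theta : R -> R) (F : R -> hist -> R) :
  continuous theta -> (forall t, 0 <= t -> 0 <= theta t) ->
  hist_continuous F -> hist_continuous (fun t phi => F (theta t) phi).
Proof.
move=> cth th0 FC S FS t phi t0 phi0 N FF t00 H cphi0 bphi0 tt0 hc.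
apply: (FC S FS _ phi _ phi0 N) => //; first exact: th0.
- by apply: filterS H => k [h1 h2 h3]; split => //; exact: th0.
- exact: (cvg_comp t theta tt0 (cth t0)).
Qed.

Lemma past_bounded M x t : (forall j s, s <= t -> `|x j s| <= M) ->
  hist_bounded M (past x t).
Proof. by move=> xM j u u0; apply: xM; rewrite gerDl. Qed.

Lemma has_deriv_within_decr (f : R -> R) t l lo : lo <= t -> l < 0 ->
  has_deriv_within `[lo, +oo[ f t l -> \forall s \near t, t < s -> f s <= f t.
Proof.
move=> lot l0 /has_deriv_withinP/(_ (- l)); rewrite oppr_gt0 => /(_ l0).
apply: filterS => s H ts; have : `[lo, +oo[%classic s.
  by rewrite /= in_itv/= andbT (le_trans lot)// ltW.
move=> /H; rewrite ler_norml (ger0_norm (_ : 0 <= s - t)) ?subr_ge0 ?(ltW ts)//.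
by move=> /andP[_]; lra.
Qed.

Lemma has_deriv_withinN (D : set R) (f : R -> R) t (l : R) :
  has_deriv_within D f t l -> has_deriv_within D (fun s => - f s) t (- l).
Proof.
move=> /has_deriv_withinP hf; apply/has_deriv_withinP => e e0.
apply: filterS (hf _ e0) => s h /h; rewrite -normrN; congr (`|_| <= _); ring.
Qed.

(** The truncated equation is solved from the zero history. The field points strictly inward on the
    faces of the box, so the solution stays inside and truncation never acts. *)
Lemma bounded_solution F (M : J -> R) (B : R) :
  (forall j, hist_continuous (F j)) -> (forall j, 0 <= M j) ->
  (forall j t phi, 0 <= t -> hist_cont phi ->
     (forall i u, u <= 0 -> `|phi i u| <= M i) ->
     [/\ `|F j t phi| <= B, phi j 0 = M j -> F j t phi < 0 &
         phi j 0 = - M j -> 0 < F j t phi]) ->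
  exists x, [/\ forall j, continuous (x j), forall j t, `|x j t| <= M j &
    forall j t, 0 <= t -> has_deriv_within `[0, +oo[ (x j) t (F j t (past x t))].
Proof.
move=> FC M0 HF.
have c0 : hist_cont (fun (_ : J) (_ : R) => (0 : R)).
  by move=> j u; apply: cvg_cst.
have b0 : hist_bounded 0 (fun (_ : J) (_ : R) => (0 : R)).
  by move=> j u _; rewrite normr0.
have cb phi : hist_cont phi -> hist_cont (clamp_hist M phi) /\
    forall i u, u <= 0 -> `|clamp_hist M phi i u| <= M i.
  by move=> cphi; split; [exact: hist_cont_clamp|move=> i u _; exact: clamp_bound].
have [|j t phi N t0 cphi _|x [cx x0 dx]] := @peano R J
    (fun j t phi => F j t (clamp_hist M phi)) B 0 _ 0 (lexx 0) _ _ c0 b0.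
- by move=> j; exact: hist_continuous_clamp.
- by have [h1 h2] := cb _ cphi; have [] := HF j t _ t0 h1 h2.
have xM j t : `|x j t| <= M j.
  have [t0|/ltW t0] := leP t 0.
    by have := x0 j t t0; rewrite add0r => ->; rewrite normr0.
  (* One barrier function for each face of the box; the boolean chooses between the two opposite
     faces. *)
  pose u (p : J * bool) s := (if p.2 then x p.1 s else - x p.1 s) - M p.1.
  have cu p : continuous (u p).
    move=> s; apply: cvgB; last exact: cvg_cst.
    by rewrite /u; case: p.2; [exact: cx|apply: cvgN; exact: cx].
  have u_le p s : 0 <= s <= t -> u p s <= 0.
    apply: (@barrier R _ u 0 t) => //.
    - by move=> q r _; exact: cu.
    - move=> [i c]; rewrite /u/=; have := x0 i 0 (lexx 0); rewrite add0r => ->.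
      by case: c; rewrite ?oppr0 sub0r oppr_le0.
    move=> [i c] r /andP[r0 rt] _; rewrite /u/=.
    have cp : hist_cont (past x r) by apply: hist_cont_past => k q _; exact: cx.
    have [h1 h2] := cb _ cp; have [_ hp hn] := HF i r _ r0 h1 h2.
    have cl : clamp_hist M (past x r) i 0 = clamp (- M i) (M i) (x i r).
      by rewrite /clamp_hist /past addr0.
    case: c => /eqP; rewrite subr_eq0 => /eqP e.
      have := has_deriv_within_decr r0 _ (dx i r r0); move=> H.
      apply: filterS (H (hp _)) => [s' hs' /hs'|]; first by rewrite e subr_le0.
      by rewrite cl e clamp_id// ger0_norm.
    have := has_deriv_within_decr r0 _ (has_deriv_withinN (dx i r r0)); move=> H.
    have e' : x i r = - M i by rewrite -e opprK.
    rewrite oppr_lt0 in H; apply: filterS (H (hn _)) => [s' hs' /hs'|].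
      by rewrite e subr_le0.
    by rewrite cl e' clamp_id// normrN ger0_norm.
  have h1 := u_le (j, true) t; have h2 := u_le (j, false) t.
  rewrite ler_norml; move: h1 h2; rewrite /u/= lexx t0 => /(_ isT) h1 /(_ isT) h2.
  by apply/andP; split; lra.
exists x; split => // j t t0.
have := dx j t t0.
have cp : hist_cont (past x t) by apply: hist_cont_past => k q _; exact: cx.
pose N := \sum_j M j.
have MN i : M i <= N by rewrite /N (bigD1 i)//= lerDl sumr_ge0.
have -> // : F j t (clamp_hist M (past x t)) = F j t (past x t).
apply/esym/(hist_continuous_ext (M := N) (FC j) t0 cp).
  by apply: past_bounded => i s _; apply: le_trans (MN i).
by move=> i u _; rewrite /clamp_hist clamp_id// /past.
Qed.

(* Being Lipschitz, [x] has a limit at [T]; Peano's theorem is restarted there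
   for the equation with clamped histories. *)
Lemma extend_solution F x t0 T (M B : R) : (forall j, hist_continuous (F j)) ->
  0 <= t0 -> t0 < T ->
  (forall j t phi, 0 <= t -> t <= T + 1 -> hist_cont phi ->
     hist_bounded (M + 1) phi -> `|F j t phi| <= B) ->
  (forall j t, t < T -> {for t, continuous (x j)}) ->
  (forall j t, t < T -> `|x j t| <= M) ->
  (forall j t, t0 <= t -> t < T ->
     has_deriv_within `[t0, +oo[ (x j) t (F j t (past x t))) ->
  exists2 delta, 0 < delta & exists y, [/\ forall j, continuous (y j),
    forall j t, t < T -> y j t = x j t &
    forall j t, t0 <= t -> t < T + delta ->
      has_deriv_within `[t0, +oo[ (y j) t (F j t (past y t))].
Proof.
move=> FC t00 t0T FB cx xM dx.
have T0 : 0 <= T by apply/ltW/(le_lt_trans t00).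
have M0 (j : J) : 0 <= M by apply: le_trans (xM j _ t0T).
have cpx t : t < T -> hist_cont (past x t).
  by move=> tT; apply: hist_cont_past => j s st; apply: cx; exact: le_lt_trans tT.
have lipx j r s : t0 <= r -> r <= s -> s < T -> `|x j s - x j r| <= B * (s - r).
  move=> t0r rs sT; have := @mean_value_dist R `[t0, +oo[ (x j)
    (fun t => F j t (past x t)) r s 0 B rs.
  rewrite mul0r subr0; apply.
  - by move=> t /andP[h1 h2]; rewrite /= in_itv/= andbT (le_trans t0r)// ltW.
  - by apply: cx; exact: le_lt_trans sT.
  - exact: cx.
  - move=> t /andP[h1 h2]; apply: dx; first by rewrite (le_trans t0r)// ltW.
    exact: lt_trans sT.
  - move=> t /andP[h1 h2]; have tT := lt_trans h2 sT; rewrite subr0; apply: FB.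
    + by rewrite (le_trans t00)// (le_trans t0r)// ltW.
    + by rewrite (le_trans (ltW tT))// lerDl.
    + exact: cpx.
    + apply: past_bounded => i q qt; rewrite (@le_trans _ _ M)// ?lerDl//.
      by apply: xM; exact: le_lt_trans tT.
have limx j : exists l : R, x j s @[s --> T^'-] --> l.
  apply: (@cvg_ex _ (x j s @[s --> T^'-])).1; apply/cauchy_cvgP/cauchy_exP => e e0.
  have B0 : 0 <= B.
    have := lipx j t0 ((t0 + T) / 2); rewrite lexx => /(_ isT).
    have [h1 h2] := midf_lt t0T.
    move=> /(_ (ltW h1) h2) h; have := le_trans (normr_ge0 _) h.
    by rewrite pmulr_lge0// subr_gt0.
  have e1 : 0 < e / (B + 1) by rewrite divr_gt0// ltr_wpDl.
  pose s0 := Num.max t0 (T - e / (B + 1)).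
  have s0T : s0 < T by rewrite gt_max t0T/= gtrBl.
  exists (x j s0).
  have : \forall s \near T^'-, s0 < s /\ s < T.
    near=> s; split; last by near: s; exact: nbhs_left_lt.
    by near: s; exact: nbhs_left_gt.
  apply: filterS => s [s0s sT]; rewrite /ball/= distrC.
  apply: le_lt_trans (lipx j _ _ _ (ltW s0s) sT) _.
    by rewrite le_max lexx.
  have h : s - s0 <= e / (B + 1).
    have h3 : T - e / (B + 1) <= s0 by rewrite le_max lexx orbT.
    by rewrite lerBlDl -lerBlDr (le_trans _ h3)// lerD2r ltW.
  apply: le_lt_trans (ler_wpM2l B0 h) _.
  rewrite mulrC mulrAC ltr_pdivrMr ?ltr_wpDl// ltr_pM2l// ltrDl.
  exact: ltr01.
have [l hl] : exists l : J -> R, forall j, x j s @[s --> T^'-] --> l j.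
  by have [l hl] := choice limx; exists l.
(* The solution completed by its limit at [T] and kept constant afterwards: a globally continuous
   function supplying the new initial history. *)
pose w j t := if t < T then x j t else l j.
have cw j : continuous (w j).
  move=> t; have [tT|Tt|->] := ltgtP t T.
  - have e : w j t = x j t by rewrite /w tT.
    have h : {near t, x j =1 w j}.
      by near=> s; rewrite /w ifT//; near: s; exact: lt_nbhsl.
    by rewrite /continuous_at e; exact: cvg_trans (near_eq_cvg h) (cx j t tT).
  - have e : w j t = l j by rewrite /w ltNge (ltW Tt).
    have h : {near t, (fun=> l j) =1 w j}.
      near=> s; rewrite /w ifF//; apply/negbTE; rewrite -leNgt.
      by apply/ltW; near: s; exact: lt_nbhsr.
    by rewrite /continuous_at e; exact: cvg_trans (near_eq_cvg h) (cvg_cst (l j)).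
  - rewrite /continuous_at; apply/cvgrPdist_le => e e0; rewrite /w ltxx.
    have /cvgrPdist_le/(_ _ e0) := hl j.
    rewrite /at_left near_withinE; apply: filterS => s h; case: ifPn => [/h//|_].
    by rewrite subrr normr0 ltW.
have wM j t : t <= T -> `|w j t| <= M.
  rewrite le_eqVlt => /predU1P[->|tT]; last by rewrite /w tT xM.
  have -> : w j T = l j by rewrite /w ltxx.
  rewrite -[l j]subr0; apply: (@cvg_dist_le _ _ (T^'-) _ _ _ _ _ (hl j)).
  by near=> s; rewrite subr0; apply: xM; near: s; exact: nbhs_left_lt.
(* Time is frozen at [T + 1] because the bound [B] is known only up to there; the extension is used
   only for [t < T + 1], where [theta] is the identity. *)
pose theta t := Num.min t (T + 1).
have cth : continuous theta.
  move=> t; have := @continuous_min R R id (cst (T + 1)) t (@cvg_id _ _) (@cvg_cst _ _ _ _ _).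
  exact.
have th0 t : 0 <= t -> 0 <= theta t by move=> t1; rewrite le_min t1 addr_ge0.
have M1 (j : J) : 0 <= M + 1 by rewrite addr_ge0// M0.
have [j|j t phi N t1 cphi _||j u u0|y [cy y0 dy]] := @peano R J
    (fun j t phi => F j (theta t) (clamp_hist (fun=> M + 1) phi)) B T (past w T) M T0.
- apply: (hist_continuous_clamp (F := fun t phi => F j (theta t) phi)) => //.
  exact: hist_continuous_time.
- apply: FB; [exact: th0|by rewrite ge_min lexx orbT|exact: hist_cont_clamp|].
  by move=> i u _; apply: clamp_bound; exact: M1.
- by apply: hist_cont_past => j s _; exact: cw.
- by apply: wM; rewrite gerDl.
have yw j t : t <= T -> y j t = w j t.
  by move=> tT; have := y0 j (t - T); rewrite /past subrKC subr_le0; exact.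
have /nbhs_ballP[d /= d0 hd] : \forall s \near T, forall j, `|y j s| <= M + 1.
  apply: (@filter_forall _ _ _ (nbhs T)) => j.
  have /cvgrPdist_le/(_ 1 ltr01) := cy j T; apply: filterS => s h.
  rewrite -[y j s](subrK (y j T)) (le_trans (ler_normD _ _))// addrC lerD//.
    by rewrite yw// wM.
  by rewrite distrC.
pose delta := Num.min d 1.
have yM j t : t < T + delta -> `|y j t| <= M + 1.
  move=> tT; have [tT'|Tt] := leP t T; first by rewrite yw// (le_trans (wM _ _ tT'))// lerDl.
  apply: hd; rewrite /ball/= ltr0_norm ?subr_lt0// opprB ltrBlDl.
  by rewrite (lt_le_trans tT)// lerD2l ge_min lexx.
have cpy t : hist_cont (past y t) by apply: hist_cont_past => j s _; exact: cy.
have dy' j t : T <= t -> t < T + delta ->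
    has_deriv_within `[T, +oo[ (y j) t (F j t (past y t)).
  move=> Tt tT; have := dy j t Tt; rewrite /theta min_l; last first.
    by rewrite (le_trans (ltW tT))// lerD2l ge_min lexx orbT.
  have -> // : F j t (clamp_hist (fun=> M + 1) (past y t)) = F j t (past y t).
  apply/esym/(hist_continuous_ext (M := M + 1) (FC j) (le_trans T0 Tt) (cpy t)).
    by apply: past_bounded => i s st; apply: yM; exact: le_lt_trans tT.
  move=> i u u0; rewrite /clamp_hist clamp_id//; apply: yM.
  by apply: le_lt_trans tT; rewrite gerDl.
have dyl j t : t0 <= t -> t < T -> has_deriv_within `[t0, +oo[ (y j) t (F j t (past y t)).
  move=> t0t tT; have := dx j t t0t tT.
  have -> : F j t (past x t) = F j t (past y t).
    apply: (hist_continuous_ext (M := M) (FC j) (le_trans t00 t0t) (cpx _ tT)).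
      by apply: past_bounded => i s st; apply: xM; exact: le_lt_trans tT.
    move=> i u u0; have tuT : t + u < T by apply: le_lt_trans tT; rewrite gerDl.
    by rewrite /past yw ?(ltW tuT)// /w tuT.
  apply: has_deriv_within_near; near=> s.
  have sT : s < T by near: s; exact: lt_nbhsl.
  by rewrite yw ?(ltW sT)// /w sT.
have dl0 : 0 < delta by rewrite lt_min d0 ltr01.
exists delta => //; exists y; split => // [j t tT|j t t0t tT].
  by rewrite yw ?(ltW tT)// /w tT.
have [tT'|Tt|eT] := ltgtP t T; first exact: dyl.
  apply: has_deriv_within_sub (dy' j t (ltW Tt) tT); near=> s => _.
  by rewrite /= in_itv/= andbT ltW//; near: s; exact: lt_nbhsr.
rewrite eT; have PF := principal_filter_proper tt.
have nearT : \forall s \near T, t0 <= s /\ s < T + delta.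
  near=> s; split; first by apply/ltW; near: s; exact: lt_nbhsr.
  by near: s; apply: lt_nbhsl; rewrite ltrDl.
(* At the junction only one-sided derivatives are known. The two-sided one follows because the
   derivative has the same limit from both sides; the lemma is applied to a constant family. *)
apply: (@cvg_cont_deriv R unit (principal_filter tt) PF (fun=> y j)
   (fun _ s => F j s (past y s)) (y j) t0 T _ (ltW t0T)).
- apply: (@filter_prod2 _ _ (principal_filter tt) (nbhs T) _ (fun s =>
    {for s, continuous (y j)} /\ (t0 < s -> s != T ->
      has_deriv_within `[t0, +oo[ (y j) s (F j s (past y s))))).
  apply: filterS nearT => s [h1 h2]; split; first exact: cy.
  move=> t0s; rewrite neq_lt => /orP[sT|Ts]; first exact: dyl.
  apply: has_deriv_within_sub (dy' j s (ltW Ts) h2); near=> r => _.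
  by rewrite /= in_itv/= andbT ltW//; near: r; exact: lt_nbhsr.
- move=> e e0.
  apply: (@filter_prod2 _ _ (principal_filter tt) (nbhs T) _ (fun s =>
    t0 < s -> s != T -> `|F j s (past y s) - F j T (past y T)| <= e)).
  have : F j s (past y s) @[s --> nbhs T] --> F j T (past y T).
    apply: (FC j R (nbhs T) id (fun s => past y s) T _ (M + 1)) => //.
    + apply: filterS nearT => s [h1 h2]; split => //; first exact: le_trans h1.
      by apply: past_bounded => i r rs; apply: yM; exact: le_lt_trans h2.
    + apply: past_bounded => i r rs; apply: yM; apply: le_lt_trans rs _.
      by rewrite ltrDl.
    by apply: hist_cvg_past_cst => [i r _|]; [exact: cy|exact: cvg_id].
  move/cvgrPdist_le/(_ _ e0); apply: filterS => s h _ _.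
  by rewrite distrC.
- by apply: (@filterE _ (nbhs T)) => s _; exact: cvg_cst.
Unshelve. all: by end_near. Qed.

End Systems.

(** * Estimates for increments of primitives *)

Section Primitives.
Context {R : realType}.

(* Bounded convergence, read on primitives: the integrands are bounded above
   uniformly but converge only pointwise. *)
Lemma primitive_limsup (q Q : nat -> R -> R) (lo al be c C : R) :
  lo < al -> al <= be -> (forall n, continuous (q n)) -> (forall n u, q n u <= C) ->
  (forall n u D, lo < u -> has_deriv_within D (Q n) u (q n u)) ->
  (forall u e, 0 < e -> \forall n \near \oo, q n u <= c + e) ->
  forall e, 0 < e -> \forall n \near \oo, Q n be - Q n al <= c * (be - al) + e.
Proof.
move=> loal albe cq qC dQ qc e e0.
pose mu : measure _ _ := @lebesgue_measure R.
(* The excess of the integrand over [c]: it is nonnegative, bounded by [C'] and tends to 0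
   pointwise, so its integrals tend to 0 by dominated convergence. *)
pose p n u := Num.max (q n u - c) 0.
have cp n : continuous (p n).
  move=> u; apply: (@continuous_max R R (fun v => q n v - c) (cst 0) u).
    by apply: cvgB; [exact: cq|exact: cvg_cst].
  exact: cvg_cst.
have p0 n u : 0 <= p n u by rewrite le_max lexx orbT.
pose C' := Num.max (C - c) 0.
have pC n u : p n u <= C'.
  by rewrite ge_max !le_max lexx orbT andbT lerD2r qC.
pose I := `[lo, be]%classic : set R.
have mI : measurable I by exact: measurable_itv.
have intI (f : R -> R) : continuous f -> mu.-integrable I (EFin \o f).
  move=> cf; apply: continuous_compact_integrable; first exact: segment_compact.
  exact: continuous_subspaceT.
have [|||||_ _ H] := @dominated_convergence _ _ R mu I mI (fun n => EFin \o p n) (cst 0%E)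
  (EFin \o cst C').
- by move=> n; exact: measurable_int (intI _ (cp n)).
- exact: measurable_cst.
- apply: aeW => u _; apply/cvg_EFin; first by apply: (@filterE _ \oo).
  apply/cvgrPdist_le => d d0; apply: filterS (qc u _ d0) => n h.
  by rewrite sub0r normrN ger0_norm//= ge_max (ltW d0) andbT; lra.
- by apply: intI => u; exact: cvg_cst.
- by apply: aeW => u n _; rewrite /= lee_fin ger0_norm.
have {}H : (\int[mu]_(t in I) p n t)%R @[n --> \oo] --> (0 : R).
  move: H; rewrite integral0 => H; exact: fine_cvg.
have pos n : 0 <= \int[mu]_(t in `[lo, al]) p n t by apply: Rintegral_ge0.
move/cvgrPdist_le/(_ _ e0) : H; apply: filterS => n; rewrite sub0r normrN => hn.
have D u : lo < u -> has_deriv_within setT (fun x => \int[mu]_(t in `[lo, x]) p n t) u (p n u).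
  by move=> lou; exact: has_deriv_within_integral.
have near_T (u : R) : \forall s \near u, [set: R] s by apply: (@filterE _ (nbhs u)).
(* Once the integral of the excess is subtracted, the derivative is at most [c]. *)
have := @mean_value_le R setT (fun x => Q n x - \int[mu]_(t in `[lo, x]) p n t)
  (fun u => q n u - p n u) al be c albe.
have dB u : al <= u -> has_deriv_within setT
    (fun x => Q n x - \int[mu]_(t in `[lo, x]) p n t) u (q n u - p n u).
  move=> alu; have lou := lt_le_trans loal alu.
  by apply: has_deriv_withinB; [exact: dQ|exact: D].
have cB u : al <= u -> {for u, continuous (fun x => Q n x - \int[mu]_(t in `[lo, x]) p n t)}.
  by move=> alu; exact: has_deriv_within_continuous (near_T u) (dB u alu).
move=> /(_ _ (cB _ (lexx _)) (cB _ albe)) h.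
have {}h : Q n be - \int[mu]_(t in `[lo, be]) p n t - (Q n al - \int[mu]_(t in `[lo, al]) p n t)
   <= c * (be - al).
  apply: h => // u /andP[/ltW alu _]; first exact: dB.
  by rewrite lerBlDr -lerBlDl le_max lexx.
by have := pos n; have := le_trans (ler_norm _) hn; rewrite /I; lra.
Qed.

Lemma primitive_dist (f g F G : R -> R) (lo al be e : R) : lo < al -> al <= be ->
  (forall u D, lo < u -> has_deriv_within D F u (f u)) ->
  (forall u D, lo < u -> has_deriv_within D G u (g u)) ->
  (forall u, al <= u <= be -> `|f u - g u| <= e) ->
  `|(F be - F al) - (G be - G al)| <= e * (be - al).
Proof.
move=> loal albe dF dG fg.
have near_T (u : R) : \forall s \near u, [set: R] s by apply: (@filterE _ (nbhs u)).
have dB u : al <= u -> has_deriv_within setT (fun x => F x - G x) u (f u - g u).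
  move=> alu; have lou := lt_le_trans loal alu.
  by apply: has_deriv_withinB; [exact: dF|exact: dG].
have cB u : al <= u -> {for u, continuous (fun x => F x - G x)}.
  by move=> alu; exact: has_deriv_within_continuous (near_T u) (dB u alu).
have := @mean_value_dist R setT (fun x => F x - G x) (fun u => f u - g u) al be 0 e albe.
rewrite mul0r subr0 => h.
rewrite (_ : _ - _ - _ = F be - G be - (F al - G al)); last by ring.
apply: h => //.
- exact: cB.
- exact: cB.
- by move=> t /andP[/ltW alt _]; exact: dB.
- by move=> t /andP[/ltW h1 /ltW h2]; rewrite subr0 fg// h1.
Qed.

End Primitives.

(** * Periodic systems and limits of translates *)

Section PeriodicSystems.
Context {R : realType} {J : finType}.
Local Notation hist := (@hist R J).

Lemma nonneg2_cvg (f : R -> R -> R) (S : Type) (FS : set_system S) (t u : S -> R) (t0 u0 : R) :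
  Filter FS -> continuous_nonneg2 f -> 0 <= t0 -> (\forall k \near FS, 0 <= t k) ->
  t @ FS --> t0 -> u @ FS --> u0 -> f (t k) (u k) @[k --> FS] --> f t0 u0.
Proof.
move=> FF /subspace_continuousP cf t00 tn tt0 uu0.
have D0 : (`[0, +oo[ `*` [set: R]) (t0, u0) by split => //=; rewrite in_itv/= t00.
have tu : (t k, u k) @[k --> FS] --> within (`[0, +oo[ `*` [set: R]) (nbhs (t0, u0)).
  move=> A; rewrite /within/= => nA.
  have H : \forall k \near FS, (`[0, +oo[ `*` [set: R]) (t k, u k) -> A (t k, u k).
    exact: (@cvg_pair _ _ _ FS (nbhs t0) (nbhs u0) _ _ _ t u tt0 uu0 _ nA).
  apply: filterS2 tn H => k tk; apply.
  by split => //=; rewrite in_itv/= tk.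
exact: (cvg_comp _ _ tu (cf _ D0)).
Qed.

Lemma nonneg_cvg (f : R -> R) (S : Type) (FS : set_system S) (t : S -> R) (t0 : R) :
  Filter FS -> continuous_nonneg f -> 0 <= t0 -> (\forall k \near FS, 0 <= t k) ->
  t @ FS --> t0 -> f (t k) @[k --> FS] --> f t0.
Proof.
move=> FF /subspace_continuousP cf t00 tn tt0.
have D0 : `[0, +oo[%classic t0 by rewrite /= in_itv/= t00.
have tu : t k @[k --> FS] --> within `[0, +oo[ (nbhs t0).
  move=> A; rewrite /within/= => nA.
  have H : \forall k \near FS, `[0, +oo[%classic (t k) -> A (t k) by exact: (tt0 _ nA).
  apply: filterS2 tn H => k tk; apply.
  by rewrite /= in_itv/= tk.
exact: (cvg_comp _ _ tu (cf _ D0)).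
Qed.

Lemma has_deriv_within_shift (D D' : set R) (f : R -> R) (c s l : R) :
  (\forall r \near s, D' r -> D (c + r)) ->
  has_deriv_within D f (c + s) l -> has_deriv_within D' (fun r => f (c + r)) s l.
Proof.
move=> DD /has_deriv_withinP H; apply/has_deriv_withinP => e e0.
have cs : c + r @[r --> s] --> c + s by apply: cvgD; [exact: cvg_cst|exact: cvg_id].
have He : \forall r \near s, D (c + r) ->
    `|f (c + r) - f (c + s) - l * (c + r - (c + s))| <= e * `|c + r - (c + s)|.
  exact: (cs _ (H e e0)).
apply: filterS2 DD He => r {}DD + /DD => /[apply].
by rewrite (_ : c + r - (c + s) = r - s)//; ring.
Qed.

Lemma periodic_iter (omega : R) (T : Type) (f : R -> T) :
  0 <= omega -> (forall t, 0 <= t -> f (t + omega) = f t) ->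
  forall (m : nat) t, 0 <= t -> f (t + m%:R * omega) = f t.
Proof.
move=> o0 fP; elim=> [|m IH] t t0; first by rewrite mul0r addr0.
by rewrite -natr1 mulrDl mul1r addrA fP ?IH// addr_ge0// mulr_ge0.
Qed.

Lemma period_decomposition (omega t : R) : 0 < omega -> 0 <= t ->
  exists r (m : nat), [/\ t = r + m%:R * omega, 0 <= r & r <= omega].
Proof.
move=> o0 t0; pose m := Num.truncn (t / omega).
have tm : 0 <= t / omega by rewrite divr_ge0// ltW.
have /andP[h1 h2] := truncn_itv tm.
exists (t - m%:R * omega), m; split; first by rewrite subrK.
  by rewrite subr_ge0 -ler_pdivlMr.
by move: h2; rewrite ltr_pdivrMr// -natr1 mulrDl mul1r -/m; lra.
Qed.

Section TranslateLimit.
Variables (F : J -> R -> hist -> R) (omega M : R).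
Hypothesis omega_gt0 : 0 < omega.
Hypothesis F_cont : forall j, hist_continuous (F j).
Hypothesis F_per : forall j t phi, 0 <= t -> F j (t + omega) phi = F j t phi.
Hypothesis F_bound : exists B, forall j t phi, 0 <= t -> hist_cont phi ->
  hist_bounded M phi -> `|F j t phi| <= B.
Variables (x err : J -> R -> R) (t0 : R).
Hypothesis t0_ge0 : 0 <= t0.
Hypothesis x_cont : forall j, continuous (x j).
Hypothesis x_bound : forall j t, `|x j t| <= M.
Hypothesis err_lim : forall j, err j t @[t --> +oo] --> (0 : R).
Hypothesis x_deriv : forall j t, t0 <= t ->
  has_deriv_within `[t0, +oo[ (x j) t (F j t (past x t) + err j t).

Lemma past_cont t : hist_cont (past x t).
Proof. by apply: hist_cont_past => j s _; exact: x_cont. Qed.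

(** Beyond some time the perturbation is below 1, so the derivative is bounded by the bound of [F]
    plus 1. Nothing of the kind holds on the initial history, which is merely continuous. *)
Lemma solution_lipschitz : exists T1 B, [/\ t0 <= T1, 0 <= B & forall j r s,
  T1 <= r -> T1 <= s -> `|x j s - x j r| <= B * `|s - r|].
Proof.
have [B HB] := F_bound.
have [T [_ hT]] : \forall t \near +oo, forall j, `|err j t| <= 1.
  apply: (@filter_forall _ _ _ (pinfty_nbhs R)) => j.
  have /cvgrPdist_le/(_ 1 ltr01) := (@err_lim j).
  by apply: filterS => t; rewrite sub0r normrN.
pose T1 := Num.max t0 (T + 1).
have HT j t : T1 <= t -> `|F j t (past x t) + err j t| <= `|B| + 1.
  move=> T1t; rewrite (le_trans (ler_normD _ _))// lerD//.
    rewrite (le_trans _ (ler_norm B))//; apply: HB => //.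
    - by rewrite (le_trans t0_ge0)// (le_trans _ T1t)// le_max lexx.
    - exact: past_cont.
    - by apply: past_bounded => i s _; exact: x_bound.
  apply: hT; apply: lt_le_trans T1t; rewrite lt_max; apply/orP; right.
  by rewrite ltrDl.
exists T1, (`|B| + 1); split; first by rewrite le_max lexx.
  by rewrite addr_ge0.
move=> j r s; wlog rs : r s / r <= s.
  move=> H Tr Ts; have [/H|/ltW/H] := leP r s; first exact.
  by rewrite distrC (distrC s); exact.
move=> Tr _; rewrite (ger0_norm (_ : 0 <= s - r)) ?subr_ge0//.
have := @mean_value_dist R `[t0, +oo[ (x j) (fun t => F j t (past x t) + err j t)
  r s 0 (`|B| + 1) rs.
have tr : t0 <= r by rewrite (le_trans _ Tr)// le_max lexx.
rewrite mul0r subr0; apply.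
- by move=> t /andP[rt _]; rewrite /= in_itv/= andbT (le_trans tr)// ltW.
- exact: x_cont.
- exact: x_cont.
- by move=> t /andP[rt _]; apply: x_deriv; rewrite (le_trans tr)// ltW.
- by move=> t /andP[rt _]; rewrite subr0; apply: HT; rewrite (le_trans Tr)// ltW.
Qed.

Variables (U : set_system nat) (tk r : nat -> R) (m : nat -> nat) (theta : R).
Hypothesis U_ultra : UltraFilter U.
Hypothesis tk_infty : forall C, \forall k \near U, C <= tk k.
Hypothesis tkE : forall k, tk k = r k + (m k)%:R * omega.
Hypothesis r_itv : forall k, 0 <= r k <= omega.
Hypothesis r_lim : r k @[k --> U] --> theta.

(** Translation by [tk k] amounts to the phase [r k], up to [m k] periods. Keeping [p] of these
    periods makes the time [theta + p * omega + s] nonnegative for [s] down to [- p * omega], so the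
    limit solves the periodic equation arbitrarily far into the past. *)
Lemma translate_limit : exists X : J -> R -> R, [/\ forall j, continuous (X j),
  forall j t, `|X j t| <= M,
  forall j s, cvg_cont U (fun k s => x j (tk k + s)) (X j) s &
  forall j s lo (p : nat), 0 <= p%:R * omega + lo -> lo <= s ->
    has_deriv_within `[lo, +oo[ (X j) s (F j (theta + p%:R * omega + s) (past X s))].
Proof.
have PU : ProperFilter U by exact: ultra_proper.
have [X XP] : exists X : J -> R -> R, forall j s,
    x j (tk k + s) @[k --> U] --> X j s /\ `|X j s| <= M.
  have H (p : J * R) : exists l : R, x p.1 (tk k + p.2) @[k --> U] --> l /\ `|l| <= M.
    have [|l h1 h2] := @ultra_lim R nat U (fun k => x p.1 (tk k + p.2)) M U_ultra.
      by apply: filterE => k; exact: x_bound.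
    by exists l.
  have [X hX] := choice H.
  by exists (fun j s => X (j, s)) => j s; exact: (hX (j, s)).
have Xl j s : x j (tk k + s) @[k --> U] --> X j s by have [] := XP j s.
have XM j s : `|X j s| <= M by have [] := XP j s.
have [T1 [B [tT1 B0 HB]]] := solution_lipschitz.
have cc j s : cvg_cont U (fun k s => x j (tk k + s)) (X j) s.
  apply: cvg_cont_equicontinuous => // e e0.
  have e1 : 0 < e / (B + 1) by rewrite divr_gt0// ltr_wpDl.
  (* For such [k], every translated time within distance 1 of [s] lies beyond [T1], where the
     Lipschitz bound applies. *)
  exists ([set k | T1 - s + 1 <= tk k], [set q | `|s - q| <= Num.min 1 (e / (B + 1))]) => /=.
    split; first exact: tk_infty.
    have d0 : 0 < Num.min 1 (e / (B + 1)) by rewrite lt_min ltr01.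
    by have /cvgrPdist_le/(_ _ d0) := @cvg_id R (nbhs s).
  move=> [k q] /= [h1]; rewrite le_min => /andP[h2 h3].
  have h4 : T1 <= tk k + q by move: h2; rewrite ler_norml => /andP[_]; lra.
  have h5 : T1 <= tk k + s by lra.
  apply: le_trans (HB j _ _ h5 h4) _.
  rewrite (_ : tk k + q - (tk k + s) = - (s - q)); last by ring.
  rewrite normrN (le_trans (ler_wpM2l B0 h3))//.
  by rewrite mulrC frac_le// ltW.
have cX j : continuous (X j) by exact: cvg_cont_continuous (cc j).
exists X; split => // j s lo p plo los.
pose xk k : J -> R -> R := fun j q => x j (tk k + q).
have pastE k q : past x (tk k + q) = past (xk k) q.
  by apply/funext => i; apply/funext => u; rewrite /past /xk addrA.
apply: (@cvg_cont_deriv R nat U PU (fun k => xk k j)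
  (fun k q => F j (tk k + q) (past x (tk k + q)) + err j (tk k + q))) => //.
- exists ([set k | t0 - s + 2 <= tk k], [set q | s - 1 < q]) => /=.
    by split; [exact: tk_infty|apply: lt_nbhsr; lra].
  move=> [k q] /= [h1 h2]; split.
    apply: (@continuous_comp R R R (fun q : R => tk k + q) (x j) q).
      by apply: cvgD; [exact: cvg_cst|exact: cvg_id].
    exact: x_cont.
  move=> _ _; apply: (@has_deriv_within_shift `[t0, +oo[).
    near=> q' => _; rewrite /= in_itv/= andbT.
    have : s - 1 < q' by near: q'; exact: lt_nbhsr.
    lra.
  by apply: x_deriv; lra.
- move=> e e0.
  pose L := F j (theta + p%:R * omega + s) (past X s).
  have theta0 : 0 <= theta <= omega.
    have : `|theta - omega / 2| <= omega / 2.
      apply: (cvg_dist_le PU r_lim); apply: (@filterE _ U) => k.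
      by case/andP: (r_itv k) => ? ?; rewrite ler_norml; apply/andP; split; lra.
    by rewrite ler_norml => /andP[? ?]; apply/andP; split; lra.
  have FS : Filter (filter_prod U (within `[lo, +oo[ (nbhs s))).
    exact: filter_prod_filter.
  have cvg2 : (q : nat * R).2 @[q --> (U, within `[lo, +oo[ (nbhs s))] --> s.
    exact: cvg_trans (@cvg_snd nat R U _ _) (cvg_within _).
  have HF : F j (r q.1 + p%:R * omega + q.2) (past (xk q.1) q.2)
      @[q --> (U, within `[lo, +oo[ (nbhs s))] --> L.
    apply: (F_cont (M := M)) => //.
    + by case/andP: theta0 => ? _; lra.
    + exists (setT, `[lo, +oo[%classic) => /=.
        split; first exact: filterT.
        by rewrite /within/=; apply: (@filterE _ (nbhs s)).
      move=> [k q] /= [_]; rewrite in_itv/= andbT => loq; split.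
      * by case/andP: (r_itv k) => ? _; lra.
      * by rewrite -pastE; exact: past_cont.
      * by rewrite -pastE; apply: past_bounded => i q' _; exact: x_bound.
    + by apply: hist_cont_past => i q _; exact: cX.
    + by apply: past_bounded => i q _; exact: XM.
    + apply: cvgD => //; apply: cvgD; last exact: cvg_cst.
      exact: (cvg_comp (@fst nat R) r (@cvg_fst nat R U _ _) r_lim).
    + apply: (@hist_cvg_past R J nat U xk X _ _ fst snd s) => //.
        by move=> i q _; exact: cc.
      exact: (@cvg_fst nat R U).
  have e20 : 0 < e / 2 by rewrite divr_gt0.
  have H1 : \forall q \near (U, nbhs s), lo <= q.2 ->
      `|L - F j (r q.1 + p%:R * omega + q.2) (past (xk q.1) q.2)| <= e / 2.
    have : \forall q \near (U, within `[lo, +oo[ (nbhs s)),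
        `|L - F j (r q.1 + p%:R * omega + q.2) (past (xk q.1) q.2)| <= e / 2.
      by move/cvgrPdist_le : HF; exact.
    move=> /near_prod_within; apply: filterS => q h loq; apply: h.
    by rewrite /= in_itv/= loq.
  have [T2 [_ HT2]] : \forall t \near +oo, `|err j t| <= e / 2.
    have /cvgrPdist_le/(_ _ e20) := (@err_lim j).
    by apply: filterS => t; rewrite sub0r normrN.
  have H2 : \forall q \near (U, nbhs s), `|err j (tk q.1 + q.2)| <= e / 2 /\
      (p <= m q.1)%N.
    exists ([set k | T2 - s + 2 <= tk k /\ (p.+1)%:R * omega <= tk k], [set q | s - 1 < q]) => /=.
      by split; [apply: filterI; exact: tk_infty|apply: lt_nbhsr; lra].
    move=> [k q] /= [[h1 h3] h2]; split; first by apply: HT2; lra.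
    move: h3; rewrite tkE -natr1 mulrDl mul1r => h3.
    rewrite -(ler_nat R) -(ler_pM2r omega_gt0).
    by case/andP: (r_itv k) => ? ?; lra.
  move: H1 H2; apply: filterS2 => -[k q] /= h1 [h2 h3] /ltW loq _.
  have tE : tk k + q = (r k + p%:R * omega + q) + (m k - p)%:R * omega.
    by rewrite tkE natrB//; ring.
  have -> : F j (tk k + q) (past x (tk k + q)) =
      F j (r k + p%:R * omega + q) (past (xk k) q).
    rewrite pastE tE.
    rewrite (@periodic_iter omega _ (fun t => F j t (past (xk k) q)) (ltW omega_gt0))//.
      by move=> t ht; exact: F_per.
    by case/andP: (r_itv k) => ? _; lra.
  rewrite addrAC (le_trans (ler_normD _ _))// [leRHS]splitr lerD//.
  by rewrite distrC; exact: h1.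
- by apply: (@filterE _ (nbhs s)) => q _; exact: Xl.
Unshelve. all: by end_near. Qed.

End TranslateLimit.
End PeriodicSystems.

(** * Asymptotic equality of bounded perturbed solutions *)

Section Stability.
Context {R : realType} {J : finType}.
Local Notation hist := (@hist R J).

Lemma hist_cvg_eval (S : Type) (FS : set_system S) (phi : S -> hist) (phi0 : hist)
    (s : S -> R) (s0 : R) j : Filter FS -> hist_cvg FS phi phi0 -> hist_cont phi0 ->
  0 <= s0 -> (\forall k \near FS, 0 <= s k) -> s @ FS --> s0 ->
  phi k j (- s k) @[k --> FS] --> phi0 j (- s0).
Proof.
move=> FF hc c0 s00 sn ss0; apply/cvgrPdist_le => e e0.
have e20 : 0 < e / 2 by rewrite divr_gt0.
have h1 : \forall k \near FS, s k <= s0 + 1.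
  have /cvgrPdist_le/(_ 1 ltr01) := ss0.
  by apply: filterS => k; rewrite ler_norml => /andP[? _]; lra.
have h2 : phi0 j (Num.min (- s k) 0) @[k --> FS] --> phi0 j (Num.min (- s0) 0).
  apply: (cvg_comp (fun k => - s k) (fun u => phi0 j (Num.min u 0)) _ (c0 j (- s0))).
  exact: cvgN.
move/cvgrPdist_le/(_ _ e20) : h2 => h2.
have h3 := hc (s0 + 1) _ e20.
near=> k.
have k1 : s k <= s0 + 1 by near: k.
have k2 : 0 <= s k by near: k.
have k3 : `|phi0 j (Num.min (- s0) 0) - phi0 j (Num.min (- s k) 0)| <= e / 2.
  by near: k.
have k4 : forall j u, - (s0 + 1) <= u -> u <= 0 -> `|phi k j u - phi0 j u| <= e / 2.
  by near: k.
move: k3; rewrite !min_l ?oppr_le0// => k3.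
rewrite (le_trans (ler_distD (phi0 j (- s k)) _ _))// [leRHS]splitr lerD//.
by rewrite distrC; apply: k4; rewrite ?lerN2 ?oppr_le0.
Unshelve. all: by end_near. Qed.

Lemma has_deriv_withinMr (D : set R) (f : R -> R) t (l c : R) :
  has_deriv_within D f t l -> has_deriv_within D (fun s => f s * c) t (l * c).
Proof.
move=> /has_deriv_withinP hf; apply/has_deriv_withinP => e e0.
have e1 : 0 < e / (`|c| + 1) by rewrite divr_gt0// ltr_wpDl.
apply: filterS (hf _ e1) => s h /h {}h.
rewrite (_ : _ - _ - _ = (f s - f t - l * (s - t)) * c); last by ring.
rewrite normrM (le_trans (ler_wpM2r (normr_ge0 c) h))// mulrAC ler_wpM2r//.
by rewrite frac_le// ltW.
Qed.

Variables (a : J -> R -> R -> R) (g : J -> R -> hist -> R) (betah A : J -> R -> R).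
Variables (K : J -> R -> (J -> R) -> R) (a_lo a_up : J -> R) (dta : J -> R -> R -> R).
Variables (omega M : R) (w : J -> R).
Hypothesis omega_gt0 : 0 < omega.
Hypothesis w_gt0 : forall i, 0 < w i.
Hypothesis a_cont : forall i, continuous_nonneg2 (a i).
Hypothesis a_lo_gt0 : forall i, 0 < a_lo i.
Hypothesis a_bounds : forall i t v, 0 <= t -> a_lo i <= a i t v <= a_up i.
Hypothesis a_per : forall i u t, 0 <= t -> a i (t + omega) u = a i t u.
Hypothesis dtaP : forall i t v, 0 <= t ->
  has_deriv_within `[0, +oo[ (fun s => a i s v) t (dta i t v).
Hypothesis dta_lb : forall i t v, 0 <= t -> A i t * a i t v ^+ 2 <= dta i t v.
Hypothesis g_cont : forall i, hist_continuous (g i).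
Hypothesis g_per : forall i t phi, 0 <= t -> g i (t + omega) phi = g i t phi.
Hypothesis g_bound : exists B, forall i t phi, 0 <= t -> hist_cont phi ->
  hist_bounded M phi -> `|g i t phi| <= B.
Hypothesis g_diss : forall i t phi psi e, 0 <= t -> hist_cont phi -> hist_cont psi ->
  hist_bounded M phi -> hist_bounded M psi ->
  (forall j u, u <= 0 -> `|phi j u - psi j u| <= e j) -> psi i 0 <= phi i 0 ->
  g i t phi - g i t psi <= - betah i t * (phi i 0 - psi i 0) + K i t e.
Hypothesis betah_bound : exists B, forall i t, 0 <= t -> betah i t <= B.
Hypothesis K_ge0 : forall i t e, (forall j, 0 <= e j) -> 0 <= K i t e.
Hypothesis K_scale : forall i t e r, K i t (fun j => r * e j) = r * K i t e.
Hypothesis stab : forall i t, 0 <= t ->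
  - (betah i t + A i t) * a_lo i * w i + K i t (fun j => a_up j * w j) < 0.

Lemma a_up_gt0 i : 0 < a_up i.
Proof.
have /andP[h1 h2] := a_bounds i 0 (lexx 0).
exact: lt_le_trans (a_lo_gt0 i) (le_trans h1 h2).
Qed.

Lemma a_gt0 i t v : 0 <= t -> 0 < a i t v.
Proof. by move=> /(a_bounds i v) /andP[h _]; exact: lt_le_trans h. Qed.

(** The gain in [stab] is nonnegative, so the other term must be negative. This is the source of the
    upper bound on [- A]. *)
Lemma betahA_gt0 i t : 0 <= t -> 0 < betah i t + A i t.
Proof.
move=> t0; have := stab i t0.
have Kp : 0 <= K i t (fun j => a_up j * w j).
  by apply: K_ge0 => j; rewrite mulr_ge0 ?ltW ?a_up_gt0.
have c0 : 0 < a_lo i * w i by rewrite mulr_gt0.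
rewrite -mulrA mulNr => h.
have : 0 < (betah i t + A i t) * (a_lo i * w i) by lra.
by rewrite pmulr_lgt0.
Qed.

Lemma inva_cvg i (S : Type) (FS : set_system S) (t u : S -> R) (t0 u0 : R) :
  Filter FS -> 0 <= t0 -> (\forall k \near FS, 0 <= t k) ->
  t @ FS --> t0 -> u @ FS --> u0 -> (a i (t k) (u k))^-1 @[k --> FS] --> (a i t0 u0)^-1.
Proof.
move=> FF t00 tn tt0 uu0; apply: cvgV; first by rewrite gt_eqF// a_gt0.
exact: nonneg2_cvg.
Qed.

Lemma inva_cont i t : 0 <= t -> continuous (fun u => (a i t u)^-1).
Proof.
move=> t0 u; apply: (@inva_cvg i R (nbhs u) (fun=> t) id) => //.
  by apply: (@filterE _ (nbhs u)).
exact: cvg_cst.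
Qed.

(* [Psi i t (x i t) - Psi i t (y i t)] is a distance whose derivative along
   solutions does not involve the factor [a i]. The lower endpoint lies strictly
   below the values of the solutions, so that [Psi i t] is differentiable there. *)
Definition Psi i t u := \int[lebesgue_measure]_(v in `[- M - 1, u]) (a i t v)^-1.

Lemma Psi_deriv i t u D : 0 <= t -> - M - 1 < u ->
  has_deriv_within D (Psi i t) u (a i t u)^-1.
Proof. by move=> t0 uM; apply: has_deriv_within_integral => //; exact: inva_cont. Qed.

Lemma Psi_mvt i t u v : 0 <= t -> - M <= u -> - M <= v ->
  exists2 c, Num.min u v <= c <= Num.max u v &
    Psi i t u - Psi i t v = (a i t c)^-1 * (u - v).
Proof.
move=> t0; wlog vu : u v / v <= u.
  move=> H uM vM; case/orP: (le_total v u) => [vu|uv]; first by apply: H.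
  have [c c1 c2] := H v u uv vM uM; exists c.
    by move: c1; rewrite minC maxC.
  by rewrite -opprB c2; ring.
move=> uM vM; move: vu; rewrite le_eqVlt => /predU1P[->|vu].
  by exists u; rewrite ?subrr ?mulr0// ge_min le_max lexx.
have near_T (z : R) : \forall s \near z, [set: R] s by apply: (@filterE _ (nbhs z)).
have dP z : - M <= z -> has_deriv_within setT (Psi i t) z (a i t z)^-1.
  by move=> Mz; apply: Psi_deriv => //; lra.
have cP z : - M <= z -> {for z, continuous (Psi i t)}.
  by move=> Mz; exact: has_deriv_within_continuous (near_T z) (dP _ Mz).
have [//|z /andP[vz _]|c /andP[c1 c2] ->] :=
  has_deriv_within_mvt vu _ (cP _ vM) (cP _ uM) (g := fun z => (a i t z)^-1) (D := setT).
  by apply: dP; lra.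
by exists c => //; rewrite ge_min le_max (ltW c1) (ltW c2) orbT.
Qed.

Lemma Psi_bounds i t u v : 0 <= t -> - M <= v -> v <= u ->
  (u - v) / a_up i <= Psi i t u - Psi i t v <= (u - v) / a_lo i.
Proof.
move=> t0 vM vu; have [c _ ->] := Psi_mvt i t0 (le_trans vM vu) vM.
have /andP[h1 h2] := a_bounds i c t0.
rewrite mulrC ![_^-1 * _]mulrC; apply/andP; split; apply: ler_wpM2l; rewrite ?subr_ge0//.
  by rewrite lef_pV2 ?posrE ?a_gt0 ?a_up_gt0.
by rewrite lef_pV2 ?posrE ?a_gt0.
Qed.

Lemma Psi_dist_ge i t u v : 0 <= t -> - M <= v -> - M <= u ->
  `|u - v| <= a_up i * `|Psi i t u - Psi i t v|.
Proof.
move=> t0; wlog vu : u v / v <= u.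
  move=> H uM vM; case/orP: (le_total v u) => [vu|uv]; first by apply: H.
  by rewrite distrC (distrC (Psi _ _ _)); exact: H.
move=> vM uM; have /andP[h _] := Psi_bounds i t0 vM vu.
rewrite (ger0_norm (_ : 0 <= u - v)) ?subr_ge0// [leRHS]mulrC -ler_pdivrMr ?a_up_gt0//.
exact: le_trans h (ler_norm _).
Qed.

Lemma Psi_dist_le i t u v : 0 <= t -> - M <= v -> - M <= u ->
  `|Psi i t u - Psi i t v| <= `|u - v| / a_lo i.
Proof.
move=> t0; wlog vu : u v / v <= u.
  move=> H uM vM; case/orP: (le_total v u) => [vu|uv]; first by apply: H.
  by rewrite distrC (distrC u); exact: H.
move=> vM uM; have /andP[h1 h2] := Psi_bounds i t0 vM vu.
rewrite (@ger0_norm _ (u - v)) ?subr_ge0// ger0_norm//.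
by apply: le_trans h1; rewrite divr_ge0// ?subr_ge0// ltW// a_up_gt0.
Qed.

Lemma Psi_per i t (m : nat) : 0 <= t -> Psi i (t + m%:R * omega) = Psi i t.
Proof.
move=> t0; apply: (periodic_iter (ltW omega_gt0)) => // s s0.
rewrite /Psi; apply/funext => u; apply: eq_Rintegral => v _.
by rewrite a_per.
Qed.

(** Near coverings make 1 / a converge uniformly on [- M, u0] as the time varies. The value at [- M]
    is subtracted because [primitive_dist] controls increments only; it cancels in [Psi_cvg]. *)
Lemma Psi_cvg0 i (S : Type) (FS : set_system S) (t u : S -> R) (t0 u0 : R) :
  Filter FS -> 0 <= t0 -> (\forall k \near FS, 0 <= t k) ->
  (\forall k \near FS, - M <= u k) -> - M <= u0 ->
  t @ FS --> t0 -> u @ FS --> u0 ->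
  Psi i (t k) (u k) - Psi i (t k) (- M) @[k --> FS] --> Psi i t0 u0 - Psi i t0 (- M).
Proof.
move=> FF t00 tn un u0M tt0 uu0; apply/cvgrPdist_le => e e0.
have e20 : 0 < e / 2 by rewrite divr_gt0.
have e1 : 0 < e / 2 * a_lo i by rewrite mulr_gt0.
have e2 : 0 < e / 2 / (u0 + M + 1) by rewrite divr_gt0// ltr_wpDl//; lra.
have Kc : compact `[- M, u0] by exact: segment_compact.
have NC := (compact_near_coveringP _).1 Kc S FS (fun k z => 0 <= t k ->
  `|(a i t0 z)^-1 - (a i (t k) z)^-1| <= e / 2 / (u0 + M + 1)) FF.
have {}NC : \forall k \near FS, forall z, - M <= z <= u0 -> 0 <= t k ->
    `|(a i t0 z)^-1 - (a i (t k) z)^-1| <= e / 2 / (u0 + M + 1).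
  apply: filterS (NC _) => [k h z zK|z _]; first by apply: h; rewrite /= in_itv.
  have e3 : 0 < e / 2 / (u0 + M + 1) / 2 by rewrite divr_gt0.
  have FS' : Filter (filter_prod (nbhs z) (within (fun k => 0 <= t k) FS)).
    exact: filter_prod_filter.
  have H1 : (a i (t p.2) p.1)^-1 @[p --> (nbhs z, within (fun k => 0 <= t k) FS)] -->
      (a i t0 z)^-1.
    apply: inva_cvg => //.
    - exists (setT, [set k | 0 <= t k]) => /=; last by move=> [? ?] [].
      by split; [exact: filterT|apply: (@filterE _ FS)].
    - apply: (cvg_comp (@snd R S) t (@cvg_snd R S (nbhs z) _ _)).
      exact: cvg_trans (cvg_app _ (cvg_within _)) tt0.
    - exact: (@cvg_fst R S (nbhs z)).
  have H2 : (a i t0 z')^-1 @[z' --> nbhs z] --> (a i t0 z)^-1 by exact: inva_cont.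
  move/cvgrPdist_le/(_ _ e3) : H1 => [[B C] /= [nB nC] H1].
  move/cvgrPdist_le/(_ _ e3) : H2 => H2.
  exists ([set z' | B z' /\ `|(a i t0 z)^-1 - (a i t0 z')^-1| <=
     e / 2 / (u0 + M + 1) / 2], [set k | 0 <= t k -> C k]) => /=.
    by split => //; exact: filterI.
  move=> [z' k] /= [[Bz' h] Ck] tk; rewrite (le_trans (ler_distD (a i t0 z)^-1 _ _))//.
  by rewrite [leRHS]splitr lerD//; [rewrite distrC|exact: (H1 (z', k)) (conj Bz' (Ck tk))].
move/cvgrPdist_le/(_ _ e1) : uu0 => hu.
near=> k.
have tk : 0 <= t k by near: k.
have uk : - M <= u k by near: k.
have h1 : `|(Psi i t0 u0 - Psi i t0 (- M)) - (Psi i (t k) u0 - Psi i (t k) (- M))| <= e / 2.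
  have h : forall z, - M <= z <= u0 ->
     `|(a i t0 z)^-1 - (a i (t k) z)^-1| <= e / 2 / (u0 + M + 1).
    by move=> z zK; move: z zK tk; near: k; apply: filterS NC => k h z zK; exact: h.
  have loM : - M - 1 < - M by lra.
  have := @primitive_dist R _ _ (Psi i t0) (Psi i (t k)) (- M - 1) (- M) u0 _ loM u0M
    (fun u D => @Psi_deriv i t0 u D t00) (fun u D => @Psi_deriv i (t k) u D tk) h.
  move/le_trans; apply; rewrite opprK frac_le ?(ltW e20)//; lra.
have h2 : `|Psi i (t k) u0 - Psi i (t k) (u k)| <= e / 2.
  rewrite (le_trans (Psi_dist_le i tk uk u0M))// ler_pdivrMr//.
  by near: k.
rewrite (_ : _ - _ = (Psi i t0 u0 - Psi i t0 (- M)) - (Psi i (t k) u0 - Psi i (t k) (- M))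
  + (Psi i (t k) u0 - Psi i (t k) (u k))); last by ring.
by rewrite (le_trans (ler_normD _ _))// [leRHS]splitr lerD.
Unshelve. all: by end_near. Qed.

Lemma Psi_cvg i (S : Type) (FS : set_system S) (t u v : S -> R) (t0 u0 v0 : R) :
  Filter FS -> 0 <= t0 -> (\forall k \near FS, 0 <= t k) ->
  (\forall k \near FS, - M <= u k) -> - M <= u0 ->
  (\forall k \near FS, - M <= v k) -> - M <= v0 ->
  t @ FS --> t0 -> u @ FS --> u0 -> v @ FS --> v0 ->
  Psi i (t k) (u k) - Psi i (t k) (v k) @[k --> FS] --> Psi i t0 u0 - Psi i t0 v0.
Proof.
move=> FF t00 tn un u0M vn v0M tt0 uu0 vv0.
have h1 := @Psi_cvg0 i S FS t u t0 u0 FF t00 tn un u0M tt0 uu0.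
have h2 := @Psi_cvg0 i S FS t v t0 v0 FF t00 tn vn v0M tt0 vv0.
have -> : Psi i t0 u0 - Psi i t0 v0 =
    (Psi i t0 u0 - Psi i t0 (- M)) - (Psi i t0 v0 - Psi i t0 (- M)) by ring.
apply: cvg_trans (cvgB h1 h2); apply: near_eq_cvg; apply: (@filterE _ FS) => k /=.
by rewrite !fctE; ring.
Qed.

Lemma inva_deriv i t u : 0 < t ->
  has_deriv_within `[0, +oo[ (fun s => (a i s u)^-1) t (- (dta i t u / a i t u ^+ 2)).
Proof.
move=> t0.
have near_D : \forall s \near t, `[0, +oo[%classic s.
  near=> s; rewrite /= in_itv/= andbT ltW//; near: s; exact: lt_nbhsr.
have at0 : a i t u != 0 by rewrite gt_eqF// a_gt0// ltW.
have dA := (has_deriv_within_derive _ _ near_D).1 (@dtaP i t u (ltW t0)).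
apply/(has_deriv_within_derive _ _ near_D).
have -> : - (dta i t u / a i t u ^+ 2) = - (a i t u) ^- 2 *: dta i t u.
  by rewrite /GRing.scale/= mulNr mulrC.
exact: is_deriveV.
Unshelve. all: by end_near. Qed.

Lemma inva_deriv_le i t u : 0 <= t -> - (dta i t u / a i t u ^+ 2) <= - A i t.
Proof.
by move=> t0; rewrite lerN2 ler_pdivlMr ?dta_lb// exprn_gt0// a_gt0.
Qed.

(** The time derivative of 1 / a is at most [- A], which [betahA_gt0] bounds by [betah], a function
    bounded above. This is the uniform upper bound that [primitive_limsup] needs. *)
Lemma inva_quotient_le i : exists C, forall t h u, 0 < h -> h < t ->
  ((a i t u)^-1 - (a i (t - h) u)^-1) / h <= C.
Proof.
have [B HB] := betah_bound; exists B => t h u h0 ht.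
have th : 0 < t - h by rewrite subr_gt0.
have tht : t - h <= t by rewrite gerBl ltW.
have near_D (s : R) : 0 < s -> \forall r \near s, `[0, +oo[%classic r.
  by move=> s0; near=> r; rewrite /= in_itv/= andbT ltW//; near: r; exact: lt_nbhsr.
rewrite ler_pdivrMr//.
have := @mean_value_le R `[0, +oo[ (fun s => (a i s u)^-1)
  (fun s => - (dta i s u / a i s u ^+ 2)) (t - h) t B tht.
rewrite subKr; apply.
- by move=> s /andP[hs _]; rewrite /= in_itv/= andbT ltW// (lt_trans th).
- by apply: (has_deriv_within_continuous (near_D _ th)); exact: inva_deriv.
- have t0 : 0 < t by exact: lt_trans ht.
  by apply: (has_deriv_within_continuous (near_D _ t0)); exact: inva_deriv.
- by move=> s /andP[hs _]; apply: inva_deriv; exact: lt_trans hs.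
- move=> s /andP[hs _]; have s0 := ltW (lt_trans th hs).
  apply: le_trans (inva_deriv_le i u s0) _; apply: le_trans (HB i s s0).
  by have := betahA_gt0 i s0; lra.
Unshelve. all: by end_near. Qed.

(* One-sided version of the maximum principle: at a point where the weighted
   distance of two solutions is maximal among the past, hypothesis [stab] is
   contradicted. Since [A] is only bounded pointwise, the time derivative of the
   integral defining [Psi] is estimated by bounded convergence. *)
Lemma max_principle (X Y : J -> R -> R) (theta v : R) i : omega <= theta -> 0 < v ->
  (forall j, continuous (X j)) -> (forall j, continuous (Y j)) ->
  (forall j t, `|X j t| <= M) -> (forall j t, `|Y j t| <= M) ->
  (forall j s, `|X j s - Y j s| <= a_up j * (v * w j)) ->
  has_deriv_within `[- omega, +oo[ (X i) 0
    (a i theta (past X 0 i 0) * g i theta (past X 0)) ->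
  has_deriv_within `[- omega, +oo[ (Y i) 0
    (a i theta (past Y 0 i 0) * g i theta (past Y 0)) ->
  Psi i theta (X i 0) - Psi i theta (Y i 0) = v * w i ->
  (forall h, 0 < h -> h < omega ->
    Psi i (theta - h) (X i (- h)) - Psi i (theta - h) (Y i (- h)) <= v * w i) ->
  False.
Proof.
move=> oth v0 cX cY XM YM XY dX dY W0 Wh.
have th0 : 0 < theta by exact: lt_le_trans oth.
have th0' := ltW th0.
have MX s : - M <= X i s by have := XM i s; rewrite ler_norml => /andP[].
have MY s : - M <= Y i s by have := YM i s; rewrite ler_norml => /andP[].
have YX0 : Y i 0 <= X i 0.
  rewrite leNgt; apply/negP => XY0.
  have /andP[h _] := Psi_bounds i th0' (MX 0) (ltW XY0).
  have : 0 < v * w i by rewrite mulr_gt0.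
  have : 0 <= (Y i 0 - X i 0) / a_up i.
    by rewrite divr_ge0 ?subr_ge0 1?ltW// a_up_gt0.
  by lra.
(* Multiplied by the positive [betah + A], this produces the first term of [stab]. *)
have D0 : a_lo i * (v * w i) <= X i 0 - Y i 0.
  have /andP[_ h] := Psi_bounds i th0' (MY 0) YX0.
  by move: h; rewrite W0 ler_pdivlMr// mulrC.
have past0 Z : past Z 0 = Z :> hist.
  by apply/funext => j; apply/funext => u; rewrite /past add0r.
(* The denominator [n.+2] keeps each step strictly below [omega], inside the window of the past on
   which [Wh] and the equations hold. *)
pose h_ n : R := omega / n.+2%:R.
have h0 n : 0 < h_ n by rewrite divr_gt0.
have ho n : h_ n < omega.
  by rewrite /h_ ltr_pdivrMr// ltr_pMr// ltr1n.
have ht n : h_ n < theta by exact: lt_le_trans oth.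
have hlim : h_ n @[n --> \oo] --> (0 : R).
  rewrite -(mulr0 omega) /h_; apply: cvgM; first exact: cvg_cst.
  have := @cvg_harmonic R; rewrite -(cvg_shiftn 1) => H.
  apply: cvg_trans H; apply: near_eq_cvg; apply: (@filterE _ \oo) => n /=.
  by rewrite addn1.
have thn n : 0 <= theta - h_ n by rewrite subr_ge0 ltW.
have thlim : theta - h_ n @[n --> \oo] --> theta.
  by rewrite -[X in _ --> X]subr0; apply: cvgB => //; exact: cvg_cst.
(* [Q n] is the backward time quotient of [Psi] at a fixed state, and [q n] is its derivative in the
   state. *)
pose q n u := ((a i theta u)^-1 - (a i (theta - h_ n) u)^-1) * (h_ n)^-1.
pose Q n u := (Psi i theta u - Psi i (theta - h_ n) u) * (h_ n)^-1.
have [C HC] := inva_quotient_le i.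
have Q_le e : 0 < e -> \forall n \near \oo,
    Q n (X i 0) - Q n (Y i 0) <= - A i theta * (X i 0 - Y i 0) + e.
  apply: (@primitive_limsup R q Q (- M - 1) (Y i 0) (X i 0) (- A i theta) C) => //.
  - by have := MY 0; lra.
  - move=> n u; apply: cvgM; last exact: cvg_cst.
    by apply: cvgB; [exact: inva_cont|exact: inva_cont].
  - by move=> n u; exact: HC.
  - by move=> n u D uM; apply: has_deriv_withinMr; apply: has_deriv_withinB;
      exact: Psi_deriv.
  - move=> u d d0.
    have /has_deriv_withinP/(_ _ d0) H := @inva_deriv i theta u th0.
    have : \forall n \near \oo, `[0, +oo[%classic (theta - h_ n) ->
        `|(a i (theta - h_ n) u)^-1 - (a i theta u)^-1 -
          - (dta i theta u / a i theta u ^+ 2) * (theta - h_ n - theta)|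
        <= d * `|theta - h_ n - theta| by exact: thlim _ H.
    apply: filterS => n; rewrite /= in_itv/= andbT thn => /(_ isT).
    rewrite (_ : theta - h_ n - theta = - h_ n); last by ring.
    rewrite normrN (gtr0_norm (h0 n)) ler_norml => /andP[h1 _].
    have h2 := inva_deriv_le i u th0'; move: h1 h2; rewrite /q ler_pdivrMr//.
    move: (- (dta i theta u / a i theta u ^+ 2)) => l h1 h2.
    have h3 : (l + d) * h_ n <= (- A i theta + d) * h_ n.
      by rewrite ler_pM2r// lerD2r.
    lra.
(* The state quotient of [Psi] tends to 1 / a times the derivative [a * p] of [Z i]: here the factor
   [a] cancels. *)
have quot (Z : J -> R -> R) (p : R) : (forall j, continuous (Z j)) ->
    (forall j t, `|Z j t| <= M) ->
    has_deriv_within `[- omega, +oo[ (Z i) 0 (a i theta (Z i 0) * p) ->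
    (Psi i (theta - h_ n) (Z i 0) - Psi i (theta - h_ n) (Z i (- h_ n))) * (h_ n)^-1
      @[n --> \oo] --> p.
  move=> cZ ZM dZ.
  have MZ s : - M <= Z i s by have := ZM i s; rewrite ler_norml => /andP[].
  have H n : exists c, Num.min (Z i 0) (Z i (- h_ n)) <= c <=
        Num.max (Z i 0) (Z i (- h_ n)) /\
      Psi i (theta - h_ n) (Z i 0) - Psi i (theta - h_ n) (Z i (- h_ n)) =
      (a i (theta - h_ n) c)^-1 * (Z i 0 - Z i (- h_ n)).
    by have [c c1 c2] := Psi_mvt i (thn n) (MZ 0) (MZ (- h_ n)); exists c.
  have [c cP] := choice H.
  have Zh : Z i (- h_ n) @[n --> \oo] --> Z i 0.
    have : - h_ n @[n --> \oo] --> (0 : R) by rewrite -oppr0; exact: cvgN.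
    by move=> hN; exact: (cvg_comp _ _ hN (cZ i 0)).
  have clim : c n @[n --> \oo] --> Z i 0.
    apply/cvgrPdist_le => e e0; move/cvgrPdist_le/(_ _ e0) : Zh.
    apply: filterS => n; rewrite !ler_norml => /andP[h1 h2].
    have [/andP[c1 c2] _] := cP n; move: c1 c2; rewrite ge_min le_max.
    by move=> /orP[] c1 /orP[] c2; apply/andP; split; lra.
  have alim : (a i (theta - h_ n) (c n))^-1 @[n --> \oo] --> (a i theta (Z i 0))^-1.
    by apply: inva_cvg => //; apply: (@filterE _ \oo).
  have Zlim : (Z i 0 - Z i (- h_ n)) * (h_ n)^-1 @[n --> \oo] --> a i theta (Z i 0) * p.
    apply/cvgrPdist_le => e e0.
    have hN : - h_ n @[n --> \oo] --> (0 : R) by rewrite -oppr0; exact: cvgN.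
    have /has_deriv_withinP/(_ _ e0) D := dZ.
    have : \forall n \near \oo, `[- omega, +oo[%classic (- h_ n) ->
        `|Z i (- h_ n) - Z i 0 - a i theta (Z i 0) * p * (- h_ n - 0)|
        <= e * `|- h_ n - 0| by exact: hN _ D.
    apply: filterS => n; rewrite /= in_itv/= andbT lerN2 (ltW (ho n)) => /(_ isT).
    rewrite subr0 normrN (gtr0_norm (h0 n)) -ler_pdivrMr//.
    rewrite -[X in _ / X](gtr0_norm (h0 n)) -normfV -normrM.
    rewrite (_ : (Z i (- h_ n) - Z i 0 - a i theta (Z i 0) * p * - h_ n) / h_ n =
      a i theta (Z i 0) * p - (Z i 0 - Z i (- h_ n)) * (h_ n)^-1)//.
    by field; rewrite gt_eqF.
  have a0 : a i theta (Z i 0) != 0 by rewrite gt_eqF// a_gt0.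
  rewrite -(mulKf a0 p) (_ : (fun n => _) = (fun n => (a i (theta - h_ n) (c n))^-1 *
    ((Z i 0 - Z i (- h_ n)) * (h_ n)^-1))); first exact: cvgM.
  by apply/funext => n; have [_ ->] := cP n; rewrite mulrA.
rewrite (past0 X) in dX; rewrite (past0 Y) in dY.
have qX := quot X _ cX XM dX; have qY := quot Y _ cY YM dY.
(* The left difference quotient of the distance is nonnegative by maximality. It splits into the
   time quotient at the states [X i 0] and [Y i 0] and two state quotients at time
   [theta - h_ n]. *)
have key : 0 <= - A i theta * (X i 0 - Y i 0) + g i theta X - g i theta Y.
  apply/ler_addgt0Pl => e e0.
  have e3 : 0 < e / 3 by rewrite divr_gt0.
  have [n [h1 [h2 h3]]] : exists n, Q n (X i 0) - Q n (Y i 0) <=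
      - A i theta * (X i 0 - Y i 0) + e / 3 /\
      `|g i theta X - (Psi i (theta - h_ n) (X i 0) -
          Psi i (theta - h_ n) (X i (- h_ n))) * (h_ n)^-1| <= e / 3 /\
      `|g i theta Y - (Psi i (theta - h_ n) (Y i 0) -
          Psi i (theta - h_ n) (Y i (- h_ n))) * (h_ n)^-1| <= e / 3.
    apply: (@filter_ex _ \oo).
    move/cvgrPdist_le/(_ _ e3) : qX => qX; move/cvgrPdist_le/(_ _ e3) : qY => qY.
    by have := Q_le _ e3; move: qX qY; apply: filterS3.
  have Wn := Wh _ (h0 n) (ho n).
  have : 0 <= (Psi i theta (X i 0) - Psi i theta (Y i 0) - (Psi i (theta - h_ n) (X i (- h_ n)) -
     Psi i (theta - h_ n) (Y i (- h_ n)))) * (h_ n)^-1.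
    by rewrite mulr_ge0 ?invr_ge0 ?(ltW (h0 n))// subr_ge0 W0.
  move: h1 h2 h3; rewrite /Q !ler_norml => h1 /andP[h2 _] /andP[_ h3].
  by move: h1 h2 h3; rewrite !mulrBl; lra.
have cpX : hist_cont X by rewrite -(past0 X); apply: hist_cont_past => j s _; exact: cX.
have cpY : hist_cont Y by rewrite -(past0 Y); apply: hist_cont_past => j s _; exact: cY.
have dXY j u : u <= 0 -> `|X j u - Y j u| <= v * (a_up j * w j).
  by move=> _; rewrite mulrCA.
have := @g_diss i theta X Y (fun j => v * (a_up j * w j)) th0' cpX cpY
  (fun j u _ => XM j u) (fun j u _ => YM j u) dXY YX0.
rewrite K_scale => H.
have bA := betahA_gt0 i th0'.
have : (betah i theta + A i theta) * (a_lo i * (v * w i)) <=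
    (betah i theta + A i theta) * (X i 0 - Y i 0) by rewrite ler_pM2l.
have : v * (- (betah i theta + A i theta) * a_lo i * w i +
   K i theta (fun j => a_up j * w j)) < 0 by rewrite pmulr_rlt0// stab.
lra.
Qed.

Let F i t (phi : hist) := a i t (phi i 0) * g i t phi.

Lemma system_continuous i : hist_continuous (F i).
Proof.
move=> S FS t phi t0 phi0 N FF t00 H cphi0 bphi0 tt0 hc; apply: cvgM.
  apply: nonneg2_cvg => //; first by apply: filterS H => k [].
  rewrite -oppr0; apply: hist_cvg_eval => //; first by apply: (@filterE _ FS).
  exact: cvg_cst.
exact: (g_cont (M := N)).
Qed.

Lemma system_periodic i t phi : 0 <= t -> F i (t + omega) phi = F i t phi.
Proof. by move=> t0; rewrite /F a_per// g_per. Qed.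

Lemma system_bounded : exists B, forall i t phi, 0 <= t -> hist_cont phi ->
  hist_bounded M phi -> `|F i t phi| <= B.
Proof.
have [B HB] := g_bound; exists ((\sum_j a_up j) * `|B|) => i t phi t0 cp bp.
have /andP[h1 h2] := a_bounds i (phi i 0) t0.
rewrite normrM ler_pM//; last exact: le_trans (HB _ _ _ t0 cp bp) (ler_norm _).
rewrite gtr0_norm ?a_gt0// (le_trans h2)// (bigD1 i)//= lerDl sumr_ge0// => j _.
exact/ltW/a_up_gt0.
Qed.

(** The error stands inside the factor [a], so for a solution of (S) it is just the discrepancy
    between the brackets of the two systems. *)
Definition perturbed_solution (t0 : R) (x ex : J -> R -> R) :=
  [/\ 0 <= t0, forall j, continuous (x j), forall j t, `|x j t| <= M,
    forall j, ex j t @[t --> +oo] --> (0 : R) &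
    forall j t, t0 <= t -> has_deriv_within `[t0, +oo[ (x j) t
      (a j t (x j t) * (g j t (past x t) + ex j t))].

Lemma perturbed_translate_limit t0 x ex (U : set_system nat) (tk r : nat -> R)
    (m : nat -> nat) (theta : R) : perturbed_solution t0 x ex -> UltraFilter U ->
  (forall C, \forall k \near U, C <= tk k) ->
  (forall k, tk k = r k + (m k)%:R * omega) -> (forall k, 0 <= r k <= omega) ->
  r k @[k --> U] --> theta ->
  exists X : J -> R -> R, [/\ forall j, continuous (X j), forall j t, `|X j t| <= M,
  forall j s, cvg_cont U (fun k s => x j (tk k + s)) (X j) s &
  forall j s lo (p : nat), 0 <= p%:R * omega + lo -> lo <= s ->
    has_deriv_within `[lo, +oo[ (X j) s (F j (theta + p%:R * omega + s) (past X s))].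
Proof.
move=> [t00 cx xM ex0 dx] UU tkU tkE rP rth.
apply: (@translate_limit R J F omega M omega_gt0 system_continuous system_periodic
  system_bounded x (fun j t => a j t (x j t) * ex j t) t0 t00 cx xM _ _ U tk r m theta) => //.
- move=> j; apply/cvgrPdist_le => e e0.
  have e1 : 0 < e / (a_up j + 1) by rewrite divr_gt0// ltr_wpDl ?ltW ?a_up_gt0.
  have /cvgrPdist_le/(_ _ e1) := ex0 j.
  have : \forall t \near +oo, (0 : R) <= t by exact: nbhs_pinfty_ge.
  apply: filterS2 => t tp; rewrite !sub0r !normrN normrM => h.
  have /andP[_ h2] := a_bounds j (x j t) tp.
  rewrite gtr0_norm ?a_gt0// (le_trans (ler_wpM2r (normr_ge0 _) h2))//.
  rewrite (le_trans (ler_wpM2l (ltW (a_up_gt0 j)) h))// mulrC frac_le// ?ltW//.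
  exact: a_up_gt0.
- move=> j t t0t; rewrite /F {1}/past addr0 -mulrDr; exact: dx.
Qed.

(* If the limit superior [v] of the weighted distances were positive, translates
   of the two solutions along times realizing it would converge to solutions of
   the unperturbed system, on a window reaching one period into the past, whose
   weighted distance is maximal at time 0. *)
Lemma stability_core (U : set_system nat) (tk : nat -> R) x y ex ey tx ty i v :
  UltraFilter U -> perturbed_solution tx x ex -> perturbed_solution ty y ey ->
  (forall k, 0 <= tk k) -> (forall C, \forall k \near U, C <= tk k) -> 0 < v ->
  Psi i (tk k) (x i (tk k)) - Psi i (tk k) (y i (tk k)) @[k --> U] --> v * w i ->
  (forall e, 0 < e -> \forall t \near +oo, forall j,
     `|Psi j t (x j t) - Psi j t (y j t)| <= (v + e) * w j) -> False.
Proof.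
move=> UU sx sy tk0 tkU v0 Wlim Vle.
have PU : ProperFilter U by exact: ultra_proper.
have [rm rmP] := choice (fun k => period_decomposition omega_gt0 (tk0 k)).
have [m mP] := choice rmP.
have tkE k : tk k = rm k + (m k)%:R * omega by have [] := mP k.
have rP k : 0 <= rm k <= omega by have [_ -> ->] := mP k.
have [|th rth _] := @ultra_lim R nat U rm omega UU.
  by apply: (@filterE _ U) => k; case/andP: (rP k) => ? ?; rewrite ger0_norm.
have [X [cX XM ccX dX]] := perturbed_translate_limit sx UU tkU tkE rP rth.
have [Y [cY YM ccY dY]] := perturbed_translate_limit sy UU tkU tkE rP rth.
have [tx0 cx xM _ _] := sx; have [ty0 cy yM _ _] := sy.
have Mx j s : - M <= x j s by have := xM j s; rewrite ler_norml => /andP[].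
have My j s : - M <= y j s by have := yM j s; rewrite ler_norml => /andP[].
have MX j s : - M <= X j s by have := XM j s; rewrite ler_norml => /andP[].
have MY j s : - M <= Y j s by have := YM j s; rewrite ler_norml => /andP[].
have th0 : 0 <= th.
  have : `|th - omega / 2| <= omega / 2.
    apply: (cvg_dist_le PU rth); apply: (@filterE _ U) => k.
    by case/andP: (rP k) => ? ?; rewrite ler_norml; apply/andP; split; lra.
  by rewrite ler_norml => /andP[? ?]; lra.
have Xl j s := cvg_cont_pointwise PU (ccX j s).
have Yl j s := cvg_cont_pointwise PU (ccY j s).
have near_tk s (P : R -> Prop) : (\forall t \near +oo, P t) -> \forall k \near U, P (tk k + s).
  move=> [C [_ hC]]; apply: filterS (tkU (C - s + 1)) => k hk; apply: hC; lra.
have Psi_lim s : - omega <= s -> Psi i (tk k + s) (x i (tk k + s)) -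
     Psi i (tk k + s) (y i (tk k + s)) @[k --> U] -->
     Psi i (th + omega + s) (X i s) - Psi i (th + omega + s) (Y i s).
  move=> os.
  have r0 k : 0 <= rm k + omega + s by case/andP: (rP k) => ? ?; lra.
  have H : Psi i (rm k + omega + s) (x i (tk k + s)) -
     Psi i (rm k + omega + s) (y i (tk k + s)) @[k --> U] -->
     Psi i (th + omega + s) (X i s) - Psi i (th + omega + s) (Y i s).
    apply: Psi_cvg => //; try by apply: (@filterE _ U).
      by lra.
    by apply: cvgD; [apply: cvgD => //; exact: cvg_cst|exact: cvg_cst].
  apply: cvg_trans H; apply: near_eq_cvg; apply: filterS (tkU (2 * omega)) => k hk.
  have mk : (1 <= m k)%N.
    rewrite -(ler_nat R) -(ler_pM2r omega_gt0).
    by move: hk; rewrite tkE; case/andP: (rP k) => ? ?; lra.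
  have -> : tk k + s = rm k + omega + s + (m k - 1)%:R * omega.
    by rewrite tkE natrB//; ring.
  by rewrite Psi_per.
have W0 : Psi i (th + omega) (X i 0) - Psi i (th + omega) (Y i 0) = v * w i.
  have No : - omega <= 0 by rewrite oppr_le0 ltW.
  have := Psi_lim 0 No; rewrite addr0 => H.
  apply: (cvg_unique _ H _); first exact: norm_hausdorff.
  apply: cvg_trans Wlim; apply: near_eq_cvg; apply: (@filterE _ U) => k.
  by rewrite addr0.
have No0 : 0 <= 1%:R * omega + - omega by rewrite mul1r subrr.
have No : - omega <= 0 by rewrite oppr_le0 ltW.
apply: (@max_principle X Y (th + omega) v i) => //.
- by rewrite lerDr.
- move=> j s; apply/ler_addgt0Pr => e e0.
  have wj := w_gt0 j; have aj := a_up_gt0 j.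
  have e1 : 0 < e / (a_up j * w j) by rewrite divr_gt0// mulr_gt0.
  have H : \forall k \near U, `|x j (tk k + s) - y j (tk k + s) - 0| <=
      a_up j * (v * w j) + e.
    have tp : \forall t \near +oo, 0 <= t :> R by exact: nbhs_pinfty_ge.
    move: (near_tk s _ tp) (near_tk s _ (Vle _ e1)); apply: filterS2 => k tk1 h.
    rewrite subr0 (le_trans (Psi_dist_ge j tk1 (My _ _) (Mx _ _)))//.
    rewrite (le_trans (ler_wpM2l (ltW aj) (h j)))//.
    rewrite mulrDl mulrDr lerD2l.
    by rewrite (_ : a_up j * (e / (a_up j * w j) * w j) = e)//; field; rewrite !gt_eqF.
  rewrite -[X j s - _]subr0; apply: (cvg_dist_le PU _ H).
  exact: cvgB (Xl j s) (Yl j s).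
- have := dX i 0 _ 1%N No0 No; rewrite mul1r addr0; exact.
- have := dY i 0 _ 1%N No0 No; rewrite mul1r addr0; exact.
- move=> h h0 ho.
  have hs : - omega <= - h by rewrite lerN2 ltW.
  apply/ler_addgt0Pr => e e0.
  have wi := w_gt0 i.
  have e1 : 0 < e / w i by rewrite divr_gt0.
  have Hle := near_tk (- h) _ (Vle _ e1).
  have HP := Psi_lim _ hs.
  apply: (@closed_cvg _ _ U _ _ (fun z : R => z <= v * w i + e) (@closed_le R _) _ _ HP).
  apply: filterS Hle => k /(_ i) h'; apply: le_trans (ler_norm _) (le_trans h' _).
  by rewrite mulrDl lerD2l divfK// gt_eqF.
Qed.

Lemma perturbed_solutions_asymptotic tx ty x y ex ey :
  perturbed_solution tx x ex -> perturbed_solution ty y ey ->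
  forall j, x j t - y j t @[t --> +oo] --> (0 : R).
Proof.
move=> sx sy.
have [tx0 cx xM _ _] := sx; have [ty0 cy yM _ _] := sy.
have Mx j s : - M <= x j s by have := xM j s; rewrite ler_norml => /andP[].
have My j s : - M <= y j s by have := yM j s; rewrite ler_norml => /andP[].
pose V j t := `|Psi j t (x j t) - Psi j t (y j t)|.
(* The infimum of the eventual weighted bounds is the limit superior of the largest [V j / w j], and
   it makes sense even when [J] is empty. *)
pose E := [set v : R | 0 <= v /\ \forall t \near +oo, forall j, V j t <= v * w j].
have VM j t : 0 <= t -> V j t <= 2 * M / a_lo j.
  move=> t0; rewrite (le_trans (Psi_dist_le j t0 (My _ _) (Mx _ _)))//.
  rewrite ler_pM2r ?invr_gt0// (le_trans (ler_normB _ _))// mulr2n mulrDl mul1r.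
  by rewrite lerD.
have infE : has_inf E.
  split; last by exists 0 => v [].
  have t0 j : 0 <= 2 * M / a_lo j / w j.
    have M0 : 0 <= M by exact: le_trans (xM j 0).
    by rewrite !divr_ge0 ?mulr_ge0// ltW.
  exists (\sum_j (2 * M / a_lo j / w j)); split; first exact: sumr_ge0.
  have : \forall t \near +oo, 0 <= t :> R by exact: nbhs_pinfty_ge.
  apply: filterS => t tp j; rewrite (le_trans (VM j t tp))// -ler_pdivrMr//.
  by rewrite [leRHS](bigD1 j)//= lerDl sumr_ge0.
set vs := inf E.
have vs0 : 0 <= vs by apply: lb_le_inf; [case: infE|move=> v []].
have Vle e : 0 < e -> \forall t \near +oo, forall j, V j t <= (vs + e) * w j.
  move=> e0; have [v [v0 Hv] ve] := inf_adherent e0 infE.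
  apply: filterS Hv => t h j; rewrite (le_trans (h j))// ler_pM2r//.
  exact: ltW.
have vs_eq0 : vs = 0.
  apply/eqP; rewrite eq_le vs0 andbT leNgt; apply/negP => vsp.
  (* Strictly below [vs] and tending to it: [vk k] is not in [E], so some component exceeds it at
     arbitrarily late times. *)
  pose vk (k : nat) : R := vs * (k.+1%:R / k.+2%:R).
  have vkP k : 0 <= vk k < vs.
    rewrite mulr_ge0 ?divr_ge0//= /vk gtr_pMr// ltr_pdivrMr// mul1r ltr_nat.
    exact: ltnSn.
  have Hk k : exists t : R, k%:R <= t /\ exists j, vk k * w j < V j t.
    apply: contrapT => H.
    have /andP[vk0 vkv] := vkP k.
    have : E (vk k).
      split => //; exists k%:R; split; first exact: num_real.
      move=> t kt j; rewrite leNgt; apply/negP => h; apply: H; exists t.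
      by split; [exact: ltW|exists j].
    move=> /(ge_inf (infE.2)); rewrite leNgt; apply/negP.
    by rewrite negbK.
  have [tk tkP] := choice Hk.
  have [U UU Uoo] := free_ultrafilter.
  have PU : ProperFilter U by exact: ultra_proper.
  have tk0 k : 0 <= tk k by have [h _] := tkP k; exact: le_trans h.
  have tkU C : \forall k \near U, C <= tk k.
    apply: Uoo; near=> k; have [h _] := tkP k; apply: le_trans h.
    by near: k; exact: nbhs_infty_ger.
  have HL j : exists l : R, Psi j (tk k) (x j (tk k)) - Psi j (tk k) (y j (tk k))
      @[k --> U] --> l.
    have [|l hl _] := @ultra_lim R nat U (fun k => Psi j (tk k) (x j (tk k)) -
        Psi j (tk k) (y j (tk k))) (2 * M / a_lo j) UU.
      by apply: (@filterE _ U) => k; exact: VM.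
    by exists l.
  have [l hl] := choice HL.
  have near_tk (P : R -> Prop) : (\forall t \near +oo, P t) -> \forall k \near U, P (tk k).
    by move=> [C [_ hC]]; apply: filterS (tkU (C + 1)) => k hk; apply: hC; lra.
  have l_le j : `|l j| <= vs * w j.
    apply/ler_addgt0Pr => e e0.
    have e1 : 0 < e / w j by rewrite divr_gt0.
    rewrite -[l j]subr0; apply: (cvg_dist_le PU (hl j)).
    apply: filterS (near_tk _ (Vle _ e1)) => k /(_ j) h; rewrite subr0.
    by rewrite (le_trans h)// mulrDl divfK// gt_eqF.
  (* If every limit were strictly smaller, then, [J] being finite, all components would be below
     [vk k * w j] for some [k], against the choice of [tk k]. *)
  have [i li] : exists i, `|l i| = vs * w i.
    apply: contrapT => H.
    have lt_l j : `|l j| < vs * w j.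
      by rewrite lt_neqAle l_le andbT; apply/eqP => h; apply: H; exists j.
    have : \forall k \near U, forall j, V j (tk k) <= vk k * w j.
      apply: (@filter_forall _ _ _ U) => j.
      pose c := (`|l j| + vs * w j) / 2.
      have [c1 c2] := midf_lt (lt_l j).
      have vlim : vk k * w j @[k --> U] --> vs * w j.
        apply: cvgM; last exact: cvg_cst.
        rewrite -[X in _ --> X]mulr1; apply: cvgM; first exact: cvg_cst.
        have -> : (fun k => k.+1%:R / k.+2%:R) = (fun k : nat => 1 - (k.+2%:R : R)^-1).
          apply/funext => k; have k0 : (k.+2%:R : R) != 0 by rewrite pnatr_eq0.
          rewrite (_ : k.+1%:R = k.+2%:R - 1); last by rewrite -[k.+2%:R]natr1 addrK.
          by rewrite mulrBl divff// mul1r.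
        rewrite -[X in _ --> X]subr0; apply: cvgB; first exact: cvg_cst.
        have h2 : (k.+2%:R : R)^-1 @[k --> \oo] --> (0 : R).
          have := @cvg_harmonic R; rewrite -(cvg_shiftn 1) => H'.
          apply: cvg_trans H'; apply: near_eq_cvg; apply: (@filterE _ \oo) => k /=.
          by rewrite addn1.
        by apply: cvg_trans h2; exact: cvg_fmap2 Uoo.
      have h1 := cvgr_gt _ vlim _ c2.
      have h2 := cvgr_lt _ (cvg_norm (hl j)) _ c1.
      near=> k; apply/ltW; apply: (@lt_trans _ _ c); near: k; [exact: h2|exact: h1].
    move=> /filter_ex[k hk]; have [_ [j]] := tkP k.
    by rewrite ltNge hk.
  have wi := w_gt0 i.
  (* [stability_core] wants a positive signed limit; when it is negative the two solutions are
     exchanged. *)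
  have [l0|l0] := leP 0 (l i).
    apply: (@stability_core U tk x y ex ey tx ty i vs) => //.
    by move: li; rewrite ger0_norm// => <-; exact: hl.
  apply: (@stability_core U tk y x ey ex ty tx i vs) => //.
    rewrite -li ltr0_norm//; apply: cvg_trans (cvgN (hl i)).
    by apply: near_eq_cvg; apply: (@filterE _ U) => k; rewrite fctE opprB.
  by move=> e /Vle; apply: filterS => t h j; rewrite distrC; exact: h.
move=> j; apply/cvgrPdist_le => e e0.
have awj : 0 < a_up j * w j by rewrite mulr_gt0// a_up_gt0.
have e1 : 0 < e / (a_up j * w j) by rewrite divr_gt0.
have : \forall t \near +oo, 0 <= t :> R by exact: nbhs_pinfty_ge.
move: (Vle _ e1); apply: filterS2 => t h tp; rewrite sub0r normrN.
rewrite (le_trans (Psi_dist_ge j tp (My _ _) (Mx _ _)))//.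
rewrite (le_trans (ler_wpM2l (ltW (a_up_gt0 j)) (h j)))// vs_eq0 add0r.
by rewrite (_ : a_up j * (e / (a_up j * w j) * w j) = e)//; field; rewrite !gt_eqF// a_up_gt0.
Unshelve. all: by end_near. Qed.

End Stability.

(** * A priori bounds by moving boxes *)

Section Envelopes.
Context {R : realType} {J : finType}.
Local Notation hist := (@hist R J).
Implicit Types (x : J -> R -> R).

(** The barrier principle on the faces of a box of radius [rho t]. As [rho] is nondecreasing, the
    entire past of the solution lies in the current box, so [key] can be used despite the infinite
    delay. *)
Lemma envelope x (dx : J -> R -> R) (rho drho : R -> R) (w : J -> R) t0 t1 :
  (forall j, 0 < w j) ->
  (forall j t, t0 <= t <= t1 -> {for t, continuous (x j)}) ->
  (forall t, t0 <= t <= t1 -> {for t, continuous rho}) ->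
  (forall s t, t0 <= s -> s <= t -> rho s <= rho t) ->
  (forall j t, t0 <= t < t1 -> has_deriv_within `[t0, +oo[ (x j) t (dx j t)) ->
  (forall t, t0 <= t < t1 -> has_deriv_within `[t0, +oo[ rho t (drho t)) ->
  (forall j s, s <= t0 -> `|x j s| <= rho t0 * w j) ->
  (forall j t, t0 <= t < t1 -> (forall i s, s <= t -> `|x i s| <= rho t * w i) ->
     (x j t = rho t * w j -> dx j t < drho t * w j) /\
     (x j t = - (rho t * w j) -> - (drho t * w j) < dx j t)) ->
  forall j t, t0 <= t <= t1 -> `|x j t| <= rho t * w j.
Proof.
move=> w0 cx cr mr dxP drP x0 key.
pose u (p : J * bool) s := (if p.2 then x p.1 s else - x p.1 s) - rho s * w p.1.
have u_le p s : t0 <= s <= t1 -> u p s <= 0.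
  apply: (@barrier R _ u t0 t1) => //.
  - move=> q r rt; apply: cvgB; last by apply: cvgM; [exact: cr|exact: cvg_cst].
    by case: q => i [] /=; [exact: cx|apply: cvgN; exact: cx].
  - move=> [i c]; have := x0 i t0 (lexx _); rewrite ler_norml /u/= => /andP[h1 h2].
    by case: c; rewrite subr_le0//; lra.
  move=> [i c] r rt Hle; have /andP[r0 r1] := rt.
  have Hx k s' : s' <= r -> `|x k s'| <= rho r * w k.
    move=> s'r; have [s0|/ltW s0] := leP s' t0.
      by rewrite (le_trans (x0 k s' s0))// ler_pM2r// mr.
    have st : t0 <= s' <= r by rewrite s0.
    have := Hle (k, true) s' st; have := Hle (k, false) s' st; rewrite /u/= => h1 h2.
    have : rho s' * w k <= rho r * w k by rewrite ler_pM2r// mr.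
    by rewrite ler_norml => h3; apply/andP; split; lra.
  have [k1 k2] := key i r rt Hx; rewrite /u/= => e.
  have dr := has_deriv_withinMr (c := w i) (drP r rt).
  case: c e => e.
    have l0 : dx i r - drho r * w i < 0 by rewrite subr_lt0 k1//; lra.
    have := has_deriv_within_decr r0 l0 (has_deriv_withinB (dxP i r rt) dr).
    by rewrite e.
  have l0 : - dx i r - drho r * w i < 0.
    by have : - (drho r * w i) < dx i r by [apply: k2; lra]; lra.
  have := has_deriv_within_decr r0 l0 (has_deriv_withinB (has_deriv_withinN (dxP i r rt)) dr).
  by rewrite e.
move=> j t tt; have := u_le (j, true) t tt; have := u_le (j, false) t tt; rewrite /u/= => h1 h2.
by rewrite ler_norml; apply/andP; split; lra.
Qed.

Variables (F : J -> R -> hist -> R) (w : J -> R).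
Hypothesis w_gt0 : forall j, 0 < w j.
Hypothesis F_growth : forall T, exists C K, forall j t phi rho, 0 <= t -> t <= T ->
  hist_cont phi -> 0 <= rho -> (forall i u, u <= 0 -> `|phi i u| <= rho * w i) ->
  (phi j 0 = rho * w j -> F j t phi <= C + K * rho) /\
  (phi j 0 = - (rho * w j) -> - (C + K * rho) <= F j t phi).
Hypothesis F_dissipative : exists T rho1, forall j t phi rho, 0 <= t -> T <= t ->
  hist_cont phi -> rho1 <= rho -> (forall i u, u <= 0 -> `|phi i u| <= rho * w i) ->
  (phi j 0 = rho * w j -> F j t phi < 0) /\
  (phi j 0 = - (rho * w j) -> 0 < F j t phi).

Lemma sum_weight_bound (M : R) j : 0 <= M -> M <= (\sum_i M / w i) * w j.
Proof.
move=> M0; rewrite -ler_pdivrMr// (bigD1 j)//= lerDl sumr_ge0// => i _.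
by rewrite divr_ge0// ltW.
Qed.

Lemma solution_bounded_finite x t0 T (M0 : R) : 0 <= t0 -> 0 <= M0 ->
  (forall j t, t < T -> {for t, continuous (x j)}) ->
  (forall j s, s <= t0 -> `|x j s| <= M0) ->
  (forall j t, t0 <= t -> t < T -> has_deriv_within `[t0, +oo[ (x j) t (F j t (past x t))) ->
  exists M, forall j t, t < T -> `|x j t| <= M.
Proof.
move=> t00 M00 cx xM0 dx.
have [C [K CK]] := F_growth T.
(* The sum makes [rho0 * w j] dominate the initial bound for every [j]; the added 1 keeps [rho] at
   least 1, so that [C] is absorbed by [C * rho]. *)
pose rho0 := \sum_i M0 / w i + 1.
have sum0 : 0 <= \sum_i M0 / w i.
  by apply: sumr_ge0 => i _; rewrite divr_ge0// ltW.
have rho01 : 1 <= rho0 by rewrite lerDr.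
have rho00 : 0 < rho0 by exact: lt_le_trans ltr01 rho01.
(* With this rate, the growth [lam * rho * w j] of the exponential envelope strictly exceeds
   [C + K * rho] on every face. *)
pose lam := \sum_i (`|C| + `|K| + 1) / w i.
have lam0 : 0 <= lam by apply: sumr_ge0 => i _; rewrite divr_ge0 ?ltW// !addr_ge0.
have lamw j : `|C| + `|K| + 1 <= lam * w j.
  by apply: sum_weight_bound; rewrite !addr_ge0.
pose rho t := rho0 * expR (lam * (t - t0)).
pose drho t := lam * rho t.
have rho_mono s t : s <= t -> rho s <= rho t.
  move=> st; rewrite /rho ler_pM2l// ler_expR ler_wpM2l// lerB//.
have rho_ge t : t0 <= t -> rho0 <= rho t.
  by move=> t0t; have := rho_mono _ _ t0t; rewrite {1}/rho subrr mulr0 expR0 mulr1.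
have drhoP (t : R) : is_derive t (1 : R) rho (drho t).
  have H1 : is_derive t (1:R) (fun t : R => lam * (t - t0)) lam.
    by apply: is_derive_eq; rewrite subr0 [_ *: _]mulr1.
  have H2 : is_derive t (1:R) (expR \o (fun t : R => lam * (t - t0)))
      (lam * expR (lam * (t - t0))).
    by apply: is_derive_eq; rewrite mulrC.
  have H3 := @is_deriveZ R R R (expR \o (fun t : R => lam * (t - t0))) rho0 t 1 _ H2.
  by apply: is_derive_eq H3 _; rewrite [_ *: _]mulrCA.
have cpx t : t < T -> hist_cont (past x t).
  by move=> tT; apply: hist_cont_past => j s st; apply: cx; exact: le_lt_trans tT.
have bnd t1 : t1 < T -> forall j t, t0 <= t <= t1 -> `|x j t| <= rho t * w j.
  move=> t1T; apply: (@envelope x (fun j t => F j t (past x t)) rho drho w t0 t1) => //.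
  - by move=> j t /andP[_ tt1]; apply: cx; exact: le_lt_trans t1T.
  - move=> t _; have [H _] := drhoP t.
    by apply/differentiable_continuous/derivable1_diffP.
  - by move=> s t _; exact: rho_mono.
  - by move=> j t /andP[h1 h2]; apply: dx => //; exact: lt_trans t1T.
  - move=> t _; have nT : \forall s \near t, [set: R] s by apply: (@filterE _ (nbhs t)).
    have := (has_deriv_within_derive rho (drho t) nT).2 (drhoP t).
    by apply: has_deriv_within_sub; apply: (@filterE _ (nbhs t)).
  - move=> j s st0; rewrite (le_trans (xM0 j s st0))//.
    rewrite (le_trans (sum_weight_bound j M00))// ler_pM2r// (le_trans _ (rho_ge _ (lexx _)))//.
    by rewrite lerDl.
  - move=> j t /andP[h1 h2] Hx; have tT := lt_trans h2 t1T.
    have rt := le_trans rho01 (rho_ge t h1).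
    have rt0 : 0 <= rho t by exact: le_trans rt.
    have Hp i u : u <= 0 -> `|past x t i u| <= rho t * w i.
      by move=> u0; apply: Hx; rewrite gerDl.
    have [k1 k2] := CK j t (past x t) (rho t) (le_trans t00 h1) (ltW tT) (cpx t tT) rt0 Hp.
    have k3 : C + K * rho t < drho t * w j.
      rewrite /drho mulrAC.
      have : (`|C| + `|K| + 1) * rho t <= lam * w j * rho t by rewrite ler_wpM2r.
      apply: lt_le_trans.
      have a1 : C <= `|C| * rho t.
        by rewrite (le_trans (ler_norm C))// ler_peMr.
      have a2 : K * rho t <= `|K| * rho t by rewrite ler_wpM2r// ler_norm.
      by rewrite !mulrDl mul1r; lra.
    move: k1 k2; rewrite /past addr0 => k1 k2; split.
      by move=> /k1 k; exact: le_lt_trans k3.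
    by move=> /k2 k; apply: lt_le_trans k; rewrite ltrN2.
exists (M0 + rho T * \sum_i w i) => j t tT.
have rT0 : 0 <= rho T by rewrite mulr_ge0 ?ltW// expR_gt0.
have sw : w j <= \sum_i w i.
  by rewrite (bigD1 j)//= lerDl sumr_ge0// => i _; exact: ltW.
have [tt0|/ltW t0t] := leP t t0.
  rewrite (le_trans (xM0 j t tt0))// lerDl mulr_ge0// sumr_ge0// => i _; exact: ltW.
have h : t0 <= t <= t by rewrite t0t lexx.
rewrite (le_trans (bnd t tT j t h))// (@le_trans _ _ (rho T * \sum_i w i)) ?lerDr//.
apply: ler_pM => //; [exact: le_trans (ltW rho00) (rho_ge t t0t)|exact: ltW|exact/rho_mono/ltW].
Qed.

(** The exponential envelope is used only until the dissipative regime begins; from then on a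
    constant box, large enough to contain the whole past, is invariant. *)
Lemma solution_bounded x t0 (M0 : R) : 0 <= t0 -> 0 <= M0 ->
  (forall j, continuous (x j)) -> (forall j s, s <= t0 -> `|x j s| <= M0) ->
  (forall j t, t0 <= t -> has_deriv_within `[t0, +oo[ (x j) t (F j t (past x t))) ->
  exists M, forall j t, `|x j t| <= M.
Proof.
move=> t00 M00 cx xM0 dx.
have [T [rho1 H]] := F_dissipative.
pose T1 := Num.max t0 T.
have tT1 : t0 <= T1 by rewrite le_max lexx.
have T1_ge0 := le_trans t00 tT1.
have [||M HM] := @solution_bounded_finite x t0 (T1 + 1) M0 t00 M00 _ xM0 _.
- by move=> j t _; exact: cx.
- by move=> j t h _; exact: dx.
pose M' := `|M|.
pose rho := Num.max rho1 0 + \sum_i M' / w i.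
have s0 : 0 <= \sum_i M' / w i.
  by apply: sumr_ge0 => i _; apply: divr_ge0; [exact: normr_ge0|exact: ltW].
have r0 : rho1 <= rho.
  by rewrite (@le_trans _ _ (Num.max rho1 0)) ?lerDl// le_max lexx.
have Mr j : M' <= rho * w j.
  rewrite (le_trans (sum_weight_bound j (normr_ge0 M)))// ler_pM2r// lerDr.
  by rewrite le_max lexx orbT.
have bnd t1 j t : T1 <= t <= t1 -> `|x j t| <= rho * w j.
  apply: (@envelope x (fun j t => F j t (past x t)) (fun=> rho) (fun=> 0) w T1 t1) => //.
  - by move=> i s _; exact: cx.
  - by move=> s _; exact: cvg_cst.
  - move=> i s /andP[T1s _]; apply: (has_deriv_within_sub _ (dx i s (le_trans tT1 T1s))).
    apply: (@filterE _ (nbhs s)) => r /=; rewrite !in_itv/= !andbT; exact: le_trans.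
  - move=> s _; apply/has_deriv_withinP => e e0; apply: (@filterE _ (nbhs s)) => r _.
    by rewrite mul0r subr0 subrr normr0 mulr_ge0// ltW.
  - move=> i s sT1; rewrite (le_trans _ (Mr i))// (le_trans _ (ler_norm M))//.
    by apply: HM; rewrite (le_lt_trans sT1)// ltrDl.
  - move=> i s /andP[T1s _] Hx.
    have Ts : T <= s by rewrite (le_trans _ T1s)// le_max lexx orbT.
    have Hp k u : u <= 0 -> `|past x s k u| <= rho * w k.
      by move=> u0; apply: Hx; rewrite gerDl.
    have cp : hist_cont (past x s) by apply: hist_cont_past => k r _; exact: cx.
    have [k1 k2] := H i s (past x s) rho (le_trans T1_ge0 T1s) Ts cp r0 Hp.
    by move: k1 k2; rewrite /past addr0 mul0r oppr0.
exists (M' + rho * \sum_i w i) => j t.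
have rr0 : 0 <= rho by rewrite addr_ge0// le_max lexx orbT.
have sw : w j <= \sum_i w i.
  by rewrite (bigD1 j)//= lerDl sumr_ge0// => i _; exact: ltW.
have [tT|Tt] := ltP t (T1 + 1).
  rewrite (le_trans (HM j t tT))// (le_trans (ler_norm M))// lerDl mulr_ge0//.
  by rewrite sumr_ge0// => i _; exact: ltW.
have h : T1 <= t <= t by rewrite lexx andbT (le_trans _ Tt)// lerDl.
rewrite (le_trans (bnd t j t h))// (@le_trans _ _ (rho * \sum_i w i)) ?lerDr//.
  by rewrite ler_wpM2l.
exact: normr_ge0.
Qed.

End Envelopes.

(** * Functions on the half-line, vanishing at infinity or periodic *)

Section HalfLine.
Context {R : realType}.

Lemma cvg_sumr (S I : Type) (FS : set_system S) (r : seq I) (f : I -> S -> R) (l : I -> R) :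
  Filter FS -> (forall i, f i k @[k --> FS] --> l i) ->
  \sum_(i <- r) f i k @[k --> FS] --> \sum_(i <- r) l i.
Proof.
by move=> FF fl; apply: cvg_big => [|i _]; [exact: add_continuous|exact: fl].
Qed.

Lemma ler_norm_dist (u v c : R) : `|u - v| <= c -> `|u| <= `|v| + c.
Proof.
move=> uvc; rewrite -{1}(subrK v u) (le_trans (ler_normD _ _))//.
by rewrite addrC lerD2l.
Qed.

Lemma vanish_le (u v : R -> R) (C : R) :
  (\forall t \near +oo, `|u t| <= C * `|v t|) ->
  v t @[t --> +oo] --> (0 : R) -> u t @[t --> +oo] --> (0 : R).
Proof.
move=> uv v0; apply/cvgrPdist_le => e e0.
have e1 : 0 < e / (`|C| + 1) by rewrite divr_gt0// ltr_wpDl.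
move/cvgrPdist_le/(_ _ e1) : v0; move: uv; apply: filterS2 => t h.
rewrite !sub0r !normrN => h2; rewrite (le_trans h)//.
rewrite (le_trans (ler_wpM2r (normr_ge0 _) (ler_norm C)))//.
rewrite (le_trans (ler_wpM2l (normr_ge0 C) h2))// mulrC frac_le//.
exact: ltW.
Qed.

Lemma vanish_sum (K : finType) (u v : K -> R -> R) :
  (forall k, u k t - v k t @[t --> +oo] --> (0 : R)) ->
  \sum_k u k t - \sum_k v k t @[t --> +oo] --> (0 : R).
Proof.
move=> uv.
have -> : (fun t => \sum_k u k t - \sum_k v k t) = (fun t => \sum_k (u k t - v k t)).
  by apply/funext => t; rewrite -sumrB.
have FF : Filter (pinfty_nbhs R) by exact: _.
have := @cvg_sumr R K (pinfty_nbhs R) (index_enum K) (fun k t => u k t - v k t) (fun=> 0) FF uv.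
by rewrite big1.
Qed.

Lemma nonneg_bounded (f : R -> R) (T : R) : continuous_nonneg f ->
  exists C, forall t, 0 <= t -> t <= T -> `|f t| <= C.
Proof.
move=> cf; have [T0|T0] := leP 0 T; last first.
  by exists 0 => t t0 tT; have := le_lt_trans (le_trans t0 tT) T0; rewrite ltxx.
have cf' : {within `[0, T], continuous (fun t => `|f t|)}.
  have : {within `[0, T], continuous f}.
    apply: continuous_subspaceW cf => t /=; rewrite !in_itv/= => /andP[->//].
  move=> H t; apply: cvg_norm; exact: H.
have [c _ hc] := EVT_max T0 cf'.
by exists `|f c| => t t0 tT; apply: hc; rewrite in_itv/= t0.
Qed.

Lemma nonneg_periodic_bounded (f : R -> R) (omega : R) : 0 < omega ->
  continuous_nonneg f -> periodic_nonneg omega f ->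
  exists C, forall t, 0 <= t -> `|f t| <= C.
Proof.
move=> o0 cf pf; have [C HC] := nonneg_bounded omega cf; exists C => t t0.
have [r [m [-> r0 ro]]] := period_decomposition o0 t0.
by rewrite (periodic_iter (ltW o0) pf)// HC.
Qed.

Lemma finite_bound (I : finType) (P : I -> R -> Prop) :
  (forall i C C', C <= C' -> P i C -> P i C') ->
  (forall i, exists C, P i C) -> exists C, forall i, P i C.
Proof.
move=> mono /choice[C HC]; exists (\sum_i `|C i|) => i.
apply: mono (HC i); rewrite (le_trans (ler_norm _))// (bigD1 i)//= lerDl.
exact: sumr_ge0.
Qed.

Lemma hist_continuous_nonneg (J : finType) (F : R -> @hist R J -> R) phi M :
  hist_continuous F -> hist_cont phi -> hist_bounded M phi ->
  continuous_nonneg (fun t => F t phi).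
Proof.
move=> FC cp bp; apply/subspace_continuousP => t; rewrite /= in_itv/= andbT => t0.
apply: (FC R (within `[0, +oo[ (nbhs t)) id (fun=> phi) t phi M) => //.
- rewrite /within/=; apply: (@filterE _ (nbhs t)) => s /=; rewrite in_itv/= andbT => s0.
  by split.
- by apply: cvg_within.
- by move=> T e e0; apply: filterE => s j u _ _; rewrite subrr normr0 ltW.
Qed.

End HalfLine.

(** * The network nonlinearity: continuity, Lipschitz gain, periodicity *)

Section Network.
Context {R : realType} {n P Q : nat}.
Local Notation hist := (@hist R 'I_n).
Variables (G H : 'I_n -> R -> R)
  (h : 'I_n -> 'I_n -> 'I_n -> 'I_P -> R -> R -> R)
  (f : 'I_n -> 'I_n -> 'I_n -> 'I_Q -> R -> R -> R)
  (g tg eta teta : 'I_n -> 'I_n -> 'I_Q -> R -> R)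
  (gam1 gam2 : 'I_n -> 'I_n -> 'I_n -> 'I_P -> R)
  (mu1 mu2 : 'I_n -> 'I_n -> 'I_n -> 'I_Q -> R)
  (xi txi : 'I_n -> 'I_n -> 'I_Q -> R) (zeta sigma : 'I_n -> R).
Hypotheses (G_cont : forall i, continuous (G i)) (H_cont : forall i, continuous (H i))
  (h_cont : forall i j l p, continuous (fun z : R * R => h i j l p z.1 z.2))
  (f_cont : forall i j l q, continuous (fun z : R * R => f i j l q z.1 z.2))
  (g_cont : forall i j q, continuous (g i j q))
  (tg_cont : forall i l q, continuous (tg i l q))
  (eta_weight : forall i j q, stieltjes_weight (eta i j q))
  (teta_weight : forall i l q, stieltjes_weight (teta i l q))
  (gam1_gt0 : forall i j l p, 0 < gam1 i j l p)
  (gam2_gt0 : forall i j l p, 0 < gam2 i j l p)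
  (mu1_gt0 : forall i j l q, 0 < mu1 i j l q)
  (mu2_gt0 : forall i j l q, 0 < mu2 i j l q)
  (xi_gt0 : forall i j q, 0 < xi i j q)
  (txi_gt0 : forall i l q, 0 < txi i l q)
  (zeta_gt0 : forall i, 0 < zeta i)
  (sigma_gt0 : forall i, 0 < sigma i)
  (h_lip : forall i j l p u1 u2 v1 v2,
     `|h i j l p u1 u2 - h i j l p v1 v2|
       <= gam1 i j l p * `|u1 - v1| + gam2 i j l p * `|u2 - v2|)
  (f_lip : forall i j l q u1 u2 v1 v2,
     `|f i j l q u1 u2 - f i j l q v1 v2|
       <= mu1 i j l q * `|u1 - v1| + mu2 i j l q * `|u2 - v2|)
  (g_lip : forall i j q u v, `|g i j q u - g i j q v| <= xi i j q * `|u - v|)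
  (tg_lip : forall i l q u v,
     `|tg i l q u - tg i l q v| <= txi i l q * `|u - v|)
  (G_lip : forall i u v, `|G i u - G i v| <= zeta i * `|u - v|)
  (H_lip : forall i u v, `|H i u - H i v| <= sigma i * `|u - v|).

Definition delay_sum (c : 'I_n -> 'I_n -> 'I_n -> 'I_P -> R -> R)
    (tau ttau : 'I_n -> 'I_n -> 'I_P -> R -> R) i t (phi : hist) : R :=
  \sum_(p < P) \sum_(j < n) \sum_(l < n)
    c i j l p t * h i j l p (phi j (- tau i j p t)) (phi l (- ttau i l p t)).

Definition distributed_sum (d : 'I_n -> 'I_n -> 'I_n -> 'I_Q -> R -> R) i t
    (phi : hist) : R :=
  \sum_(q < Q) \sum_(j < n) \sum_(l < n)
    d i j l q t * f i j l q (RSint_neg (fun s => g i j q (phi j s)) (eta i j q))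
      (RSint_neg (fun s => tg i l q (phi l s)) (teta i l q)).

(** The bracket of the system without its damping term -b_i. *)
Definition net c d tau ttau (I : 'I_n -> R -> R) i t (phi : hist) : R :=
  G i (delay_sum c tau ttau i t phi) + H i (distributed_sum d i t phi) + I i t.

(** The Lipschitz bound of [net] for histories whose components differ by at most [e j]. Its shape
    is that of the hypotheses: [e j] equal to d_j / d_i gives the sum in (vi), and [a_up j] times
    d_j / d_i the one in (viii). *)
Definition gain (c : 'I_n -> 'I_n -> 'I_n -> 'I_P -> R -> R)
    (d : 'I_n -> 'I_n -> 'I_n -> 'I_Q -> R -> R) i t (e : 'I_n -> R) : R :=
  \sum_(j < n) \sum_(l < n)
    (\sum_(p < P) zeta i * `|c i j l p t| * (gam1 i j l p * e j + gam2 i j l p * e l)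
     + \sum_(q < Q) sigma i * `|d i j l q t| *
         (mu1 i j l q * xi i j q * e j + mu2 i j l q * txi i l q * e l)).

(** The hypotheses sum over [j] and [l] first, the system over [p] or [q] first; this form matches
    the system and is the one used for estimates. *)
Lemma gainE c d i t e : gain c d i t e =
  zeta i * (\sum_(p < P) \sum_(j < n) \sum_(l < n)
    `|c i j l p t| * (gam1 i j l p * e j + gam2 i j l p * e l)) +
  sigma i * (\sum_(q < Q) \sum_(j < n) \sum_(l < n)
    `|d i j l q t| * (mu1 i j l q * xi i j q * e j + mu2 i j l q * txi i l q * e l)).
Proof.
have ex (m : nat) (k : R) (E : 'I_n -> 'I_n -> 'I_m -> R) :
    \sum_(j < n) \sum_(l < n) \sum_(p < m) k * E j l p =
    k * (\sum_(p < m) \sum_(j < n) \sum_(l < n) E j l p).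
  under eq_bigr => j _ do rewrite exchange_big/=.
  rewrite exchange_big/= mulr_sumr; apply: eq_bigr => p _.
  rewrite mulr_sumr; apply: eq_bigr => j _.
  by rewrite mulr_sumr; apply: eq_bigr => l _.
rewrite /gain -!ex -big_split; apply: eq_bigr => j _; rewrite -big_split.
by apply: eq_bigr => l _; congr (_ + _); apply: eq_bigr => p _; rewrite mulrA.
Qed.

Lemma ler_dist_sum (I : Type) (r : seq I) (u v e : I -> R) :
  (forall i, `|u i - v i| <= e i) ->
  `|\sum_(i <- r) u i - \sum_(i <- r) v i| <= \sum_(i <- r) e i.
Proof.
move=> uve; rewrite -sumrB (le_trans (ler_norm_sum _ _ _))//.
by apply: ler_sum => i _; exact: uve.
Qed.

Lemma gain_ge0 c d i t e : (forall j, 0 <= e j) -> 0 <= gain c d i t e.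
Proof.
move=> e0; rewrite gainE; apply: addr_ge0; (apply: mulr_ge0; first exact: ltW);
  do 3 (apply: sumr_ge0 => ? _); (apply: mulr_ge0; first exact: normr_ge0);
  apply: addr_ge0; apply: mulr_ge0 => //; try apply: mulr_ge0; exact: ltW.
Qed.

Lemma gain_scale c d i t e r : gain c d i t (fun j => r * e j) = r * gain c d i t e.
Proof.
rewrite !gainE mulrDr ![r * (_ i * _)]mulrCA; congr (_ * _ + _ * _);
  do 3 (rewrite mulr_sumr; apply: eq_bigr => ? _); ring.
Qed.

Lemma lip_comp_cont_neg (k u : R -> R) : continuous k -> cont_neg u ->
  cont_neg (fun s => k (u s)).
Proof.
by move=> ck cu s; apply: (@continuous_comp R R R (fun s : R => u (Num.min s 0)) k s);
  [exact: cu|exact: ck].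
Qed.

Lemma lip_comp_bound (k u : R -> R) (L M : R) :
  0 <= L -> (forall v w, `|k v - k w| <= L * `|v - w|) ->
  (forall s, s <= 0 -> `|u s| <= M) -> forall s, s <= 0 -> `|k (u s)| <= `|k 0| + L * M.
Proof.
move=> L0 kL uM s s0; apply: ler_norm_dist.
by rewrite (le_trans (kL _ _))// subr0 ler_wpM2l// uM.
Qed.

Lemma stieltjes_cvg (k : R -> R) (et : R -> R) (L M : R) (S : Type) (FS : set_system S)
    (phi : S -> hist) (phi0 : hist) j :
  Filter FS -> stieltjes_weight et -> continuous k -> 0 <= L ->
  (forall v w, `|k v - k w| <= L * `|v - w|) ->
  (\forall s \near FS, hist_cont (phi s) /\ hist_bounded M (phi s)) ->
  hist_cont phi0 -> hist_bounded M phi0 -> hist_cvg FS phi phi0 ->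
  RSint_neg (fun u => k (phi s j u)) et @[s --> FS] -->
  RSint_neg (fun u => k (phi0 j u)) et.
Proof.
move=> FF we ck L0 kL Hphi c0 b0 hc.
apply: (@RSint_neg_cvg R S FS _ _ et (`|k 0| + L * M)) => //.
- by apply: filterS Hphi => s [h1 h2]; exact: lip_comp_cont_neg (h1 j).
- exact: lip_comp_cont_neg (c0 j).
- by apply: filterS Hphi => s [h1 h2]; exact: lip_comp_bound L0 kL (h2 j).
- exact: lip_comp_bound L0 kL (b0 j).
- move=> T e e0; have e1 : 0 < e / (L + 1) by rewrite divr_gt0// ltr_wpDl.
  apply: filterS (hc T _ e1) => s hs u Tu u0; rewrite (le_trans (kL _ _))//.
  by rewrite (le_trans (ler_wpM2l L0 (hs j u Tu u0)))// mulrC frac_le// ltW.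
Qed.

Lemma cvg_comp2 (k : R -> R -> R) (S : Type) (FS : set_system S) (u v : S -> R) (u0 v0 : R) :
  Filter FS -> continuous (fun z : R * R => k z.1 z.2) ->
  u @ FS --> u0 -> v @ FS --> v0 -> k (u s) (v s) @[s --> FS] --> k u0 v0.
Proof.
move=> FF ck uu vv.
have uv : (u s, v s) @[s --> FS] --> ((u0, v0) : R * R).
  exact: (@cvg_pair _ _ _ FS (nbhs u0) (nbhs v0) _ _ _ u v uu vv).
exact: (cvg_comp (fun s => (u s, v s)) (fun z : R * R => k z.1 z.2) uv (ck (u0, v0))).
Qed.

Lemma net_continuous c d tau ttau I :
  (forall i j l p, continuous_nonneg (c i j l p)) ->
  (forall i j l q, continuous_nonneg (d i j l q)) ->
  (forall i j p, continuous_nonneg (tau i j p)) ->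
  (forall i l p, continuous_nonneg (ttau i l p)) ->
  (forall i j p t, 0 <= t -> 0 <= tau i j p t) ->
  (forall i l p t, 0 <= t -> 0 <= ttau i l p t) ->
  (forall i, continuous_nonneg (I i)) ->
  forall i, hist_continuous (net c d tau ttau I i).
Proof.
move=> cc cd ct ctt t_ge0 tt_ge0 cI i S FS t phi t0 phi0 M FF t00 Hk c0 b0 tt0 hc.
have tn : \forall k \near FS, 0 <= t k by apply: filterS Hk => k [].
have Hphi : \forall s \near FS, hist_cont (phi s) /\ hist_bounded M (phi s).
  by apply: filterS Hk => k [].
have ev (th : R -> R) j : continuous_nonneg th -> (forall s, 0 <= s -> 0 <= th s) ->
    phi k j (- th (t k)) @[k --> FS] --> phi0 j (- th t0).
  move=> cth th0; apply: hist_cvg_eval => //; first exact: th0.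
    by apply: filterS tn => k; exact: th0.
  exact: nonneg_cvg.
apply: cvgD; last exact: nonneg_cvg.
apply: cvgD.
  apply: (@cvg_comp _ _ _ (fun k => delay_sum c tau ttau i (t k) (phi k)) (G i) FS _ _ _
    (@G_cont i _)).
  apply: cvg_sumr => p; apply: cvg_sumr => j; apply: cvg_sumr => l.
  apply: cvgM; first exact: nonneg_cvg.
  by apply: cvg_comp2 => //; apply: ev => // s; [exact: t_ge0|exact: tt_ge0].
apply: (@cvg_comp _ _ _ (fun k => distributed_sum d i (t k) (phi k)) (H i) FS _ _ _
  (@H_cont i _)).
apply: cvg_sumr => q; apply: cvg_sumr => j; apply: cvg_sumr => l.
apply: cvgM; first exact: nonneg_cvg.
apply: cvg_comp2 => //.
  by apply: (@stieltjes_cvg (g i j q) _ (xi i j q) M S FS phi phi0 j) => //; exact: ltW.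
by apply: (@stieltjes_cvg (tg i l q) _ (txi i l q) M S FS phi phi0 l) => //; exact: ltW.
Qed.

Lemma net_lipschitz c d tau ttau I i t phi psi M e : 0 <= t ->
  (forall i j p t, 0 <= t -> 0 <= tau i j p t) ->
  (forall i l p t, 0 <= t -> 0 <= ttau i l p t) ->
  hist_cont phi -> hist_cont psi -> hist_bounded M phi -> hist_bounded M psi ->
  (forall j u, u <= 0 -> `|phi j u - psi j u| <= e j) ->
  `|net c d tau ttau I i t phi - net c d tau ttau I i t psi| <= gain c d i t e.
Proof.
move=> t0 t_ge0 tt_ge0 cp cs bp bs pe.
rewrite gainE /net.
rewrite (_ : _ - _ = (G i (delay_sum c tau ttau i t phi) - G i (delay_sum c tau ttau i t psi))
  + (H i (distributed_sum d i t phi) - H i (distributed_sum d i t psi))); last by ring.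
apply: le_trans (ler_normD _ _) _; apply: lerD.
  apply: le_trans (G_lip _ _ _) _; rewrite ler_pM2l//.
  apply: ler_dist_sum => p; apply: ler_dist_sum => j; apply: ler_dist_sum => l.
  rewrite -mulrBr normrM ler_wpM2l//; apply: le_trans (h_lip _ _ _ _ _ _ _ _) _.
  by apply: lerD; rewrite ler_pM2l//; apply: pe; rewrite oppr_le0 ?t_ge0 ?tt_ge0.
apply: le_trans (H_lip _ _ _) _; rewrite ler_pM2l//.
apply: ler_dist_sum => q; apply: ler_dist_sum => j; apply: ler_dist_sum => l.
rewrite -mulrBr normrM ler_wpM2l//; apply: le_trans (f_lip _ _ _ _ _ _ _ _) _.
have RSle (k et : R -> R) (L : R) j' : 0 <= L -> stieltjes_weight et -> continuous k ->
    (forall v w, `|k v - k w| <= L * `|v - w|) ->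
    `|RSint_neg (fun s => k (phi j' s)) et - RSint_neg (fun s => k (psi j' s)) et| <= L * e j'.
  move=> L0 we ck kL; apply: (@RSint_neg_le R _ _ _ _ (`|k 0| + L * M)) => //.
  - exact: lip_comp_cont_neg.
  - exact: lip_comp_cont_neg.
  - exact: lip_comp_bound L0 kL (bp j').
  - exact: lip_comp_bound L0 kL (bs j').
  - by move=> u u0; apply: le_trans (kL _ _) _; rewrite ler_wpM2l// pe.
apply: lerD; rewrite -mulrA ler_pM2l//; apply: RSle => //; exact: ltW.
Qed.

(** Closeness of the delays yields closeness of the delayed states only through the eventual
    Lipschitz bound on [x]. The periodic delays are bounded, so for late [t] both delayed times are
    beyond [T1]. *)
Lemma net_asymptotic c d tau ttau I ch dh tauh ttauh Ih (omega M T1 B : R) x i :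
  0 < omega -> 0 <= T1 ->
  (forall i j l p, continuous_nonneg (ch i j l p)) ->
  (forall i j l q, continuous_nonneg (dh i j l q)) ->
  (forall i j p, continuous_nonneg (tauh i j p)) ->
  (forall i l p, continuous_nonneg (ttauh i l p)) ->
  (forall i j l p, periodic_nonneg omega (ch i j l p)) ->
  (forall i j l q, periodic_nonneg omega (dh i j l q)) ->
  (forall i j p, periodic_nonneg omega (tauh i j p)) ->
  (forall i l p, periodic_nonneg omega (ttauh i l p)) ->
  (forall i j l p, vanishes_at_infty (fun t => c i j l p t - ch i j l p t)) ->
  (forall i j l q, vanishes_at_infty (fun t => d i j l q t - dh i j l q t)) ->
  (forall i j p, vanishes_at_infty (fun t => tau i j p t - tauh i j p t)) ->
  (forall i l p, vanishes_at_infty (fun t => ttau i l p t - ttauh i l p t)) ->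
  (forall i, vanishes_at_infty (fun t => I i t - Ih i t)) ->
  (forall j, continuous (x j)) -> (forall j t, `|x j t| <= M) ->
  (forall j r s, T1 <= r -> T1 <= s -> `|x j s - x j r| <= B * `|s - r|) ->
  net c d tau ttau I i t (past x t) - net ch dh tauh ttauh Ih i t (past x t)
    @[t --> +oo] --> (0 : R).
Proof.
move=> o0 T10 cch cdh cth ctth pch pdh pth ptth vc vd vt vtt vI cx xM xL.
have cpx t : hist_cont (past x t) by apply: hist_cont_past => j s _; exact: cx.
have bpx t : hist_bounded M (past x t) by apply: past_bounded => j s _; exact: xM.
have t_ge0 : \forall t \near +oo, 0 <= t :> R by exact: nbhs_pinfty_ge.
(* The product is split so that boundedness is asked of the periodic coefficient [uh] and of the
   state factor [v]. *)
have prod (u uh v vh : R -> R) (Cu Cv : R) :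
    (\forall t \near +oo, `|uh t| <= Cu) -> (forall t, `|v t| <= Cv) ->
    u t - uh t @[t --> +oo] --> (0 : R) -> v t - vh t @[t --> +oo] --> (0 : R) ->
    u t * v t - uh t * vh t @[t --> +oo] --> (0 : R).
  move=> uhC vC uu vv.
  have -> : (fun t => u t * v t - uh t * vh t) =
      (fun t => (u t - uh t) * v t + uh t * (v t - vh t)).
    by apply/funext => t; ring.
  rewrite -[X in _ --> X]addr0; apply: cvgD.
    apply: (vanish_le (C := Cv) _ uu); apply: (@filterE _ (pinfty_nbhs R)) => t.
    by rewrite normrM mulrC ler_wpM2r.
  apply: (vanish_le (C := Cu) _ vv); apply: filterS uhC => t h'.
  by rewrite normrM ler_wpM2r.
have per_bound (u : R -> R) : continuous_nonneg u -> periodic_nonneg omega u ->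
    exists C, \forall t \near +oo, `|u t| <= C.
  move=> cu pu; have [C HC] := nonneg_periodic_bounded o0 cu pu; exists C.
  by apply: filterS t_ge0 => t; exact: HC.
have shift (th thh : R -> R) j : continuous_nonneg thh -> periodic_nonneg omega thh ->
    vanishes_at_infty (fun t => th t - thh t) ->
    x j (t - th t) - x j (t - thh t) @[t --> +oo] --> (0 : R).
  move=> cu pu vu; have [C HC] := per_bound _ cu pu.
  apply: (vanish_le (C := B) _ vu).
  have h1 : \forall t \near +oo, T1 + C + 1 <= t by exact/nbhs_pinfty_ge/num_real.
  move/cvgrPdist_le/(_ 1 ltr01) : vu; move: h1 HC; apply: filterS3 => t h1 h2.
  rewrite sub0r normrN => h3.
  have /andP[a1 a2] : - C <= thh t <= C by rewrite -ler_norml.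
  have /andP[b1 b2] : -1 <= th t - thh t <= 1 by rewrite -ler_norml.
  have T2 : T1 <= t - thh t by lra.
  have T3 : T1 <= t - th t by lra.
  have := @xL j _ _ T2 T3.
  by rewrite (_ : t - th t - (t - thh t) = - (th t - thh t)) ?normrN//; ring.
have dG : G i (delay_sum c tau ttau i t (past x t)) -
    G i (delay_sum ch tauh ttauh i t (past x t)) @[t --> +oo] --> (0 : R).
  apply: (@vanish_le R _ (fun t => delay_sum c tau ttau i t (past x t) -
    delay_sum ch tauh ttauh i t (past x t)) (zeta i)).
    by apply: (@filterE _ (pinfty_nbhs R)) => t; exact: G_lip.
  apply: vanish_sum => p; apply: vanish_sum => j; apply: vanish_sum => l.
  have [C HC] := per_bound _ (cch i j l p) (pch i j l p).
  apply: (prod _ _ _ _ C (`|h i j l p 0 0| + (gam1 i j l p * M + gam2 i j l p * M)) HC) => //.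
    move=> t; apply: ler_norm_dist; rewrite (le_trans (h_lip _ _ _ _ _ _ _ _))//.
    by rewrite !subr0 lerD// ler_pM2l// xM.
    exact: vc.
  have s1 := shift _ _ j (cth i j p) (pth i j p) (vt i j p).
  have s2 := shift _ _ l (ctth i l p) (ptth i l p) (vtt i l p).
  have s12 : gam1 i j l p * `|x j (t - tau i j p t) - x j (t - tauh i j p t)| +
      gam2 i j l p * `|x l (t - ttau i l p t) - x l (t - ttauh i l p t)| @[t --> +oo] --> (0 : R).
    have := cvgD (cvgM (cvg_cst (gam1 i j l p)) (cvg_norm s1))
                 (cvgM (cvg_cst (gam2 i j l p)) (cvg_norm s2)).
    by rewrite normr0 !mulr0 addr0; exact.
  apply: (vanish_le (C := 1) _ s12); apply: (@filterE _ (pinfty_nbhs R)) => t.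
  rewrite mul1r; apply: le_trans (h_lip _ _ _ _ _ _ _ _) (ler_norm _).
have dH : H i (distributed_sum d i t (past x t)) -
    H i (distributed_sum dh i t (past x t)) @[t --> +oo] --> (0 : R).
  apply: (@vanish_le R _ (fun t => distributed_sum d i t (past x t) -
    distributed_sum dh i t (past x t)) (sigma i)).
    by apply: (@filterE _ (pinfty_nbhs R)) => t; exact: H_lip.
  apply: vanish_sum => q; apply: vanish_sum => j; apply: vanish_sum => l.
  have [C HC] := per_bound _ (cdh i j l q) (pdh i j l q).
  have RSb (k et : R -> R) (L : R) j' : 0 <= L -> stieltjes_weight et -> continuous k ->
      (forall v w, `|k v - k w| <= L * `|v - w|) ->
      exists C', forall t, `|RSint_neg (fun s => k (past x t j' s)) et| <= C'.
    move=> L0 we ck kL; have k0 : 0 <= M by exact: le_trans (xM j' 0).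
    exists (`|RSint_neg (fun _ : R => k 0) et| + L * M) => t.
    apply: ler_norm_dist; apply: (@RSint_neg_le R _ _ _ _ (`|k 0| + L * M)) => //.
    - exact: lip_comp_cont_neg ck (cpx t j').
    - by move=> u; exact: cvg_cst.
    - exact: lip_comp_bound L0 kL (bpx t j').
    - by move=> u _; rewrite lerDl mulr_ge0.
    - move=> u u0; apply: le_trans (kL _ _) _; rewrite subr0 ler_wpM2l//; exact: bpx.
  have [C1 H1] := RSb _ _ _ j (ltW (xi_gt0 i j q)) (eta_weight i j q) (@g_cont i j q) (g_lip i j q).
  have [C2 H2] := RSb _ _ _ l (ltW (txi_gt0 i l q)) (teta_weight i l q) (@tg_cont i l q) (tg_lip i l q).
  apply: (prod _ _ _ _ C (`|f i j l q 0 0| + (mu1 i j l q * C1 + mu2 i j l q * C2)) HC) => //.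
    move=> t; apply: ler_norm_dist; rewrite (le_trans (f_lip _ _ _ _ _ _ _ _))//.
    by rewrite !subr0 lerD// ler_pM2l.
    exact: vd.
  (* The distributed terms have the same weights and integrands in both systems; only the
     coefficients differ. *)
  have -> : (fun t => f i j l q (RSint_neg (fun s => g i j q (past x t j s)) (eta i j q))
        (RSint_neg (fun s => tg i l q (past x t l s)) (teta i l q)) -
      f i j l q (RSint_neg (fun s => g i j q (past x t j s)) (eta i j q))
        (RSint_neg (fun s => tg i l q (past x t l s)) (teta i l q))) = fun=> (0 : R).
    by apply/funext => t; rewrite subrr.
  exact: cvg_cst.
have -> : (fun t => net c d tau ttau I i t (past x t) - net ch dh tauh ttauh Ih i t (past x t)) =
   (fun t => (G i (delay_sum c tau ttau i t (past x t)) -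
      G i (delay_sum ch tauh ttauh i t (past x t))) +
    (H i (distributed_sum d i t (past x t)) - H i (distributed_sum dh i t (past x t))) +
    (I i t - Ih i t)).
  by apply/funext => t; rewrite /net; ring.
have := cvgD (cvgD dG dH) (vI i).
by rewrite !addr0; exact.
Qed.

Lemma gain_asymptotic c d ch dh i e :
  (forall i j l p, vanishes_at_infty (fun t => c i j l p t - ch i j l p t)) ->
  (forall i j l q, vanishes_at_infty (fun t => d i j l q t - dh i j l q t)) ->
  gain c d i t e - gain ch dh i t e @[t --> +oo] --> (0 : R).
Proof.
move=> vc vd.
have abs0 (u v : R -> R) (k : R) : u t - v t @[t --> +oo] --> (0 : R) ->
    `|u t| * k - `|v t| * k @[t --> +oo] --> (0 : R).
  move=> uv; apply: (vanish_le (C := `|k|) _ uv); apply: (@filterE _ (pinfty_nbhs R)) => t.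
  by rewrite -mulrBl normrM mulrC ler_wpM2l// ler_dist_dist.
have E (k1 k2 : R) (u v u' v' : R -> R) : u t - u' t @[t --> +oo] --> (0 : R) ->
    v t - v' t @[t --> +oo] --> (0 : R) ->
    (k1 * u t + k2 * v t) - (k1 * u' t + k2 * v' t) @[t --> +oo] --> (0 : R).
  move=> uu vv.
  have -> : (fun t => (k1 * u t + k2 * v t) - (k1 * u' t + k2 * v' t)) =
      (fun t => k1 * (u t - u' t) + k2 * (v t - v' t)).
    by apply/funext => t; ring.
  have := cvgD (cvgM (cvg_cst k1) uu) (cvgM (cvg_cst k2) vv).
  by rewrite !mulr0 addr0; exact.
have -> : (fun t => gain c d i t e - gain ch dh i t e) = (fun t =>
  (zeta i * (\sum_(p < P) \sum_(j < n) \sum_(l < n)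
    `|c i j l p t| * (gam1 i j l p * e j + gam2 i j l p * e l)) +
  sigma i * (\sum_(q < Q) \sum_(j < n) \sum_(l < n)
    `|d i j l q t| * (mu1 i j l q * xi i j q * e j + mu2 i j l q * txi i l q * e l))) -
  (zeta i * (\sum_(p < P) \sum_(j < n) \sum_(l < n)
    `|ch i j l p t| * (gam1 i j l p * e j + gam2 i j l p * e l)) +
  sigma i * (\sum_(q < Q) \sum_(j < n) \sum_(l < n)
    `|dh i j l q t| * (mu1 i j l q * xi i j q * e j + mu2 i j l q * txi i l q * e l)))).
  by apply/funext => t; rewrite !gainE.
apply: E; do 3 apply: vanish_sum => ?; apply: abs0; [exact: vc|exact: vd].
Qed.

Lemma gain_continuous c d i e :
  (forall i j l p, continuous_nonneg (c i j l p)) ->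
  (forall i j l q, continuous_nonneg (d i j l q)) ->
  continuous_nonneg (fun t => gain c d i t e).
Proof.
move=> cc cd; apply/subspace_continuousP => t; rewrite /= in_itv/= andbT => t0.
have C (u : R -> R) : continuous_nonneg u -> u s @[s --> within `[0, +oo[ (nbhs t)] --> u t.
  by move=> /subspace_continuousP; apply; rewrite /= in_itv/= t0.
rewrite /gain; do 2 (apply: cvg_sumr => ?); apply: cvgD; apply: cvg_sumr => ?;
  (apply: cvgM; last exact: cvg_cst); (apply: cvgM; first exact: cvg_cst);
  apply: cvg_norm; exact: C.
Qed.

Lemma gain_periodic c d i e omega :
  (forall i j l p, periodic_nonneg omega (c i j l p)) ->
  (forall i j l q, periodic_nonneg omega (d i j l q)) ->
  periodic_nonneg omega (fun t => gain c d i t e).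
Proof.
move=> pc pd t t0; rewrite /gain; do 2 (apply: eq_bigr => ? _).
by congr (_ + _); apply: eq_bigr => ? _; rewrite ?pc ?pd.
Qed.

Lemma net_periodic c d tau ttau I i phi omega :
  (forall i j l p, periodic_nonneg omega (c i j l p)) ->
  (forall i j l q, periodic_nonneg omega (d i j l q)) ->
  (forall i j p, periodic_nonneg omega (tau i j p)) ->
  (forall i l p, periodic_nonneg omega (ttau i l p)) ->
  (forall i, periodic_nonneg omega (I i)) ->
  periodic_nonneg omega (fun t => net c d tau ttau I i t phi).
Proof.
move=> pc pd pt ptt pI t t0; rewrite /net pI//; congr (G i _ + H i _ + _);
  do 3 (apply: eq_bigr => ? _); by rewrite ?pc ?pd ?pt ?ptt.
Qed.

End Network.

(** * The common form of both systems: sign and growth on the faces of a box *)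

Section DampedSystem.
Context {R : realType} {J : finType}.
Local Notation hist := (@hist R J).
Variables (a b : J -> R -> R -> R) (N : J -> R -> hist -> R) (beta : J -> R -> R).
Variables (K : J -> R -> (J -> R) -> R) (a_lo a_up : J -> R).
Hypothesis a_cont : forall i, continuous_nonneg2 (a i).
Hypothesis a_lo_gt0 : forall i, 0 < a_lo i.
Hypothesis a_bounds : forall i t v, 0 <= t -> a_lo i <= a i t v <= a_up i.
Hypothesis b_cont : forall i, continuous_nonneg2 (b i).
Hypothesis beta_ge0 : forall i t, 0 <= t -> 0 <= beta i t.
Hypothesis b_mono : forall i t u v, 0 <= t -> v <= u ->
  beta i t * (u - v) <= b i t u - b i t v.
Hypothesis N_cont : forall i, hist_continuous (N i).
Hypothesis N_lip : forall i t phi psi M e, 0 <= t -> hist_cont phi -> hist_cont psi ->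
  hist_bounded M phi -> hist_bounded M psi ->
  (forall j u, u <= 0 -> `|phi j u - psi j u| <= e j) ->
  `|N i t phi - N i t psi| <= K i t e.
Hypothesis K_scale : forall i t e r, K i t (fun j => r * e j) = r * K i t e.
Hypothesis b_bd : forall i u, exists C, forall t, 0 <= t -> `|b i t u| <= C.
Hypothesis N0_bd : forall i, exists C, forall t, 0 <= t -> `|N i t (fun _ _ => 0)| <= C.
Hypothesis K_bd : forall i e, exists C, forall t, 0 <= t -> K i t e <= C.

Lemma past_at0 (x : hist) t i : past x t i 0 = x i t.
Proof. by rewrite /past addr0. Qed.

Definition damped i t (phi : hist) := a i t (phi i 0) * (- b i t (phi i 0) + N i t phi).

Lemma damped_past i t x : damped i t (past x t) =
  a i t (x i t) * (- b i t (x i t) + N i t (past x t)).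
Proof. by rewrite /damped !past_at0. Qed.

Lemma zero_hist_cont : hist_cont ((fun _ _ => 0) : hist).
Proof. by move=> j u; exact: cvg_cst. Qed.

Lemma damping_continuous i : hist_continuous (fun t phi => - b i t (phi i 0) + N i t phi).
Proof.
move=> S FS t phi t0 phi0 M FF t00 H cphi0 bphi0 tt0 hc; apply: cvgD.
  apply: cvgN; apply: nonneg2_cvg => //; first by apply: filterS H => k [].
  rewrite -oppr0; apply: hist_cvg_eval => //; first by apply: (@filterE _ FS).
  exact: cvg_cst.
exact: (N_cont (M := M)).
Qed.

Lemma damped_continuous i : hist_continuous (damped i).
Proof. exact: (system_continuous a_cont damping_continuous). Qed.

Lemma N_dist0 i t phi (e : J -> R) : 0 <= t -> hist_cont phi ->
  (forall j u, u <= 0 -> `|phi j u| <= e j) ->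
  `|N i t phi - N i t (fun _ _ => 0)| <= K i t e.
Proof.
move=> t0 cp pe; have e0 j : 0 <= e j by exact: le_trans (pe j 0 (lexx 0)).
have le_sum j : e j <= \sum_k e k by rewrite (bigD1 j)//= lerDl sumr_ge0.
apply: (@N_lip i t phi (fun _ _ => 0) (\sum_k e k) e t0 cp) => //.
- exact: zero_hist_cont.
- by move=> j u u0; exact: le_trans (pe j u u0) (le_sum j).
- by move=> j u _; rewrite normr0; exact: sumr_ge0.
- by move=> j u u0; rewrite subr0 pe.
Qed.

(** Since [b] is nondecreasing in the state, its values on [- M, M] lie between those at the two
    ends, which are bounded in time. *)
Lemma damping_bound M : exists B, forall i t phi, 0 <= t -> hist_cont phi ->
  hist_bounded M phi -> `|- b i t (phi i 0) + N i t phi| <= B.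
Proof.
apply: (@finite_bound _ _ (fun i B => forall t phi, 0 <= t -> hist_cont phi ->
  hist_bounded M phi -> `|- b i t (phi i 0) + N i t phi| <= B)).
  by move=> i C C' CC h t phi t0 cp bp; exact: le_trans (h t phi t0 cp bp) CC.
move=> i; have [C1 H1] := b_bd i M; have [C2 H2] := b_bd i (- M).
have [C3 H3] := N0_bd i; have [C4 H4] := K_bd i (fun=> M).
exists (C1 + C2 + (C3 + C4)) => t phi t0 cp bp.
have bM : `|b i t (phi i 0)| <= C1 + C2.
  have := bp i 0 (lexx 0); rewrite ler_norml => /andP[l1 l2].
  have h1 := b_mono i t0 l2; have h2 := b_mono i t0 l1.
  have p1 : 0 <= beta i t * (M - phi i 0) by rewrite mulr_ge0 ?beta_ge0// subr_ge0.
  have p2 : 0 <= beta i t * (phi i 0 - - M) by rewrite mulr_ge0 ?beta_ge0// subr_ge0.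
  have := H1 t t0; have := H2 t t0; rewrite !ler_norml => /andP[? ?] /andP[? ?].
  by apply/andP; split; lra.
have NM : `|N i t phi| <= C3 + C4.
  rewrite (le_trans (ler_norm_dist (N_dist0 i t0 cp bp)))//.
  by rewrite lerD ?H3 ?H4.
by rewrite (le_trans (ler_normD _ _))// normrN lerD.
Qed.

Lemma damped_bound M : exists B, forall i t phi, 0 <= t -> hist_cont phi ->
  hist_bounded M phi -> `|damped i t phi| <= B.
Proof. exact: (system_bounded a_lo_gt0 a_bounds (damping_bound M)). Qed.

Section Weights.
Variable w : J -> R.
Hypothesis w_gt0 : forall j, 0 < w j.

(** On a face the damping contributes at least [beta * rho * w i] and the network at most
    [rho * K i t w], up to the values at zero bounded by [C]. The margin [kappa * rho] beats [C],
    and the positive factor [a] keeps the sign. *)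
Lemma damped_sign i t phi rho kappa C : 0 <= t -> hist_cont phi -> 0 <= rho ->
  (forall j u, u <= 0 -> `|phi j u| <= rho * w j) ->
  `|b i t 0| + `|N i t (fun _ _ => 0)| <= C ->
  kappa <= beta i t * w i - K i t w -> C < kappa * rho ->
  (phi i 0 = rho * w i -> damped i t phi < 0) /\
  (phi i 0 = - (rho * w i) -> 0 < damped i t phi).
Proof.
move=> t0 cp rho0 pw bN kap Ck.
have /andP[al _] := a_bounds i (phi i 0) t0.
have a0 := lt_le_trans (a_lo_gt0 i) al.
have rw : 0 <= rho * w i by rewrite mulr_ge0// ltW.
have := N_dist0 i t0 cp pw; rewrite K_scale ler_norml => /andP[n1 n2].
have k2 : kappa * rho <= (beta i t * w i - K i t w) * rho by rewrite ler_wpM2r.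
have [b1 b2] := (ler_norm (b i t 0), ler_norm (- b i t 0)).
have [m1 m2] := (ler_norm (N i t (fun _ _ => 0)), ler_norm (- N i t (fun _ _ => 0))).
rewrite !normrN in b2 m2.
split=> e.
  have h := b_mono i t0 rw; rewrite subr0 in h.
  by rewrite /damped pmulr_rlt0// e; lra.
have rw' : - (rho * w i) <= 0 by rewrite oppr_le0.
have h := b_mono i t0 rw'; rewrite sub0r opprK in h.
by rewrite /damped pmulr_rgt0// e; lra.
Qed.

Lemma zero_bound : exists C, forall i t, 0 <= t ->
  `|b i t 0| + `|N i t (fun _ _ => 0)| <= C.
Proof.
apply: (@finite_bound _ _ (fun i C => forall t, 0 <= t ->
  `|b i t 0| + `|N i t (fun _ _ => 0)| <= C)).
  by move=> i C C' CC h t t0; exact: le_trans (h t t0) CC.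
move=> i; have [C1 H1] := b_bd i 0; have [C2 H2] := N0_bd i.
by exists (C1 + C2) => t t0; rewrite lerD ?H1 ?H2.
Qed.

Lemma damped_dissipative : (exists T kappa, 0 < kappa /\ forall i t, 0 <= t -> T <= t ->
    kappa <= beta i t * w i - K i t w) ->
  exists T rho1, forall j t phi rho, 0 <= t -> T <= t ->
  hist_cont phi -> rho1 <= rho -> (forall i u, u <= 0 -> `|phi i u| <= rho * w i) ->
  (phi j 0 = rho * w j -> damped j t phi < 0) /\
  (phi j 0 = - (rho * w j) -> 0 < damped j t phi).
Proof.
move=> [T [kap [kap0 Hk]]]; have [C HC] := zero_bound.
exists T, (Num.max 0 ((C + 1) / kap)) => j t phi rho t0 Tt cp; rewrite ge_max => /andP[r0 r1] pw.
apply: (damped_sign t0 cp r0 pw (HC j t t0) (Hk j t t0 Tt)).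
by move: r1; rewrite ler_pdivrMr// mulrC => r1; lra.
Qed.

(** Before domination sets in, only [beta >= 0] is available: the damping cannot push outward beyond
    its value at zero, so the growth is linear in [rho]. *)
Lemma damped_growth T : exists C L, forall j t phi rho, 0 <= t -> t <= T ->
  hist_cont phi -> 0 <= rho -> (forall i u, u <= 0 -> `|phi i u| <= rho * w i) ->
  (phi j 0 = rho * w j -> damped j t phi <= C + L * rho) /\
  (phi j 0 = - (rho * w j) -> - (C + L * rho) <= damped j t phi).
Proof.
have [C0 HC0] := zero_bound.
have [L0 HL0] : exists L, forall i t, 0 <= t -> K i t w <= L.
  apply: (@finite_bound _ _ (fun i C => forall t, 0 <= t -> K i t w <= C)).
    by move=> i C C' CC h t t0; exact: le_trans (h t t0) CC.
  by move=> i; exact: K_bd.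
pose C := `|C0|; pose L := `|L0|; pose S := \sum_j a_up j.
have aS i t v : 0 <= t -> 0 < a i t v /\ a i t v <= S.
  move=> t0; have /andP[h1 h2] := a_bounds i v t0; split.
    exact: lt_le_trans h1.
  rewrite (le_trans h2)// /S (bigD1 i)//= lerDl sumr_ge0// => j _.
  by have /andP[h3 h4] := a_bounds j v t0; rewrite ltW// (lt_le_trans (a_lo_gt0 j))// (le_trans h3).
exists (S * C), (S * L) => i t phi rho t0 _ cp rho0 pw.
have [a0 aS'] := aS i t (phi i 0) t0.
have rw : 0 <= rho * w i by rewrite mulr_ge0// ltW.
have C1 : `|b i t 0| + `|N i t (fun _ _ => 0)| <= C.
  exact: le_trans (HC0 i t t0) (ler_norm _).
have L1 : K i t w * rho <= L * rho.
  by rewrite ler_wpM2r// (le_trans (HL0 i t t0))// ler_norm.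
have CL0 : 0 <= C + L * rho by rewrite addr_ge0 ?mulr_ge0 ?normr_ge0.
have := N_dist0 i t0 cp pw; rewrite K_scale ler_norml => /andP[n1 n2].
have [b1 b2] := (ler_norm (b i t 0), ler_norm (- b i t 0)).
have [m1 m2] := (ler_norm (N i t (fun _ _ => 0)), ler_norm (- N i t (fun _ _ => 0))).
rewrite !normrN in b2 m2.
have bw : 0 <= beta i t * (rho * w i) by rewrite mulr_ge0// beta_ge0.
have S_ge : a i t (phi i 0) * (C + L * rho) <= S * C + S * L * rho.
  by rewrite -mulrA -mulrDr ler_wpM2r.
split=> e.
  have h := b_mono i t0 rw; rewrite subr0 in h.
  apply: le_trans S_ge; rewrite /damped ler_pM2l// e; lra.
have rw' : - (rho * w i) <= 0 by rewrite oppr_le0.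
have h := b_mono i t0 rw'; rewrite sub0r opprK in h.
rewrite lerNl; apply: le_trans S_ge; rewrite /damped -mulrN ler_pM2l// e; lra.
Qed.

End Weights.
End DampedSystem.

(** * Transfer between row-vector solutions and coordinate families *)

Section RowSystems.
Context {R : realType} {n : nat}.
Local Notation hist := (@hist R 'I_n).

Lemma row_norm_le (x : 'rV[R]_n) e : 0 <= e -> (forall j, `|x 0 j| <= e) -> `|x| <= e.
Proof.
move=> e0 xe; rewrite [`|x|]mx_normrE; apply: bigmax_le => // -[i j] _ /=.
by rewrite ord1.
Qed.

Lemma ler_coord_norm (x : 'rV[R]_n) j : `|x 0 j| <= `|x|.
Proof.
by rewrite [`|x|]mx_normrE; apply: (le_bigmax_cond _ (fun ij => `|x ij.1 ij.2|) (j := (0, j))).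
Qed.

Lemma row_cvg (S : Type) (FS : set_system S) (x : S -> 'rV[R]_n) (l : 'rV[R]_n) :
  Filter FS -> (forall j, x k 0 j @[k --> FS] --> l 0 j) -> x @ FS --> l.
Proof.
move=> FF xl; apply/cvgrPdist_le => e e0.
have : \forall k \near FS, forall j, `|l 0 j - x k 0 j| <= e.
  apply: (@filter_forall _ _ _ FS) => j.
  by have /cvgrPdist_le/(_ _ e0) := xl j.
by apply: filterS => k h; apply: row_norm_le (ltW e0) _ => j; rewrite !mxE; exact: h.
Qed.

Definition coords (x : R -> 'rV[R]_n) : 'I_n -> R -> R := fun j t => x t 0 j.

Lemma coords_continuous x t : {for t, continuous x} ->
  forall j, {for t, continuous (coords x j)}.
Proof.
move=> cx j; apply: (@continuous_comp _ _ _ x (fun M : 'rV[R]_n => M 0 j)) => //.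
exact: coord_continuous.
Qed.

Variable F : 'I_n -> R -> hist -> R.

Definition row_rhs (x : R -> 'rV[R]_n) t i := F i t (past (coords x) t).

Lemma open_below (T : \bar R) : open [set t : R | (t%:E < T)%E].
Proof.
case: T => [T||].
- by rewrite (_ : mkset _ = `]-oo, T[%classic)//; apply/seteqP; split => t /=;
    rewrite lte_fin in_itv.
- by rewrite (_ : mkset _ = setT); [exact: openT|apply/seteqP; split => t //= _; exact: ltry].
- by rewrite (_ : mkset _ = set0); [exact: open0|apply/seteqP; split].
Qed.

Lemma is_solution_coords t0 T x : is_solution row_rhs t0 T x ->
  [/\ forall j t, (t%:E < T)%E -> {for t, continuous (coords x j)},
      exists2 M, 0 <= M & forall j t, t <= t0 -> `|coords x j t| <= M &
      forall j t, t0 <= t -> (t%:E < T)%E ->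
        has_deriv_within `[t0, +oo[ (coords x j) t (F j t (past (coords x) t))].
Proof.
move=> [t00 t0T cx [M xM] [dx _ Hdx]]; split.
- move=> j t tT; apply: coords_continuous.
  move: cx; rewrite continuous_open_subspace; last exact: open_below.
  by apply; rewrite inE.
- exists `|M| => // j t tt0; apply: le_trans (ler_coord_norm _ _) _.
  exact: le_trans (xM t tt0) (ler_norm M).
move=> j t t0t tT; have [|h1 h2] := Hdx t _ j; first by split.
move: h1; rewrite h2; apply: has_deriv_within_sub.
have : \forall s \near t, (s%:E < T)%E by apply: open_nbhs_nbhs; split => //; exact: open_below.
by apply: filterS => s sT; rewrite /= in_itv/= andbT.
Qed.

Lemma is_solution_row t0 (T : \bar R) (X : 'I_n -> R -> R) M : (forall i, hist_continuous (F i)) ->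
  0 <= t0 -> (t0%:E < T)%E -> (forall j, continuous (X j)) ->
  (forall j t, (t%:E < T)%E -> `|X j t| <= M) ->
  (forall j t, t0 <= t -> (t%:E < T)%E ->
    has_deriv_within `[t0, +oo[ (X j) t (F j t (past X t))) ->
  is_solution row_rhs t0 T (fun t => \row_j X j t).
Proof.
move=> FC t00 t0T cX XM dX.
have cE : coords (fun t => \row_j X j t) = X.
  by apply/funext => j; apply/funext => t; rewrite /coords mxE.
split => //.
- apply: continuous_subspaceT => t; apply: row_cvg => j.
  under eq_cvg do rewrite mxE.
  by rewrite mxE; exact: cX.
- exists `|M| => t tt0; apply: row_norm_le => // j; rewrite mxE.
  by apply: le_trans (XM j t _) (ler_norm M); apply: le_lt_trans t0T; rewrite lee_fin.
move=> D; exists (fun t => \row_j F j t (past X t)).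
  apply/subspace_continuousP => t [t0t tT]; apply: row_cvg => j.
  under eq_cvg do rewrite mxE.
  rewrite mxE; apply: (FC j R (within D (nbhs t)) id (past X) t (past X t) M).
  - exact: le_trans t0t.
  - rewrite /within/=; apply: (@filterE _ (nbhs t)) => s [t0s sT]; split.
    + exact: le_trans t0s.
    + by apply: hist_cont_past => i r _; exact: cX.
    + apply: past_bounded => i r rs; apply: XM; apply: le_lt_trans sT.
      by rewrite lee_fin.
  - by apply: hist_cont_past => i r _; exact: cX.
  - by apply: past_bounded => i r rs; apply: XM; apply: le_lt_trans tT; rewrite lee_fin.
  - exact: cvg_within.
  - apply: hist_cvg_past_cst; last exact: cvg_within.
    by move=> i r _; exact: cX.
move=> t [t0t tT] j; rewrite mxE /row_rhs cE; split => //.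
rewrite (_ : (fun s => _) = X j); last by apply/funext => s; rewrite mxE.
apply: has_deriv_within_sub (dX j t t0t tT).
by apply: (@filterE _ (nbhs t)) => s [t0s _]; rewrite /= in_itv/= andbT.
Qed.

Variable w : 'I_n -> R.
Hypothesis w_gt0 : forall j, 0 < w j.
Hypothesis F_cont : forall i, hist_continuous (F i).
Hypothesis F_bound : forall M, exists B, forall i t phi, 0 <= t -> hist_cont phi ->
  hist_bounded M phi -> `|F i t phi| <= B.
Hypothesis F_growth : forall T, exists C K, forall j t phi rho, 0 <= t -> t <= T ->
  hist_cont phi -> 0 <= rho -> (forall i u, u <= 0 -> `|phi i u| <= rho * w i) ->
  (phi j 0 = rho * w j -> F j t phi <= C + K * rho) /\
  (phi j 0 = - (rho * w j) -> - (C + K * rho) <= F j t phi).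

(** Linear growth forbids blow-up at a finite [T], and a bounded solution can be continued past
    [T]. *)
Lemma noncontinuable_global t0 T x : noncontinuable_solution row_rhs t0 T x -> T = +oo%E.
Proof.
move=> [sx noext]; have [t00 t0T _ _ _] := sx.
have [cx [M0 M00 xM0] dx] := is_solution_coords sx.
case: T => [T||] // in sx noext t0T cx dx *.
rewrite lte_fin in t0T.
have [M HM] : exists M, forall j t, t < T -> `|coords x j t| <= M.
  apply: (solution_bounded_finite w_gt0 F_growth t00 M00 _ xM0) => j t.
    by move=> tT; apply: cx; rewrite lte_fin.
  by move=> t0t tT; apply: dx; rewrite ?lte_fin.
have [B HB] := F_bound (M + 1).
have [||||delta delta0 [y [cy yx dy]]] := @extend_solution R 'I_n F (coords x) t0 T M B F_cont t00 t0T.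
- by move=> j t phi tt0 _; exact: HB.
- by move=> j t tT; apply: cx; rewrite lte_fin.
- exact: HM.
- by move=> j t t0t tT; apply: dx; rewrite ?lte_fin.
(* Stopping halfway leaves a compact interval around [T] on which the continuation is bounded, as
   [is_solution_row] requires. *)
exfalso; apply: noext; exists (T + delta / 2)%:E, (fun t => \row_j y j t).
have d2 : 0 < delta / 2 by rewrite divr_gt0.
have [M' HM'] : exists M', forall j t, T - 1 <= t -> t <= T + delta / 2 -> `|y j t| <= M'.
  apply: (@finite_bound _ _ (fun j C => forall t, T - 1 <= t -> t <= T + delta / 2 ->
    `|y j t| <= C)).
    by move=> j C C' CC h t h1 h2; exact: le_trans (h t h1 h2) CC.
  move=> j; have cy' : {within `[T - 1, T + delta / 2], continuous (fun t => `|y j t|)}.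
    by apply: continuous_subspaceT => t; apply: cvg_norm; exact: cy.
  have [|c _ hc] := EVT_max _ cy'; first by lra.
  by exists `|y j c| => t h1 h2; apply: hc; rewrite in_itv/= h1.
split.
- by rewrite lte_fin ltrDl.
- apply: (@is_solution_row _ _ _ (Num.max M M')) => //.
  + by rewrite lte_fin; lra.
  + move=> j t; rewrite lte_fin => tT; rewrite le_max; have [tT'|Tt] := ltP t T.
      by rewrite yx// HM.
    by rewrite HM' ?orbT//; lra.
  + by move=> j t t0t; rewrite lte_fin => tT; apply: dy => //; lra.
- move=> t; rewrite lte_fin => tT; apply/rowP => j; rewrite mxE; exact: yx.
Qed.

End RowSystems.

(** * Asymptotically periodic damped systems *)

Section Comparison.
Context {R : realType}.

Lemma vanish_bounded (f fh : R -> R) : continuous_nonneg f ->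
  f t - fh t @[t --> +oo] --> (0 : R) -> (exists C, forall t, 0 <= t -> `|fh t| <= C) ->
  exists C, forall t, 0 <= t -> `|f t| <= C.
Proof.
move=> cf /cvgrPdist_le/(_ 1 ltr01) [T [_ HT]] [C HC].
have [C' HC'] := nonneg_bounded T cf.
exists (Num.max C' (C + 1)) => t t0; rewrite le_max.
have [tT|Tt] := leP t T; first by rewrite HC'.
apply/orP; right; have := HT t Tt; rewrite sub0r normrN => h.
have := ler_norm_dist h; have := HC t t0; lra.
Qed.

(** On a period each [f i] attains a positive minimum. The bounds are combined through their
    reciprocals, where [finite_bound] applies. *)
Lemma periodic_gap (I : finType) (f : I -> R -> R) (omega : R) : 0 < omega ->
  (forall i, continuous_nonneg (f i)) -> (forall i, periodic_nonneg omega (f i)) ->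
  (forall i t, 0 <= t -> t <= omega -> 0 < f i t) ->
  exists2 kappa, 0 < kappa & forall i t, 0 <= t -> kappa <= f i t.
Proof.
move=> o0 cf pf fpos.
have f0 i t : 0 <= t -> 0 < f i t.
  move=> t0; have [r [m [-> r0 ro]]] := period_decomposition o0 t0.
  by rewrite (periodic_iter (ltW o0) (@pf i))// fpos.
have [C HC] : exists C, forall i t, 0 <= t -> 1 <= C * f i t.
  apply: (@finite_bound _ _ (fun i C => forall t, 0 <= t -> 1 <= C * f i t)).
    by move=> i C C' CC h t t0; apply: le_trans (h t t0) _; rewrite ler_wpM2r// ltW ?f0.
  move=> i; have cf' : {within `[0, omega], continuous (f i)}.
    by apply: continuous_subspaceW (@cf i) => t /=; rewrite !in_itv/= => /andP[->].
  have [c] := EVT_min (ltW o0) cf'; rewrite in_itv/= => /andP[c0 _] hc.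
  exists (f i c)^-1 => t t0; rewrite mulrC ler_pdivlMr ?f0// mul1r.
  have [r [m [-> r0 ro]]] := period_decomposition o0 t0.
  by rewrite (periodic_iter (ltW o0) (@pf i))// hc// in_itv/= r0.
have C1 : 0 < `|C| + 1 by rewrite ltr_wpDl.
exists (`|C| + 1)^-1 => [|i t t0]; first by rewrite invr_gt0.
rewrite -[_^-1]mul1r ler_pdivrMr// (le_trans (HC i t t0))// mulrC ler_wpM2l//.
  by rewrite ltW// f0.
by rewrite (le_trans (ler_norm C))// lerDl.
Qed.

(** Both numbers are the right derivative at [t]. *)
Lemma has_deriv_within_unique (D : set R) (f g : R -> R) (t l l' : R) :
  (forall s, t <= s -> D s) -> (forall s, t <= s -> f s = g s) ->
  has_deriv_within D f t l -> has_deriv_within D g t l' -> l = l'.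
Proof.
move=> tD fg hf hg.
have right k m : has_deriv_within D k t m -> (k s - k t) / (s - t) @[s --> t^'+] --> m.
  move=> hk; apply: cvg_trans hk; apply: cvg_app => A; rewrite /within/= => nA.
  have {}nA : \forall s \near t, s != t -> D s -> A s by exact: nA.
  have : \forall s \near t, t < s -> A s.
    apply: filterS nA => s h ts; apply: h; last exact/tD/ltW.
    by rewrite gt_eqF.
  exact.
have := right _ _ hg; apply: (@cvg_unique _ (@Rhausdorff R)).
apply: cvg_trans (right _ _ hf); apply: near_eq_cvg.
by rewrite /at_right/within/=; apply: (@filterE _ (nbhs t)) => s ts; rewrite !fg// ltW.
Qed.

Context {n : nat}.
Local Notation hist := (@hist R 'I_n).
Variables (a b bh : 'I_n -> R -> R -> R) (N Nh : 'I_n -> R -> hist -> R).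
Variables (beta betah A : 'I_n -> R -> R) (K Kh : 'I_n -> R -> ('I_n -> R) -> R).
Variables (a_lo a_up : 'I_n -> R) (dta : 'I_n -> R -> R -> R).
Variables (omega kappa : R) (v w : 'I_n -> R).
Hypothesis omega_gt0 : 0 < omega.
Hypothesis a_cont : forall i, continuous_nonneg2 (a i).
Hypothesis a_lo_gt0 : forall i, 0 < a_lo i.
Hypothesis a_bounds : forall i t v, 0 <= t -> a_lo i <= a i t v <= a_up i.
Hypothesis a_per : forall i u, periodic_nonneg omega (fun t => a i t u).
Hypothesis dtaP : forall i t v, 0 <= t ->
  has_deriv_within `[0, +oo[ (fun s => a i s v) t (dta i t v).
Hypothesis dta_lb : forall i t v, 0 <= t -> A i t * a i t v ^+ 2 <= dta i t v.
Hypotheses (b_cont : forall i, continuous_nonneg2 (b i))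
  (bh_cont : forall i, continuous_nonneg2 (bh i)).
Hypothesis bh_per : forall i u, periodic_nonneg omega (fun t => bh i t u).
Hypotheses (beta_ge0 : forall i t, 0 <= t -> 0 <= beta i t)
  (betah_ge0 : forall i t, 0 <= t -> 0 <= betah i t).
Hypothesis betah_bd : exists B, forall i t, 0 <= t -> betah i t <= B.
Hypothesis b_mono : forall i t u v, 0 <= t -> v <= u ->
  beta i t * (u - v) <= b i t u - b i t v.
Hypothesis bh_mono : forall i t u v, 0 <= t -> v <= u ->
  betah i t * (u - v) <= bh i t u - bh i t v.
Hypotheses (N_cont : forall i, hist_continuous (N i))
  (Nh_cont : forall i, hist_continuous (Nh i)).
Hypothesis Nh_per : forall i phi, periodic_nonneg omega (fun t => Nh i t phi).
Hypothesis N_lip : forall i t phi psi M e, 0 <= t -> hist_cont phi -> hist_cont psi ->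
  hist_bounded M phi -> hist_bounded M psi ->
  (forall j u, u <= 0 -> `|phi j u - psi j u| <= e j) ->
  `|N i t phi - N i t psi| <= K i t e.
Hypothesis Nh_lip : forall i t phi psi M e, 0 <= t -> hist_cont phi -> hist_cont psi ->
  hist_bounded M phi -> hist_bounded M psi ->
  (forall j u, u <= 0 -> `|phi j u - psi j u| <= e j) ->
  `|Nh i t phi - Nh i t psi| <= Kh i t e.
Hypothesis Kh_ge0 : forall i t e, (forall j, 0 <= e j) -> 0 <= Kh i t e.
Hypothesis K_scale : forall i t e r, K i t (fun j => r * e j) = r * K i t e.
Hypothesis Kh_scale : forall i t e r, Kh i t (fun j => r * e j) = r * Kh i t e.
Hypothesis K_cont : forall i e, continuous_nonneg (fun t => K i t e).
Hypothesis Kh_bd : forall i e, exists C, forall t, 0 <= t -> `|Kh i t e| <= C.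
Hypothesis v_gt0 : forall i, 0 < v i.
Hypothesis stab : forall i t, 0 <= t ->
  - (betah i t + A i t) * a_lo i * v i + Kh i t (fun j => a_up j * v j) < 0.
Hypothesis w_gt0 : forall i, 0 < w i.
Hypothesis kappa_gt0 : 0 < kappa.
Hypothesis dom : forall i t, 0 <= t -> kappa <= betah i t * w i - Kh i t w.
Hypothesis beta_lim : forall i, vanishes_at_infty (fun t => beta i t - betah i t).
Hypothesis b_lim : forall i (u : R -> R), continuous u -> (exists M, forall t, `|u t| <= M) ->
  vanishes_at_infty (fun t => b i t (u t) - bh i t (u t)).
Hypothesis K_lim : forall i e, vanishes_at_infty (fun t => K i t e - Kh i t e).
Hypothesis N_lim : forall i (x : 'I_n -> R -> R) M T B, 0 <= T -> (forall j, continuous (x j)) ->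
  (forall j t, `|x j t| <= M) ->
  (forall j r s, T <= r -> T <= s -> `|x j s - x j r| <= B * `|s - r|) ->
  vanishes_at_infty (fun t => N i t (past x t) - Nh i t (past x t)).

Lemma nonneg2_continuous (f : R -> R -> R) u : continuous_nonneg2 f ->
  continuous_nonneg (fun t => f t u).
Proof.
move=> cf; apply/subspace_continuousP => t; rewrite /= in_itv/= andbT => t0.
apply: (@nonneg2_cvg _ f _ _ id (fun=> u)) => //.
- by rewrite /within/=; apply: (@filterE _ (nbhs t)) => s; rewrite in_itv/= andbT.
- exact: cvg_within.
- exact: cvg_cst.
Qed.

Let c0 F : hist_continuous F -> continuous_nonneg (fun t => F t ((fun _ _ => 0) : hist)).
Proof.
move=> cF; apply: (hist_continuous_nonneg (M := 0) cF); first exact: zero_hist_cont.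
by move=> j u _; rewrite normr0.
Qed.

Let bh_bd i u : exists C, forall t, 0 <= t -> `|bh i t u| <= C.
Proof.
exact: nonneg_periodic_bounded omega_gt0 (@nonneg2_continuous _ u (@bh_cont i)) (@bh_per i u).
Qed.

Let Nh0_bd i : exists C, forall t, 0 <= t -> `|Nh i t (fun _ _ => 0)| <= C.
Proof. exact: nonneg_periodic_bounded omega_gt0 (c0 (@Nh_cont i)) (@Nh_per i _). Qed.

Let Kh_ubd i e : exists C, forall t, 0 <= t -> Kh i t e <= C.
Proof.
have [C HC] := Kh_bd i e.
by exists C => t t0; apply: le_trans (ler_norm _) (HC t t0).
Qed.

Let g i t (phi : hist) := - bh i t (phi i 0) + Nh i t phi.

Let g_bd M : exists B, forall i t phi, 0 <= t -> hist_cont phi ->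
  hist_bounded M phi -> `|g i t phi| <= B.
Proof. exact: (damping_bound betah_ge0 bh_mono Nh_lip bh_bd Nh0_bd Kh_ubd). Qed.

Let g_per i t phi : 0 <= t -> g i (t + omega) phi = g i t phi.
Proof. by move=> t0; rewrite /g bh_per// Nh_per. Qed.

Let g_cont i : hist_continuous (g i).
Proof. exact: (damping_continuous bh_cont Nh_cont). Qed.

Lemma periodic_damped_stability M tx ty x y ex ey :
  perturbed_solution a g M tx x ex -> perturbed_solution a g M ty y ey ->
  forall j, x j t - y j t @[t --> +oo] --> (0 : R).
Proof.
apply: (perturbed_solutions_asymptotic omega_gt0 v_gt0 a_cont a_lo_gt0 a_bounds _ dtaP dta_lb g_cont g_per
  (g_bd M) _ betah_bd Kh_ge0 Kh_scale stab).
  by move=> i u t; exact: a_per.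
move=> i t phi psi e t0 cp cs bp bs pe le0.
have h1 := bh_mono i t0 le0.
have := Nh_lip i t0 cp cs bp bs pe; rewrite ler_norml => /andP[_ h2].
by rewrite /g; lra.
Qed.

(* [X] is the limit along a free ultrafilter of the translates of a bounded
   solution [z] by multiples of the period; it is periodic because stability,
   applied to [z] and its translate, gives [z (t + omega) - z t --> 0]. *)
Lemma periodic_damped_existence : exists M X, [/\ forall j, continuous (X j),
  forall j t, `|X j t| <= M, forall j t, X j (t + omega) = X j t &
  forall j t, 0 <= t ->
    has_deriv_within `[0, +oo[ (X j) t (damped a bh Nh j t (past X t))].
Proof.
have [C HC] := zero_bound bh_bd Nh0_bd.
(* The radius at which the margin [kappa * rho] exceeds [C], the bound on the values at zero, so the
   box with sides [rho * w j] is invariant. *)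
pose rho := (`|C| + 1) / kappa.
have rho0 : 0 <= rho by rewrite divr_ge0 ?addr_ge0// ltW.
have Crho : C < kappa * rho.
  by rewrite mulrC divfK ?gt_eqF// (le_lt_trans (ler_norm C))// ltrDl.
pose M := \sum_j rho * w j.
have wM j : rho * w j <= M.
  by rewrite /M (bigD1 j)//= lerDl sumr_ge0// => k _; rewrite mulr_ge0// ltW.
have FC i : hist_continuous (damped a bh Nh i).
  exact: (@damped_continuous _ _ a bh Nh).
have FP i t phi : 0 <= t -> damped a bh Nh i (t + omega) phi = damped a bh Nh i t phi.
  by move=> t0; rewrite /damped a_per// bh_per// Nh_per.
have FB M' := damped_bound a_lo_gt0 a_bounds betah_ge0 bh_mono Nh_lip bh_bd Nh0_bd Kh_ubd M'.
have [B HB] := FB M.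
have [||z [cz zM dz]] := @bounded_solution _ _ (damped a bh Nh) (fun j => rho * w j) B FC.
  by move=> j; rewrite mulr_ge0// ltW.
  move=> j t phi t0 cp pw.
  have sgn := damped_sign a_lo_gt0 a_bounds bh_mono Nh_lip Kh_scale w_gt0 t0 cp rho0 pw
    (HC j t t0) (dom j t0) Crho.
  split.
  - by apply: HB => // i u u0; exact: le_trans (pw i u u0) (wM i).
  - exact: sgn.1.
  - exact: sgn.2.
have {}zM j t : `|z j t| <= M by exact: le_trans (zM j t) (wM j).
have zero_lim : 'I_n -> (0 : R) @[_ --> pinfty_nbhs R] --> (0 : R) by move=> j; exact: cvg_cst.
have solz : perturbed_solution a g M 0 z (fun _ _ => 0).
  split => // j t t0.
  rewrite /= addr0 /g past_at0.
  by have := dz j t t0; rewrite damped_past.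
have solz' : perturbed_solution a g M 0 (fun j t => z j (omega + t)) (fun _ _ => 0).
  split => // [j t|j t t0]; last first.
  - rewrite /= addr0 /g past_at0.
    apply: (@has_deriv_within_shift _ `[0, +oo[).
      apply: (@filterE _ (nbhs t)) => r; rewrite /= !in_itv/= !andbT => r0.
      by rewrite addr_ge0// ltW.
    have E : damped a bh Nh j (omega + t) (past z (omega + t)) =
        damped a bh Nh j t (past (fun j t => z j (omega + t)) t).
      rewrite [X in damped _ _ _ _ X]addrC FP//; congr damped.
      by apply/funext => i; apply/funext => u; rewrite /past addrA.
    have := dz j (omega + t); rewrite E damped_past; apply.
    by rewrite addr_ge0// ltW.
  apply: (@continuous_comp R R R (fun t : R => omega + t) (z j) t).
    by apply: cvgD; [exact: cvg_cst|exact: cvg_id].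
  exact: cz.
have zz' := periodic_damped_stability solz' solz.
have [U UU Uoo] := free_ultrafilter.
have PU : ProperFilter U by exact: ultra_proper.
pose tk k : R := k%:R * omega.
have tkU C' : \forall k \near U, C' <= tk k.
  apply: Uoo; near=> k; rewrite /tk -ler_pdivrMr//.
  by near: k; exact: nbhs_infty_ger.
have [||||X [cX XM cc dX]] := @translate_limit R _ (damped a bh Nh) omega M omega_gt0 FC FP (FB M)
  z (fun _ _ => 0) 0 (lexx 0) cz zM zero_lim _ U tk (fun=> 0) id 0 UU tkU => //.
- by move=> j t t0; rewrite addr0; exact: dz.
- by move=> k; rewrite add0r.
- by move=> _; rewrite lexx ltW.
- exact: cvg_cst.
have Xl j s : z j (tk k + s) @[k --> U] --> X j s.
  exact: (cvg_cont_pointwise PU (cc j s)).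
exists M, X; split => //; last first.
  move=> j t t0; have := dX j t 0 0%N; rewrite !mul0r !add0r; exact.
move=> j s; apply/eqP; rewrite -subr_eq0; apply/eqP.
have h1 : z j (tk k + (s + omega)) - z j (tk k + s) @[k --> U] --> X j (s + omega) - X j s.
  by apply: cvgB; exact: Xl.
have tks : tk k + s @[k --> U] --> +oo.
  apply/cvgryPge => y; apply: filterS (tkU (y - s)) => k; lra.
(* Along these times the difference of [z] over one period tends to 0 by stability, and to the
   corresponding difference of [X] by construction. *)
have := cvg_comp (fun k => tk k + s) _ tks (zz' j).
have -> : ((fun t => z j (omega + t) - z j t) \o (fun k => tk k + s)) =
    (fun k => z j (tk k + (s + omega)) - z j (tk k + s)).
  by apply/funext => k /=; congr (z j _ - _); ring.
move=> h2; exact: (@cvg_unique _ (@Rhausdorff R) _ _ _ _ h1 h2).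
Unshelve. all: by end_near. Qed.

(** Inherited from the periodic [bh] by applying (vii) to a constant function. *)
Let b_bd i u : exists C, forall t, 0 <= t -> `|b i t u| <= C.
Proof.
apply: (@vanish_bounded _ (fun t => bh i t u) (@nonneg2_continuous _ u (@b_cont i))).
- apply: (@b_lim i (fun=> u)); last by exists `|u|.
  by move=> t; exact: cvg_cst.
- exact: bh_bd.
Qed.

Let N0_bd i : exists C, forall t, 0 <= t -> `|N i t (fun _ _ => 0)| <= C.
Proof.
apply: (@vanish_bounded _ (fun t => Nh i t (fun _ _ => 0)) (c0 (@N_cont i))).
- apply: (@N_lim i (fun _ _ => 0) 0 0 0) => //.
  + by move=> j t; exact: cvg_cst.
  + by move=> j t; rewrite normr0.
  + by move=> j r s _ _; rewrite subrr normr0 mul0r.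
- exact: Nh0_bd.
Qed.

Let K_bd i e : exists C, forall t, 0 <= t -> K i t e <= C.
Proof.
have [C HC] := vanish_bounded (@K_cont i e) (@K_lim i e) (Kh_bd i e).
by exists C => t t0; apply: le_trans (ler_norm _) (HC t t0).
Qed.

(** The uniform margin of the periodic system loses at most half of itself once the perturbation is
    small. *)
Let K_dom : exists T kappa, 0 < kappa /\ forall i t, 0 <= t -> T <= t ->
  kappa <= beta i t * w i - K i t w.
Proof.
have k2 : 0 < kappa / 2 by rewrite divr_gt0.
have [T [_ HT]] : \forall t \near +oo, forall i,
    `|(beta i t - betah i t) * w i - (K i t w - Kh i t w)| <= kappa / 2.
  apply: (@filter_forall _ _ _ (pinfty_nbhs R)) => i.
  have /cvgrPdist_le/(_ _ k2) : (beta i t - betah i t) * w i - (K i t w - Kh i t w)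
      @[t --> +oo] --> (0 : R).
    have := cvgB (cvgM (@beta_lim i) (cvg_cst (w i))) (@K_lim i w).
    by rewrite mul0r subr0; exact.
  by apply: filterS => t; rewrite sub0r normrN.
exists (T + 1), (kappa / 2); split => // i t t0 Tt.
have {}Tt : T < t by rewrite (lt_le_trans _ Tt)// ltrDl.
have := HT t Tt i; rewrite ler_norml => /andP[h _].
by have := dom i t0; lra.
Qed.

Lemma damped_attractivity : exists2 xh : R -> 'rV[R]_n,
  periodic_solution (row_rhs (damped a bh Nh)) omega xh &
  forall t0 T x, noncontinuable_solution (row_rhs (damped a b N)) t0 T x ->
    T = +oo%E /\ `|x t - xh t| @[t --> +oo] --> (0 : R).
Proof.
have [M [X [cX XM pX dX]]] := periodic_damped_existence.
exists (fun t => \row_j X j t).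
  split; first by move=> t; apply/rowP => j; rewrite !mxE.
  apply: (@is_solution_row _ _ _ _ _ _ M) => //.
    by move=> i; exact: (@damped_continuous _ _ a bh Nh).
    exact: ltry.
  by move=> j t t0 _; exact: dX.
have FC i : hist_continuous (damped a b N i) by exact: damped_continuous.
have FB M' := damped_bound a_lo_gt0 a_bounds beta_ge0 b_mono N_lip b_bd N0_bd K_bd M'.
have FG := damped_growth a_lo_gt0 a_bounds beta_ge0 b_mono N_lip K_scale b_bd N0_bd K_bd w_gt0.
move=> t0 T x nx; have T_oo := noncontinuable_global w_gt0 FC FB FG nx.
split => //; move: nx => [sx _]; rewrite T_oo in sx.
have [t00 _ _ _ _] := sx.
have [cx [M0 M00 xM0] dx] := is_solution_coords sx.
have {}cx j : continuous (coords x j) by move=> t; apply: cx; exact: ltry.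
have {}dx j t : t0 <= t ->
    has_deriv_within `[t0, +oo[ (coords x j) t (damped a b N j t (past (coords x) t)).
  by move=> t0t; apply: dx => //; exact: ltry.
have FD := damped_dissipative a_lo_gt0 a_bounds b_mono N_lip K_scale b_bd N0_bd w_gt0 K_dom.
have [M1 xM] := solution_bounded w_gt0 FG FD t00 M00 cx xM0 dx.
have [T1 [B [tT1 B0 xB]]] : exists T1 B, [/\ t0 <= T1, 0 <= B & forall j r s,
    T1 <= r -> T1 <= s -> `|coords x j s - coords x j r| <= B * `|s - r|].
  apply: (@solution_lipschitz _ _ (damped a b N) M1 (FB M1) _ (fun _ _ => 0)) => //.
  - by move=> j; exact: cvg_cst.
  - by move=> j t t0t; rewrite addr0; exact: dx.
(* The difference of the two brackets along [x]. Boundedness of [x] and its eventual Lipschitz bound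
   are what make it vanish at infinity. *)
pose ex i t := - (b i t (coords x i t) - bh i t (coords x i t)) +
  (N i t (past (coords x) t) - Nh i t (past (coords x) t)).
(* A common bound is needed because the base point of [Psi] depends on it. *)
pose M2 := Num.max M M1.
have px : perturbed_solution a g M2 t0 (coords x) ex.
  split => //.
  - by move=> j t; rewrite le_max xM orbT.
  - move=> j; rewrite -[X in _ --> X]addr0; apply: cvgD.
      by rewrite -oppr0; apply: cvgN; apply: b_lim => //; exists M1.
    exact: (@N_lim j (coords x) M1 T1 B (le_trans t00 tT1) cx xM xB).
  - move=> j t t0t; have := dx j t t0t; rewrite damped_past /g past_at0 /ex.
    rewrite (_ : - bh _ _ _ + _ + _ = - b j t (coords x j t) + N j t (past (coords x) t)) //.
    by ring.
have pX' : perturbed_solution a g M2 0 X (fun _ _ => 0).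
  split => //.
  - by move=> j t; rewrite le_max XM.
  - by move=> j; exact: cvg_cst.
  - by move=> j t t0t; rewrite addr0 /g past_at0; have := dX j t t0t; rewrite damped_past.
have := periodic_damped_stability px pX'.
move=> xX; rewrite -(@normr0 _ 'rV[R]_n); apply: cvg_norm.
apply: row_cvg => j; rewrite mxE.
by apply: cvg_trans (xX j); apply: near_eq_cvg; apply: (@filterE _ (pinfty_nbhs R)) => t;
  rewrite !mxE.
Qed.

End Comparison.

(** * Extension of the hypotheses from one period to the half-line *)

Section PeriodExtension.
Context {R : realType}.

Lemma nonneg_cvg_within (f : R -> R) (t : R) : continuous_nonneg f -> 0 <= t ->
  f s @[s --> within `[0, +oo[ (nbhs t)] --> f t.
Proof. by move=> /subspace_continuousP cf t0; apply: cf; rewrite /= in_itv/= t0. Qed.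

Lemma ratio_mono (f : R -> R) (k u v : R) :
  (u != v -> k <= (f u - f v) / (u - v)) -> v <= u -> k * (u - v) <= f u - f v.
Proof.
move=> kf; rewrite le_eqVlt => /orP[/eqP -> |vu]; first by rewrite !subrr mulr0.
by rewrite -ler_pdivlMr ?subr_gt0// kf// gt_eqF.
Qed.

(** Periodicity of the derivative is deduced from that of [f]. Right derivatives are compared since
    at [r = 0] no other is available. *)
Lemma periodic_derivative (f df : R -> R) (omega : R) (m : nat) r : 0 <= omega ->
  periodic_nonneg omega f ->
  (forall t, 0 <= t -> has_deriv_within `[0, +oo[ f t (df t)) -> 0 <= r ->
  df (r + m%:R * omega) = df r.
Proof.
move=> o0 pf dfP r0; have mo : 0 <= m%:R * omega by rewrite mulr_ge0.
have D0 s : r <= s -> `[0, +oo[%classic s.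
  by move=> rs; rewrite /= in_itv/= andbT (le_trans r0).
apply: (has_deriv_within_unique (f := fun s => f (m%:R * omega + s)) (g := f) D0 _ _ (dfP r r0)).
  by move=> s /D0/=; rewrite in_itv/= andbT => s0; rewrite addrC (periodic_iter o0 pf).
rewrite addrC; apply: (@has_deriv_within_shift _ `[0, +oo[).
  by apply: (@filterE _ (nbhs r)) => s; rewrite /= !in_itv/= !andbT => s0; rewrite addr_ge0.
by apply: dfP; rewrite addr_ge0.
Qed.

End PeriodExtension.

Unset Implicit Arguments.

Theorem corollary4p5 (R : realType) (n P Q : nat)
  (a b bh : 'I_n -> R -> R -> R)
  (c ch : 'I_n -> 'I_n -> 'I_n -> 'I_P -> R -> R)
  (d dh : 'I_n -> 'I_n -> 'I_n -> 'I_Q -> R -> R)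
  (I Ih : 'I_n -> R -> R)
  (tau ttau tauh ttauh : 'I_n -> 'I_n -> 'I_P -> R -> R)
  (G H : 'I_n -> R -> R)
  (h : 'I_n -> 'I_n -> 'I_n -> 'I_P -> R -> R -> R)
  (f : 'I_n -> 'I_n -> 'I_n -> 'I_Q -> R -> R -> R)
  (g tg eta teta : 'I_n -> 'I_n -> 'I_Q -> R -> R)
  (* standing assumptions on the data *)
  (a_cont : forall i, continuous_nonneg2 (a i))
  (a_gt0 : forall i t u, 0 <= t -> 0 < a i t u)
  (b_cont : forall i, continuous_nonneg2 (b i))
  (bh_cont : forall i, continuous_nonneg2 (bh i))
  (c_cont : forall i j l p, continuous_nonneg (c i j l p))
  (ch_cont : forall i j l p, continuous_nonneg (ch i j l p))
  (d_cont : forall i j l q, continuous_nonneg (d i j l q))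
  (dh_cont : forall i j l q, continuous_nonneg (dh i j l q))
  (I_cont : forall i, continuous_nonneg (I i))
  (Ih_cont : forall i, continuous_nonneg (Ih i))
  (tau_cont : forall i j p, continuous_nonneg (tau i j p))
  (ttau_cont : forall i l p, continuous_nonneg (ttau i l p))
  (tauh_cont : forall i j p, continuous_nonneg (tauh i j p))
  (ttauh_cont : forall i l p, continuous_nonneg (ttauh i l p))
  (tau_ge0 : forall i j p t, 0 <= t -> 0 <= tau i j p t)
  (ttau_ge0 : forall i l p t, 0 <= t -> 0 <= ttau i l p t)
  (tauh_ge0 : forall i j p t, 0 <= t -> 0 <= tauh i j p t)
  (ttauh_ge0 : forall i l p t, 0 <= t -> 0 <= ttauh i l p t)
  (G_cont : forall i, continuous (G i))
  (H_cont : forall i, continuous (H i))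
  (h_cont : forall i j l p, continuous (fun z : R * R => h i j l p z.1 z.2))
  (f_cont : forall i j l q, continuous (fun z : R * R => f i j l q z.1 z.2))
  (g_cont : forall i j q, continuous (g i j q))
  (tg_cont : forall i l q, continuous (tg i l q))
  (eta_weight : forall i j q, stieltjes_weight (eta i j q))
  (teta_weight : forall i l q, stieltjes_weight (teta i l q))
  (* (i) *)
  (beta : 'I_n -> R -> R)
  (beta_cont : forall i, continuous_nonneg (beta i))
  (beta_ge0 : forall i t, 0 <= t -> 0 <= beta i t)
  (b_mono : forall i t u v, 0 <= t -> u != v ->
     beta i t <= (b i t u - b i t v) / (u - v))
  (* (ii) *)
  (a_lo a_up : 'I_n -> R) (A : 'I_n -> R -> R) (dta : 'I_n -> R -> R -> R)
  (dtaP : forall i t v, 0 <= t ->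
     has_deriv_within `[0, +oo[ (fun s => a i s v) t (dta i t v))
  (a_lo_gt0 : forall i, 0 < a_lo i)
  (a_up_gt0 : forall i, 0 < a_up i)
  (a_bounds : forall i t v, 0 <= t -> a_lo i <= a i t v <= a_up i)
  (dta_lb : forall i t v, 0 <= t -> A i t * a i t v ^+ 2 <= dta i t v)
  (* (iii) *)
  (gam1 gam2 : 'I_n -> 'I_n -> 'I_n -> 'I_P -> R)
  (mu1 mu2 : 'I_n -> 'I_n -> 'I_n -> 'I_Q -> R)
  (xi txi : 'I_n -> 'I_n -> 'I_Q -> R)
  (zeta sigma : 'I_n -> R)
  (gam1_gt0 : forall i j l p, 0 < gam1 i j l p)
  (gam2_gt0 : forall i j l p, 0 < gam2 i j l p)
  (mu1_gt0 : forall i j l q, 0 < mu1 i j l q)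
  (mu2_gt0 : forall i j l q, 0 < mu2 i j l q)
  (xi_gt0 : forall i j q, 0 < xi i j q)
  (txi_gt0 : forall i l q, 0 < txi i l q)
  (zeta_gt0 : forall i, 0 < zeta i)
  (sigma_gt0 : forall i, 0 < sigma i)
  (h_lip : forall i j l p u1 u2 v1 v2,
     `|h i j l p u1 u2 - h i j l p v1 v2|
       <= gam1 i j l p * `|u1 - v1| + gam2 i j l p * `|u2 - v2|)
  (f_lip : forall i j l q u1 u2 v1 v2,
     `|f i j l q u1 u2 - f i j l q v1 v2|
       <= mu1 i j l q * `|u1 - v1| + mu2 i j l q * `|u2 - v2|)
  (g_lip : forall i j q u v, `|g i j q u - g i j q v| <= xi i j q * `|u - v|)
  (tg_lip : forall i l q u v,
     `|tg i l q u - tg i l q v| <= txi i l q * `|u - v|)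
  (G_lip : forall i u v, `|G i u - G i v| <= zeta i * `|u - v|)
  (H_lip : forall i u v, `|H i u - H i v| <= sigma i * `|u - v|)
  (* (iv) *)
  (omega : R) (omega_gt0 : 0 < omega)
  (a_per : forall i u, periodic_nonneg omega (fun t => a i t u))
  (bh_per : forall i u, periodic_nonneg omega (fun t => bh i t u))
  (ch_per : forall i j l p, periodic_nonneg omega (ch i j l p))
  (dh_per : forall i j l q, periodic_nonneg omega (dh i j l q))
  (tauh_per : forall i j p, periodic_nonneg omega (tauh i j p))
  (ttauh_per : forall i l p, periodic_nonneg omega (ttauh i l p))
  (Ih_per : forall i, periodic_nonneg omega (Ih i))
  (* (v) *)
  (betah betahs : 'I_n -> R -> R)
  (betah_cont : forall i, continuous_nonneg (betah i))
  (betahs_cont : forall i, continuous_nonneg (betahs i))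
  (betah_gt0 : forall i t, 0 <= t -> 0 < betah i t)
  (betahs_gt0 : forall i t, 0 <= t -> 0 < betahs i t)
  (betah_per : forall i, periodic_nonneg omega (betah i))
  (betahs_per : forall i, periodic_nonneg omega (betahs i))
  (bh_mono : forall i t u v, 0 <= t <= omega -> u != v ->
     betah i t <= (bh i t u - bh i t v) / (u - v) <= betahs i t)
  (* (vi) *)
  (betah_dom : exists2 w : 'I_n -> R, (forall i, 0 < w i) &
     forall t i, 0 <= t <= omega ->
       \sum_(j < n) \sum_(l < n)
         (\sum_(p < P) zeta i * `|ch i j l p t| *
            (w j / w i * gam1 i j l p + w l / w i * gam2 i j l p)
          + \sum_(q < Q) sigma i * `|dh i j l q t| *
              (w j / w i * mu1 i j l q * xi i j q
               + w l / w i * mu2 i j l q * txi i l q))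
       < betah i t)
  (* (vii) *)
  (beta_lim : forall i, vanishes_at_infty (fun t => beta i t - betah i t))
  (b_lim : forall i (w : R -> R), continuous w ->
     (exists M, forall t, `|w t| <= M) ->
     vanishes_at_infty (fun t => b i t (w t) - bh i t (w t)))
  (c_lim : forall i j l p,
     vanishes_at_infty (fun t => c i j l p t - ch i j l p t))
  (d_lim : forall i j l q,
     vanishes_at_infty (fun t => d i j l q t - dh i j l q t))
  (tau_lim : forall i j p,
     vanishes_at_infty (fun t => tau i j p t - tauh i j p t))
  (ttau_lim : forall i l p,
     vanishes_at_infty (fun t => ttau i l p t - ttauh i l p t))
  (I_lim : forall i, vanishes_at_infty (fun t => I i t - Ih i t))
  (* (viii) *)
  (stability : exists2 w : 'I_n -> R, (forall i, 0 < w i) &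
     forall t i, 0 <= t <= omega ->
       - (betah i t + A i t) * a_lo i
       + \sum_(j < n) \sum_(l < n)
           (\sum_(p < P) zeta i * `|ch i j l p t| *
              (gam1 i j l p * a_up j * (w j / w i)
               + gam2 i j l p * a_up l * (w l / w i))
            + \sum_(q < Q) sigma i * `|dh i j l q t| *
                (mu1 i j l q * xi i j q * a_up j * (w j / w i)
                 + mu2 i j l q * txi i l q * a_up l * (w l / w i)))
       < 0) :
  exists2 xh : R -> 'rV[R]_n,
    periodic_solution
      (network_rhs a bh ch dh tauh ttauh Ih G H h f g tg eta teta) omega xh &
    forall (t0 : R) (tstar : \bar R) (x : R -> 'rV[R]_n),
      noncontinuable_solution
        (network_rhs a b c d tau ttau I G H h f g tg eta teta) t0 tstar x ->
      tstar = +oo%E /\ `|x t - xh t| @[t --> +oo] --> (0 : R).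
Proof.
pose N := net G H h f g tg eta teta c d tau ttau I.
pose Nh := net G H h f g tg eta teta ch dh tauh ttauh Ih.
pose K := gain gam1 gam2 mu1 mu2 xi txi zeta sigma c d.
pose Kh := gain gam1 gam2 mu1 mu2 xi txi zeta sigma ch dh.
have rhsE b0 c0 d0 tau0 ttau0 I0 :
    network_rhs a b0 c0 d0 tau0 ttau0 I0 G H h f g tg eta teta =
    row_rhs (damped a b0 (net G H h f g tg eta teta c0 d0 tau0 ttau0 I0)).
  apply/funext => x; apply/funext => t; apply/funext => i.
  by rewrite /row_rhs damped_past /network_rhs /net !addrA.
rewrite !rhsE.
have [v v_gt0 Hv] := stability; have [w w_gt0 Hw] := betah_dom.
have o0 := ltW omega_gt0.
have Kh_per i e : periodic_nonneg omega (fun t => Kh i t e) by exact: gain_periodic.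
have Kh_cont i e : continuous_nonneg (fun t => Kh i t e) by exact: gain_continuous.
(* Compactness of a period turns the strict inequality (vi) into a margin uniform in time. *)
have [kappa kappa_gt0 dom] : exists2 kappa, 0 < kappa & forall i t, 0 <= t ->
    kappa <= betah i t * w i - Kh i t w.
  apply: (periodic_gap (f := fun i t => betah i t * w i - Kh i t w) omega_gt0).
  - move=> i; apply/subspace_continuousP => t; rewrite /= in_itv/= andbT => t0.
    apply: cvgB; last exact: nonneg_cvg_within.
    by apply: cvgM; [exact: nonneg_cvg_within|exact: cvg_cst].
  - by move=> i t t0; rewrite betah_per// Kh_per.
  move=> i t t0 to; have /(_ t i) := Hw; rewrite t0 to => /(_ isT) h1.
  (* Homogeneity of the gain passes to the ratios of weights in which (vi) is written. *)
  have -> : Kh i t w = w i * Kh i t (fun j => w j / w i).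
    rewrite /Kh -gain_scale; congr gain; apply/funext => j.
    by rewrite mulrC divfK// gt_eqF.
  rewrite [betah i t * _]mulrC -mulrBr mulr_gt0// subr_gt0.
  apply: le_lt_trans h1; rewrite le_eqVlt; apply/orP; left; apply/eqP.
  apply: eq_bigr => j _; apply: eq_bigr => l _; congr (_ + _); apply: eq_bigr => k _; ring.
(* [A] need not be periodic: it is replaced by its values on one period. *)
have [A' HA'] : exists A' : 'I_n -> R -> R, forall i t, 0 <= t ->
    (forall u, A' i t * a i t u ^+ 2 <= dta i t u) /\
    - (betah i t + A' i t) * a_lo i * v i + Kh i t (fun j => a_up j * v j) < 0.
  have Hp (p : 'I_n * R) : exists y, 0 <= p.2 ->
      (forall u, y * a p.1 p.2 u ^+ 2 <= dta p.1 p.2 u) /\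
      - (betah p.1 p.2 + y) * a_lo p.1 * v p.1 + Kh p.1 p.2 (fun j => a_up j * v j) < 0.
    case: p => i t /=; have [t0|t0] := leP 0 t; last by exists 0.
    have [r [m [-> r0 ro]]] := period_decomposition omega_gt0 t0.
    exists (A i r) => _; split.
      move=> u; rewrite (periodic_iter o0 (a_per i u))//.
      rewrite (periodic_derivative (df := fun s => dta i s u) m o0 (a_per i u) _ r0) ?dta_lb//.
      by move=> s; exact: dtaP.
    rewrite (periodic_iter o0 (betah_per i))// (periodic_iter o0 (Kh_per i _))//.
    have /(_ r i) := Hv; rewrite r0 ro => /(_ isT) h1.
    have -> : Kh i r (fun j => a_up j * v j) = v i * Kh i r (fun j => a_up j * (v j / v i)).
      rewrite /Kh -gain_scale; congr gain; apply/funext => j.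
      by rewrite mulrCA [v i * _]mulrC divfK// gt_eqF.
    rewrite [_ * v i]mulrC -mulrDr pmulr_rlt0//.
    apply: le_lt_trans h1; rewrite le_eqVlt; apply/orP; left; apply/eqP; congr (_ + _).
    apply: eq_bigr => j _; apply: eq_bigr => l _; congr (_ + _); apply: eq_bigr => k _; ring.
  have [A' HA'] := choice Hp.
  by exists (fun i t => A' (i, t)) => i t; exact: (HA' (i, t)).
(* Hypothesis (v) is stated on one period; periodicity of [betah] and [bh] carries it to all
   times. *)
have bh_mono' i t u v' : 0 <= t -> v' <= u -> betah i t * (u - v') <= bh i t u - bh i t v'.
  move=> t0; have [r [m [-> r0 ro]]] := period_decomposition omega_gt0 t0.
  rewrite (periodic_iter o0 (betah_per i))// (periodic_iter o0 (bh_per i u))//.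
  rewrite (periodic_iter o0 (bh_per i v'))//; apply: ratio_mono => uv.
  by have /andP[] : betah i r <= (bh i r u - bh i r v') / (u - v') <= betahs i r
    by apply: bh_mono; rewrite ?r0.
apply: (@damped_attractivity R n a b bh N Nh beta betah A' K Kh a_lo a_up dta omega kappa v w) => //.
- by move=> i t u /(HA' i)[h1 _]; exact: h1.
- by move=> i t t0; rewrite ltW// betah_gt0.
- apply: (@finite_bound _ _ (fun i C => forall t, 0 <= t -> betah i t <= C)).
    by move=> i C C' CC hC t t0; exact: le_trans (hC t t0) CC.
  move=> i; have [C HC] := nonneg_periodic_bounded omega_gt0 (betah_cont i) (betah_per i).
  by exists C => t t0; exact: le_trans (ler_norm _) (HC t t0).
- by move=> i t u v' t0; apply: (ratio_mono (f := b i t)) => uv; exact: b_mono.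
- by move=> i; exact: (net_continuous (xi := xi) (txi := txi)).
- by move=> i; exact: (net_continuous (xi := xi) (txi := txi)).
- by move=> i phi; exact: net_periodic.
- by move=> i t phi psi M e t0 cp cs bp bs pe; apply: net_lipschitz bp bs pe.
- by move=> i t phi psi M e t0 cp cs bp bs pe; apply: net_lipschitz bp bs pe.
- by move=> i t e e0; exact: gain_ge0.
- by move=> i t e r; exact: gain_scale.
- by move=> i t e r; exact: gain_scale.
- by move=> i e; exact: gain_continuous.
- by move=> i e; exact: nonneg_periodic_bounded omega_gt0 (Kh_cont i e) (Kh_per i e).
- by move=> i t /(HA' i)[].
- by move=> i e; exact: gain_asymptotic.
- move=> i x M T B T0 cx xM xB.
  exact: (net_asymptotic g_cont tg_cont eta_weight teta_weight gam1_gt0 gam2_gt0 mu1_gt0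
    mu2_gt0 xi_gt0 txi_gt0 h_lip f_lip g_lip tg_lip G_lip H_lip i omega_gt0 T0 ch_cont dh_cont
    tauh_cont ttauh_cont ch_per dh_per tauh_per ttauh_per c_lim d_lim tau_lim ttau_lim I_lim
    cx xM xB).
Qed.
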